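(* Fix $\Delta>0$, $g>0$, and let $\delta_n^\pm=n^{1/4}\big(E_n^\pm-(n-g^2)\big)$. For any subinterval $[\alpha,\beta]\subset\left[-\frac{\Delta}{\sqrt{2\pi g}},\frac{\Delta}{\sqrt{2\pi g}}\right]$ and for each choice of sign, $$\lim_{N\to\infty}\frac1N\#\{n\le N:\ \delta_n^\pm\in[\alpha,\beta]\}=\int_\alpha^\beta\frac{dy}{\pi\sqrt{\frac{2\pi g}{\Delta^2}-y^2}}.$$
   Context: The quantum Rabi model is the Hamiltonian $H=a^\dagger a+\Delta\sigma_z+g\sigma_x(a+a^\dagger)$ acting on $L^2(\mathbb R)\otimes\mathbb C^2$, where $a^\dagger,a$ are the creation and annihilation operators of the harmonic oscillator (frequency $1$), $\sigma_x,\sigma_z$ are the Pauli matrices, $\Delta>0$, $g>0$. $H$ commutes with the parity operator $P=(-1)^{a^\dagger a}\sigma_z$, and on each of the $\pm1$-eigenspaces of $P$ it is unitarily equivalent to the Jacobi matrix (indices $k\ge0$) with diagonal entries $d_\pm(k)=k\pm(-1)^k\Delta$ and off-diagonal entries $a(k)=g\sqrt k$. The spectrum in each parity class is discrete and simple; its eigenvalues are labeled in increasing order $E^\pm_n$, with indexing normalized so that $E^\pm_n=n-g^2+o(1)$. (Known background: Boutet de Monvel and Zielinski proved $E_n^\pm=n-g^2\mp\frac{\Delta}{\sqrt{2\pi g}}\frac{(-1)^n\cos(4g\sqrt n-\pi/4)}{n^{1/4}}+O(n^{-1/2+o(1)})$.)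
   Formalization: The limiting density is 1/(π√(Δ²/(2πg) − y²)) instead of the printed 1/(π√(2πg/Δ² − y²)), which does not have total mass 1 on [−Δ/√(2πg), Δ/√(2πg)] (or is undefined there) unless Δ² = 2πg. *)

(* Defs.v *)
From HB Require Import structures.
From mathcomp Require Import all_boot all_order all_algebra.
From mathcomp Require Import all_classical all_reals all_analysis.
Set Implicit Arguments. Unset Strict Implicit. Unset Printing Implicit Defensive.
Import Order.TTheory GRing.Theory Num.Theory.
Import numFieldNormedType.Exports.
Local Open Scope classical_set_scope.
Local Open Scope ring_scope.

Definition rabi_a {R : realType} (g : R) (k : nat) : R := g * Num.sqrt (k%:R).

Definition rabi_d {R : realType} (s : bool) (Delta : R) (k : nat) : R :=
  k%:R + (if s then 1 else -1) * (-1) ^+ k * Delta.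

(* E is an eigenvalue of the Jacobi matrix J_pm acting on l^2(N):
   there is a nonzero square-summable u with (J u)_k = E u_k for all k, where
   (J u)_k = a(k) u_{k-1} + d(k) u_k + a(k+1) u_{k+1}  (a(0) = 0). *)
Definition rabi_eigenvalue {R : realType} (s : bool) (Delta g E : R) : Prop :=
  exists u : nat -> R,
    (exists k, u k != 0) /\
    cvgn (series (fun k => u k ^+ 2)) /\
    (forall k : nat,
        rabi_a g k * u k.-1 + rabi_d s Delta k * u k + rabi_a g k.+1 * u k.+1
        = E * u k).

Definition rabi_delta {R : realType} (g : R) (E : int -> R) (n : nat) : R :=
  (n%:R `^ (4%:R^-1)) * (E n%:Z - (n%:R - g ^+ 2)).

(* Main.v *)
Require Import Defs.
From HB Require Import structures.
From mathcomp Require Import all_boot all_order all_algebra.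
From mathcomp Require Import all_classical all_reals all_analysis.
From mathcomp Require Import measurable_realfun.
From mathcomp Require Import ring lra zify.
Set Implicit Arguments.
Unset Strict Implicit.
Unset Printing Implicit Defensive.
Import Order.TTheory GRing.Theory Num.Theory.
Import numFieldNormedType.Exports.
Local Open Scope classical_set_scope.
Local Open Scope ring_scope.

(** Put D(t) = exp(t(a^+ - a)). In the eigenbasis D(-g)|m> of the displaced
    oscillator, whose unperturbed eigenvalues are m - g^2, the coefficients c of
    an eigenvector for E satisfy (E - m + g^2) c_m = +-Delta (V c)_m, where
    V_(m,l) = (-1)^l <m|D(2g)|l> is unitary. An energy argument for the
    three-term recurrence of D gives V_(m,l) = O(n^(-1/4)) for m, l within
    O(n^(3/8)) of n, which is enough for first-order perturbation theory:
    E_n = n - g^2 +- Delta V_(n,n) + o(n^(-1/4)).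

    The function q(t) = <n|D(t)|n> solves q'' + q'/t + (4n + 2) q = t^2 q.
    Comparing it through a Gronwall estimate with (sin th / th)^(1/2) P_(2k)(cos th)
    up to th = pi/2, where the Legendre polynomial is given by a Wallis product,
    and then with a cosine over less than one period, yields
    n^(1/4) q(t) = cos(t (4n + 2)^(1/2) - pi/4) / (pi t)^(1/2) + o(1).
    Hence delta_n / A is, up to o(1) and signs, the cosine of the phase
    2g (4n + 2)^(1/2) - pi/4, with A = Delta / (2 pi g)^(1/2).

    This phase grows slowly with n, so that it is equidistributed modulo 2 pi:
    the indices whose phase lies in a given arc form intervals of integers, which
    are counted and summed. The law of the cosine of a uniform angle is the arcsine
    law. Only upper bounds for the counting functions are needed, the lower bound
    coming from the two complementary intervals. *)

(** * Matrix elements of displacement operators *)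

Section displacement.
Context {R : realType}.
Implicit Types (s t : R) (m n k : nat).

(** The normalization E_n = n - g^2 + o(1) isolates one unperturbed level: the shift is eventually
    at most 1/2, so every other denominator is at least half of an integer gap. Contributions of the
    other levels are cut at distance K from n. Inside, two factors of size n^(-1/4) leave O(K^(1/2)
    n^(-1/2)); outside, the denominators alone give O(1/K). Both are o(n^(-1/4)) when K lies well
    between n^(1/4) and n^(1/2), and the energy argument works up to a small multiple of n^(1/2);
    n^(3/8) is the middle. For q, amplitude and phase must be carried from the singular point 0
    through about n^(1/2) periods, so the comparison function has to be regular at 0 and explicit at
    the other end. A Legendre polynomial of even degree is both: at a right angle its value is a
    central binomial coefficient over a power of 4, up to sign, and its derivative vanishes. The
    variable is rescaled so that the frequencies agree, and the degree is chosen so that th = pi/2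
    falls on the last extremum of the expected cosine before t. The last stretch then starts from an
    extremum, and no sine component appears. *)

Definition sqn n : R := Num.sqrt n%:R.

Lemma sqn_sqr n : sqn n * sqn n = n%:R.
Proof. by rewrite -expr2 sqr_sqrtr // ler0n. Qed.

Lemma sqn_ge0 n : 0 <= sqn n.
Proof. exact: sqrtr_ge0. Qed.

Lemma sqnS_gt0 n : 0 < sqn n.+1.
Proof. by rewrite sqrtr_gt0 ltr0n. Qed.

Lemma sqnS_neq0 n : sqn n.+1 != 0.
Proof. by rewrite gt_eqF // sqnS_gt0. Qed.

Lemma sqn0 : sqn 0 = 0.
Proof. by rewrite /sqn sqrtr0. Qed.

(* [displ t m n] is the matrix element <m| exp(t(a^+ - a)) |n> of the
   displacement operator in the number basis. *)
Fixpoint displ t m n : R :=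
  if n is n'.+1 then
    (sqn m * displ t m.-1 n' - t * displ t m n') / sqn n'.+1
  else expR (- (t ^+ 2 / 2)) * (t ^+ m / Num.sqrt (m`!)%:R).

Lemma sqrt_fact m : Num.sqrt (m.+1`!)%:R = sqn m.+1 * Num.sqrt (m`!)%:R :> R.
Proof. by rewrite factS natrM sqrtrM // ler0n. Qed.

Lemma sqrt_fact_gt0 m : 0 < Num.sqrt (m`!)%:R :> R.
Proof. by rewrite sqrtr_gt0 ltr0n fact_gt0. Qed.

(** For the displacement operator D this is D a^+ = (a^+ - t) D. At [m = 0] the truncated [m.-1] is
    harmless because [sqn 0 = 0]. *)
Lemma displ_creation t m n :
  sqn n.+1 * displ t m n.+1 = sqn m * displ t m.-1 n - t * displ t m n.
Proof. by rewrite /= mulrC divfK // sqnS_neq0. Qed.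

Lemma displ_annihilation t m n :
  sqn m.+1 * displ t m.+1 n = sqn n * displ t m n.-1 + t * displ t m n.
Proof.
elim: n m => [|n IH] m.
  rewrite sqn0 mul0r add0r /= sqrt_fact (exprS t m).
  have := sqnS_neq0 m; have := lt0r_neq0 (sqrt_fact_gt0 m).
  by move=> h1 h2; field; rewrite h1 h2.
apply: (mulfI (sqnS_neq0 n)); rewrite mulrCA displ_creation mulrBr mulrDr.
rewrite [in RHS](mulrCA _ t) (displ_creation t m n) (mulrA _ _ (displ t m _)) sqn_sqr.
have e1 : m%:R * displ t m n = sqn n * sqn m * displ t m.-1 n.-1
     + t * sqn m * displ t m.-1 n.
  case: m => [|m] /=; first by rewrite sqn0 !(mul0r, mulr0) addr0.
  by rewrite -sqn_sqr -mulrA IH; ring.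
have e2 : sqn n * sqn m * displ t m.-1 n.-1 = n%:R * displ t m n
     + t * sqn n * displ t m n.-1.
  case: n {IH e1} => [|n]; first by rewrite sqn0 !(mul0r, mulr0) addr0.
  have := displ_creation t m n; rewrite -!pred_Sn -(sqn_sqr n.+1) => e.
  by rewrite -2!mulrA e; ring.
rewrite (mulrCA _ t) IH mulrA sqn_sqr -pred_Sn.
rewrite -!natr1; lra.
Qed.

(** The vacuum entry and the ladder relations determine the whole matrix. Transposition, parity and
    the group law are all obtained by checking these relations for a candidate [X]. *)
Lemma displ_uniq t (X : nat -> nat -> R) :
  X 0%N 0%N = displ t 0 0 ->
  (forall m, sqn m.+1 * X m.+1 0%N = t * X m 0%N) ->
  (forall m n, sqn n.+1 * X m n.+1 = sqn m * X m.-1 n - t * X m n) ->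
  forall m n, X m n = displ t m n.
Proof.
move=> X0 Xa Xc m n; elim: n m => [|n IH] m.
  elim: m => [//|m IH]; apply: (mulfI (sqnS_neq0 m)).
  by rewrite Xa IH displ_annihilation sqn0 mul0r add0r.
by apply: (mulfI (sqnS_neq0 n)); rewrite Xc displ_creation !IH.
Qed.

Lemma displ_tr t m n : displ (- t) n m = displ t m n.
Proof.
apply: (@displ_uniq t (fun m n => displ (- t) n m)) => [|k|k l] /=.
- by rewrite sqrrN !expr0.
- have := displ_creation (- t) 0 k => /= ->.
  by rewrite sqn0 mul0r sub0r mulNr opprK.
- by rewrite displ_annihilation mulNr.
Qed.

Lemma displN t m n : displ (- t) m n = (-1) ^+ (m + n) * displ t m n.
Proof.
apply/esym; apply: (@displ_uniq (- t)
  (fun m n => (-1) ^+ (m + n) * displ t m n)) => [|k|k l].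
- by rewrite addn0 !expr0 mul1r /= sqrrN !expr0.
- rewrite mulrCA displ_annihilation sqn0 mul0r add0r !addn0 exprS; ring.
- rewrite mulrCA displ_creation addnS exprS.
  case: k => [|k] /=; first by rewrite sqn0; ring.
  by rewrite addSn exprS; ring.
Qed.

Lemma displ0 m n : displ 0 m n = (m == n)%:R.
Proof.
apply/esym; apply: (@displ_uniq 0 (fun m n => (m == n)%:R)) => [|k|k l] /=.
- by rewrite expr0n /= mul0r oppr0 expR0 mul1r expr0 fact0 sqrtr1 divr1.
- by rewrite mulr0 mul0r.
- case: k => [|k] /=; first by rewrite sqn0 mulr0 !mul0r subrr.
  by rewrite mul0r subr0 eqSS; case: eqP => [->//|_]; rewrite !mulr0.
Qed.

(** This is (a^+ - t)(a - t) D = D a^+ a: the columns of the matrix are the eigenvectors of a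
    displaced oscillator. For fixed [n] it is also a three-term recurrence in [m]. *)
Lemma displ_jacobi t m n :
  - t * sqn m * displ t m.-1 n + (m%:R + t ^+ 2) * displ t m n
   - t * sqn m.+1 * displ t m.+1 n = n%:R * displ t m n.
Proof.
rewrite -[t * sqn m.+1 * _]mulrA displ_annihilation.
have -> : n%:R * displ t m n =
    sqn m * (sqn n * displ t m.-1 n.-1) - t * (sqn n * displ t m n.-1).
  case: n => [|n]; first by rewrite sqn0; ring.
  rewrite -sqn_sqr -mulrA displ_creation /=; ring.
case: m => [|m] /=; first by rewrite sqn0; ring.
rewrite -(sqn_sqr m.+1).
have := displ_annihilation t m n => e.
rewrite [sqn n * displ t m n.-1](_ : _ = sqn m.+1 * displ t m.+1 n - t * displ t m n).
  by ring.
by rewrite e; ring.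
Qed.

End displacement.

(** * Square-summable sequences *)

Section square_summable.
Context {R : realType}.
Implicit Types (x y z u : nat -> R) (a b : R).

Definition l2 x := cvgn (series (fun k => x k ^+ 2)).

Definition ip x y : R := limn (series (fun k => x k * y k)).

Lemma eq_is_cvg_series (f h : nat -> R) :
  f =1 h -> cvgn (series f) -> cvgn (series h).
Proof. by move=> /funext ->. Qed.

Lemma is_cvg_ip x y : l2 x -> l2 y -> cvgn (series (fun k => x k * y k)).
Proof.
move=> hx hy; apply: normed_cvg.
apply: (@series_le_cvg _ _ (fun k => x k ^+ 2 + y k ^+ 2)) => [n|n|n|].
- by rewrite /= normr_ge0.
- by rewrite addr_ge0 // sqr_ge0.
- rewrite /= normrM -(real_normK (num_real (x n))) -(real_normK (num_real (y n))).
  have := sqr_ge0 (`|x n| - `|y n|); have := normr_ge0 (x n).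
  have := normr_ge0 (y n); nra.
- exact: (is_cvg_seriesD hx hy).
Qed.

Lemma cvg_ip x y : l2 x -> l2 y ->
  series (fun k => x k * y k) @ \oo --> ip x y.
Proof. exact: is_cvg_ip. Qed.

Lemma ipC x y : ip x y = ip y x.
Proof. by congr (limn (series _)); apply/funext => k; rewrite mulrC. Qed.

Lemma l2Z a x : l2 x -> l2 (fun k => a * x k).
Proof.
move=> /(@is_cvg_seriesZ _ _ (a ^+ 2)); apply: eq_is_cvg_series => k.
by rewrite exprMn.
Qed.

Lemma l2D x y : l2 x -> l2 y -> l2 (fun k => x k + y k).
Proof.
move=> hx hy.
have hxy := @is_cvg_seriesZ _ _ 2 (is_cvg_ip hx hy).
have := is_cvg_seriesD (is_cvg_seriesD hx hy) hxy; apply: eq_is_cvg_series => k; rewrite !fctE /GRing.scale /=; ring.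
Qed.

Lemma l2_norm x y : (forall k, `|x k| = `|y k|) -> l2 x -> l2 y.
Proof.
move=> e; apply: eq_is_cvg_series => k.
by rewrite -[LHS]real_normK ?num_real// e real_normK ?num_real.
Qed.

Lemma l2_le x y : (forall k, `|x k| <= `|y k|) -> l2 y -> l2 x.
Proof.
move=> xy; apply: series_le_cvg => k; rewrite ?sqr_ge0//.
by rewrite -[leLHS]real_normK ?num_real// -[leRHS]real_normK ?num_real// ler_sqr ?nnegrE.
Qed.

Lemma ipDl x y z : l2 x -> l2 y -> l2 z ->
  ip (fun k => x k + y k) z = ip x z + ip y z.
Proof.
move=> hx hy hz; rewrite -lim_seriesD; [|exact: is_cvg_ip..].
by congr (limn (series _)); apply/funext => k; rewrite mulrDl.
Qed.

Lemma ipZl a x z : l2 x -> l2 z -> ip (fun k => a * x k) z = a * ip x z.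
Proof.
move=> hx hz; rewrite -[RHS]/(a *: _) -lim_seriesZ; last exact: is_cvg_ip.
by congr (limn (series _)); apply/funext => k; rewrite -mulrA.
Qed.

Lemma l20 : l2 (fun=> 0).
Proof.
rewrite /l2 (_ : series _ = fun=> 0); first exact: is_cvg_cst.
by apply/funext => n; rewrite seriesEnat /= big1 // => i _; rewrite expr0n.
Qed.

Lemma ip0l z : ip (fun=> 0) z = 0.
Proof.
rewrite /ip (_ : series _ = fun=> 0); first by rewrite lim_cst.
by apply/funext => n; rewrite seriesEnat /= big1 // => i _; rewrite mul0r.
Qed.

Lemma l2_sum (c : nat -> R) (psi : nat -> nat -> R) n :
  (forall l, l2 (psi l)) -> l2 (fun k => \sum_(0 <= l < n) c l * psi l k).
Proof.
move=> h; elim: n => [|n IH].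
  by under eq_fun do rewrite big_nil; exact: l20.
under eq_fun do rewrite big_nat_recr //=.
by apply: l2D => //; exact: l2Z.
Qed.

Lemma ip_suml (c : nat -> R) (psi : nat -> nat -> R) z n :
  (forall l, l2 (psi l)) -> l2 z ->
  ip (fun k => \sum_(0 <= l < n) c l * psi l k) z =
  \sum_(0 <= l < n) c l * ip (psi l) z.
Proof.
move=> h hz; elim: n => [|n IH].
  by under eq_fun do rewrite big_nil; rewrite ip0l big_nil.
under eq_fun do rewrite big_nat_recr //=.
rewrite ipDl ?ipZl ?IH ?big_nat_recr //; [exact: l2_sum|exact: l2Z].
Qed.

Lemma psum_le_ip x n : l2 x -> \sum_(0 <= k < n) x k ^+ 2 <= ip x x.
Proof.
move=> hx; rewrite -[leLHS]/(series (fun k => x k ^+ 2) n).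
apply: nondecreasing_cvgn_le => //.
by apply: nondecreasing_series => k _; rewrite sqr_ge0.
Qed.

Lemma ip_ge0 x : l2 x -> 0 <= ip x x.
Proof. by move=> /(@psum_le_ip _ 0); rewrite big_nil. Qed.

Lemma sqr_le_ip x k : l2 x -> x k ^+ 2 <= ip x x.
Proof.
move=> /(@psum_le_ip _ k.+1); rewrite big_nat_recr //=; apply: le_trans.
by rewrite lerDr sumr_ge0 // => i _; rewrite sqr_ge0.
Qed.

Lemma l2_bounded x (M : R) :
  (forall n, \sum_(0 <= k < n) x k ^+ 2 <= M) -> l2 x /\ ip x x <= M.
Proof.
move=> h.
have nd : nondecreasing_seq (series (fun k => x k ^+ 2)).
  by apply: nondecreasing_series => k _; rewrite sqr_ge0.
have hx : l2 x.
  by apply: nondecreasing_is_cvgn => //; exists M => _ [n _ <-]; exact: h.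
split => //; apply: limr_le; first exact: is_cvg_ip.
by apply: nearW => n; under [series _]eq_fun do [].
Qed.

Lemma CauchySchwarz_psum x y n :
  (\sum_(0 <= k < n) x k * y k) ^+ 2 <=
  (\sum_(0 <= k < n) x k ^+ 2) * (\sum_(0 <= k < n) y k ^+ 2).
Proof.
elim: n => [|n IH]; first by rewrite !big_nil mul0r expr0n.
rewrite !big_nat_recr //=; move: IH.
have := (@sumr_ge0 R _ (index_iota 0 n) xpredT (fun k => x k ^+ 2)
  (fun k _ => sqr_ge0 (x k))).
have := (@sumr_ge0 R _ (index_iota 0 n) xpredT (fun k => y k ^+ 2)
  (fun k _ => sqr_ge0 (y k))).
set P := \sum_(_ <= _ < _) _ * _; set X := \sum_(_ <= _ < _) x _ ^+ 2.
set Y := \sum_(_ <= _ < _) y _ ^+ 2 => Y0 X0 IH.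
set p := x n; set q := y n.
suff : 2 * P * (p * q) <= X * q ^+ 2 + Y * p ^+ 2 by move: IH; nra.
have A0 : 0 <= X * q ^+ 2 by rewrite mulr_ge0 // sqr_ge0.
have B0 : 0 <= Y * p ^+ 2 by rewrite mulr_ge0 // sqr_ge0.
apply: le_trans (ler_norm _) _.
rewrite -(@ler_pXn2r _ 2) ?nnegrE ?normr_ge0 ?addr_ge0 // real_normK ?num_real//.
have : P ^+ 2 * (p * q) ^+ 2 <= (X * Y) * (p * q) ^+ 2.
  by rewrite ler_wpM2r // sqr_ge0.
have := sqr_ge0 (X * q ^+ 2 - Y * p ^+ 2).
nra.
Qed.

Lemma CauchySchwarz x y : l2 x -> l2 y -> ip x y ^+ 2 <= ip x x * ip y y.
Proof.
move=> hx hy.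
have h : (fun n => (series (fun k => x k * y k) n) ^+ 2) @ \oo --> ip x y ^+ 2.
  by rewrite expr2; apply: cvgM; exact: cvg_ip.
apply: (cvgr_to_le h); apply: nearW => n.
apply: le_trans (CauchySchwarz_psum x y n) _.
by apply: ler_pM; rewrite ?sumr_ge0 ?psum_le_ip // => i _; rewrite sqr_ge0.
Qed.

Lemma l2B x y : l2 x -> l2 y -> l2 (fun k => x k - y k).
Proof.
move=> hx /(@l2_norm _ (fun k => - y k)) hy; apply: l2D => //; apply: hy => k.
by rewrite normrN.
Qed.

Lemma ipBl x y z : l2 x -> l2 y -> l2 z ->
  ip (fun k => x k - y k) z = ip x z - ip y z.
Proof.
move=> hx hy hz; rewrite -lim_seriesB; [|exact: is_cvg_ip..].
by congr (limn (series _)); apply/funext => k; rewrite mulrBl.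
Qed.

Lemma ip_sqrB x y : l2 x -> l2 y ->
  ip (fun k => x k - y k) (fun k => x k - y k) = ip x x - 2 * ip x y + ip y y.
Proof.
move=> hx hy; have hs := l2B hx hy.
by rewrite ipBl // [ip x _]ipC [ip y _]ipC !ipBl // (ipC y x); ring.
Qed.

Section orthonormal_family.
Variable psi : nat -> nat -> R.
Hypothesis l2psi : forall l, l2 (psi l).
Hypothesis psiP : forall l l', ip (psi l) (psi l') = (l == l')%:R.

Definition proj u n k : R := \sum_(0 <= l < n) ip (psi l) u * psi l k.

Let ip_proj u z n : l2 z ->
  ip (proj u n) z = \sum_(0 <= l < n) ip (psi l) u * ip (psi l) z.
Proof. exact: ip_suml. Qed.

Let ip_res u n : l2 u ->
  ip (fun k => u k - proj u n k) (fun k => u k - proj u n k) =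
  ip u u - \sum_(0 <= l < n) ip (psi l) u ^+ 2.
Proof.
move=> hu; have hp : l2 (proj u n) by exact: l2_sum.
rewrite ip_sqrB // (ipC u (proj u n)) (ip_proj u n hu) (ip_proj u n hp).
have -> : \sum_(0 <= l < n) ip (psi l) u * ip (psi l) (proj u n) =
    \sum_(0 <= l < n) ip (psi l) u ^+ 2.
  apply: eq_big_nat => l /andP[_ ln]; rewrite (ipC _ (proj u n)) ip_proj // expr2; congr (_ * _).
  rewrite (bigD1_seq l) ?iota_uniq ?mem_index_iota //= psiP eqxx mulr1.
  by rewrite big1 ?addr0 // => i /negbTE il; rewrite psiP il mulr0.
under eq_bigr do rewrite -expr2; ring.
Qed.

Lemma Bessel u : l2 u ->
  l2 (fun l => ip (psi l) u) /\
  ip (fun l => ip (psi l) u) (fun l => ip (psi l) u) <= ip u u.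
Proof.
move=> hu; apply: l2_bounded => n; rewrite -subr_ge0 -ip_res //.
apply: ip_ge0; apply: (l2B hu); exact: l2_sum.
Qed.

(** Completeness enters only through the vector [x], as equality in its Bessel inequality: then
    [proj x n] converges to [x] in norm, and Cauchy-Schwarz transfers this to the pairing with
    [u]. *)
Lemma Parseval x u : l2 x -> l2 u ->
  ip (fun l => ip (psi l) x) (fun l => ip (psi l) x) = ip x x ->
  ip x u = ip (fun l => ip (psi l) x) (fun l => ip (psi l) u).
Proof.
move=> hx hu hP; have [lx _] := Bessel hx; have [lu _] := Bessel hu.
set xi := fun l => ip (psi l) x; set c := fun l => ip (psi l) u.
have cv := cvg_ip lx lu; rewrite -/xi -/c in cv hP lx *.
have key n : (ip x u - series (fun l => xi l * c l) n) ^+ 2 <=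
    (ip x x - series (fun l => xi l * xi l) n) * ip u u.
  have hp : l2 (proj x n) by exact: l2_sum.
  have -> : series (fun l => xi l * xi l) n = \sum_(0 <= l < n) xi l ^+ 2 by [].
  have -> : ip x u - series (fun l => xi l * c l) n =
      ip (fun k => x k - proj x n k) u.
    by rewrite ipBl ?ip_proj.
  by rewrite -ip_res //; apply: CauchySchwarz => //; exact: l2B.
have cL : (fun n => (ip x u - series (fun l => xi l * c l) n) ^+ 2) @ \oo -->
    (ip x u - ip xi c) ^+ 2.
  have h : (fun n => ip x u - series (fun l => xi l * c l) n) @ \oo -->
    (ip x u - ip xi c) by apply: cvgB => //; exact: cvg_cst.
  exact: (cvgM h h).
have cR : (fun n => (ip x x - series (fun l => xi l * xi l) n) * ip u u) @ \oo
    --> (0 : R).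
  have h : (fun n => ip x x - series (fun l => xi l * xi l) n) @ \oo -->
      ip x x - ip xi xi by apply: cvgB; [exact: cvg_cst|exact: cvg_ip].
  rewrite hP subrr in h.
  have : (fun n => (ip x x - series (fun l => xi l * xi l) n) * ip u u) @ \oo
    --> 0 * ip u u by apply: cvgM h _; exact: cvg_cst.
  by rewrite mul0r.
have : (ip x u - ip xi c) ^+ 2 <= 0.
  by apply: (ler_cvg_to cL cR); apply: nearW => n; exact: key.
by move=> h; apply/eqP; rewrite -subr_eq0 -sqrf_eq0 eq_le h sqr_ge0.
Qed.

End orthonormal_family.
End square_summable.

(** * Unitarity and group law of the displacement matrices *)

Section displacement_group.
Context {R : realType}.
Implicit Types (s t g : R) (m n k : nat).

(** Each creation step produces a factor [m] relative to the square root of the factorial. It is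
    absorbed by [m <= 2 ^ m], at the price of doubling [r] with every [n]. *)
Lemma displ_decay t n : exists C r : R, [/\ 0 <= C, 1 <= r &
  forall m, `|displ t m n| <= C * r ^+ m / Num.sqrt (m`!)%:R].
Proof.
elim: n => [|n [C [r [C0 r1 H]]]].
  exists 1, (`|t| + 1); split; rewrite ?ler01 // ?lerDr // => m.
  rewrite /= normrM mul1r ger0_norm ?expR_ge0 // normrM normrX.
  rewrite normfV (ger0_norm (ltW (sqrt_fact_gt0 m))).
  rewrite -[leRHS]mul1r ler_pM ?expR_ge0 //.
  - by rewrite expR_le1 oppr_le0 mulr_ge0 ?sqr_ge0 // invr_ge0.
  - rewrite ler_pM2r ?invr_gt0 ?sqrt_fact_gt0 //.
    by rewrite lerXn2r ?nnegrE ?addr_ge0 // lerDl.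
exists (C + `|t| * C), (2 * r); split => [||m].
- by rewrite addr_ge0 // mulr_ge0.
- by rewrite -[leLHS]mulr1 ler_pM // ler1n.
have r0 : 0 <= r by apply: le_trans r1.
have f0 := @sqrt_fact_gt0 R m.
have rm : r ^+ m <= (2 * r) ^+ m.
  by rewrite lerXn2r ?nnegrE ?mulr_ge0 // ler_peMl // ler1n.
have sn1 : 1 <= sqn n.+1 :> R by rewrite -sqrtr1 ler_sqrt ?ler1n.
rewrite /= normrM normfV (ger0_norm (sqn_ge0 _)) ler_pdivrMr ?sqnS_gt0 //.
apply: le_trans (ler_peMr _ sn1); last first.
  by rewrite divr_ge0 ?mulr_ge0 ?addr_ge0 ?mulr_ge0 ?exprn_ge0 ?mulr_ge0 // ltW.
rewrite mulrDl mulrDl; apply: le_trans (ler_normB _ _) _; apply: lerD.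
- rewrite normrM ger0_norm ?sqn_ge0 //.
  case: m f0 {rm} => [|m] f0.
    by rewrite sqn0 mul0r divr_ge0 ?mulr_ge0 // ltW.
  apply: (@le_trans _ _ (sqn m.+1 * (C * r ^+ m / Num.sqrt (m`!)%:R))).
    by rewrite ler_wpM2l ?sqn_ge0.
  rewrite [leLHS](_ : _ = C * (m.+1%:R * r ^+ m) / Num.sqrt (m.+1`!)%:R).
    rewrite ler_pM2r ?invr_gt0 // ler_wpM2l // exprMn.
    apply: ler_pM; rewrite ?ler0n ?exprn_ge0 //.
      by rewrite -natrX ler_nat ltnW // ltn_expl.
    by rewrite exprS ler_peMl // exprn_ge0.
  rewrite sqrt_fact -(@sqn_sqr R m.+1).
  have := @sqnS_neq0 R m; have := lt0r_neq0 (@sqrt_fact_gt0 R m).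
  by move=> h1 h2; field; rewrite h1 h2.
- rewrite normrM -!mulrA ler_wpM2l // mulrA.
  apply: le_trans (H m) _; rewrite ler_pM2r ?invr_gt0 // ler_wpM2l //.
Qed.

Lemma l2_displ t n : l2 (fun m => displ t m n).
Proof.
have [C [r [C0 r1 H]]] := displ_decay t n.
apply: (@l2_le _ _ (fun m => C * (r ^+ m / Num.sqrt (m`!)%:R))).
  move=> m; rewrite [leRHS]ger0_norm ?mulrA // divr_ge0 ?sqrtr_ge0 //.
  by rewrite mulr_ge0 // exprn_ge0 // (le_trans _ r1).
apply: l2Z; apply: eq_is_cvg_series (is_cvg_series_exp_coeff (r ^+ 2)) => m.
by rewrite /exp_coeff /= expr_div_n sqr_sqrtr ?ler0n // -!exprM mulnC.
Qed.

Arguments l2_displ : clear implicits.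

Lemma l2_displ_tr t m : l2 (fun n => displ t m n).
Proof.
by under eq_fun do rewrite -displ_tr; exact: l2_displ.
Qed.

Arguments l2_displ_tr : clear implicits.

Lemma l2_creation t n : l2 (fun m => sqn m * displ t m.-1 n).
Proof.
have := l2D (@l2Z _ (sqn n.+1) _ (l2_displ t n.+1)) (@l2Z _ t _ (l2_displ t n)).
apply: eq_is_cvg_series => m /=; rewrite [sqn n.+1 * _]displ_creation.
by rewrite subrK.
Qed.

Arguments l2_creation : clear implicits.

Lemma l2_annihilation t n : l2 (fun m => sqn m.+1 * displ t m.+1 n).
Proof.
have := l2D (@l2Z _ (sqn n) _ (l2_displ t n.-1)) (@l2Z _ t _ (l2_displ t n)).
by apply: eq_is_cvg_series => m /=; rewrite displ_annihilation.
Qed.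

Arguments l2_annihilation : clear implicits.

Lemma l2_creation_tr t m : l2 (fun n => sqn n * displ t m n.-1).
Proof.
have := l2D (@l2Z _ (sqn m.+1) _ (l2_displ_tr t m.+1)) (@l2Z _ (- t) _ (l2_displ_tr t m)).
by apply: eq_is_cvg_series => n /=; rewrite displ_annihilation mulNr addrK.
Qed.
Arguments l2_creation_tr : clear implicits.

(** Adjointness of a^+ and a; the boundary term at 0 vanishes because [sqn 0 = 0]. *)
Lemma ip_shift (x y : nat -> R) :
  l2 (fun k => sqn k * x k.-1) -> l2 y ->
  ip (fun k => sqn k * x k.-1) y = ip x (fun k => sqn k.+1 * y k.+1).
Proof.
move=> h1 h2; apply/esym/cvg_lim => //.
have := cvg_ip h1 h2; rewrite -(@cvg_shiftS _ (series _)) => h.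
apply: cvg_trans h; apply: near_eq_cvg; apply: nearW => n /=.
rewrite !seriesEnat /= big_nat_recl //= sqn0 !mul0r add0r.
by apply: eq_bigr => i _; rewrite mulrCA mulrA.
Qed.

Lemma ip_displ_base s t :
  ip (fun k => displ s 0 k) (fun k => displ t k 0) = displ (s + t) 0 0.
Proof.
pose c := expR (- (s ^+ 2 / 2)) * expR (- (t ^+ 2 / 2)) : R.
have -> : displ (s + t) 0 0 = c * expR (- (s * t)).
  by rewrite /c /= expr0 fact0 sqrtr1 divr1 mulr1 -!expRD; congr expR; field.
have h := @is_cvg_series_exp_coeff R (- (s * t)).
rewrite -[RHS]/(c *: limn (series (exp_coeff (- (s * t))))) -lim_seriesZ //.
congr (limn (series _)); apply/funext => k; rewrite -displ_tr /= sqrrN.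
rewrite /exp_coeff /= /GRing.scale /= -[- (s * t)]mulNr exprMn -[in RHS](sqr_sqrtr (ler0n R k`!)).
rewrite /c; have := lt0r_neq0 (@sqrt_fact_gt0 R k) => f0.
by rewrite /GRing.scale /=; field.
Qed.

(** D(s) D(t) = D(s + t). Adjointness moves a ladder operator through both factors, which add [s]
    and [t] to it in turn, so the product satisfies the relations characterizing D(s + t). *)
Lemma ip_displ s t m n :
  ip (fun k => displ s m k) (fun k => displ t k n) = displ (s + t) m n.
Proof.
apply: (@displ_uniq _ (s + t)
  (fun m n => ip (fun k => displ s m k) (fun k => displ t k n))).
- exact: ip_displ_base.
- move=> {}m; rewrite -(ipZl _ (l2_displ_tr s m.+1) (l2_displ t 0)).
  have -> : (fun k => sqn m.+1 * displ s m.+1 k) =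
      fun k => sqn k * displ s m k.-1 + s * displ s m k.
    by apply/funext => k; rewrite displ_annihilation.
  have hs := @l2Z _ s _ (l2_displ_tr s m).
  rewrite (ipDl (l2_creation_tr s m) hs (l2_displ t 0)).
  rewrite (@ip_shift (fun k => displ s m k) _ (l2_creation_tr s m) (l2_displ t 0)).
  have -> : (fun k => sqn k.+1 * displ t k.+1 0) = fun k => t * displ t k 0.
    by apply/funext => k; rewrite displ_annihilation sqn0 mul0r add0r.
  rewrite ipC (ipZl _ (l2_displ t 0) (l2_displ_tr s m)) ipC.
  by rewrite (ipZl _ (l2_displ_tr s m) (l2_displ t 0)) -mulrDl addrC.
- move=> {}m {}n; rewrite ipC -(ipZl _ (l2_displ t n.+1) (l2_displ_tr s m)).
  have -> : (fun k => sqn n.+1 * displ t k n.+1) =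
      fun k => sqn k * displ t k.-1 n - t * displ t k n.
    by apply/funext => k; rewrite displ_creation.
  have ht := @l2Z _ t _ (l2_displ t n).
  rewrite (ipBl (l2_creation t n) ht (l2_displ_tr s m)).
  rewrite (@ip_shift (fun k => displ t k n) _ (l2_creation t n) (l2_displ_tr s m)).
  have -> : (fun k => sqn k.+1 * displ s m k.+1) =
      fun k => sqn m * displ s m.-1 k - s * displ s m k.
    by apply/funext => k; rewrite displ_creation.
  have h1 := @l2Z _ (sqn m) _ (l2_displ_tr s m.-1).
  have h2 := @l2Z _ s _ (l2_displ_tr s m).
  rewrite ipC (ipBl h1 h2 (l2_displ t n)).
  rewrite (ipZl _ (l2_displ_tr s m.-1) (l2_displ t n)).
  rewrite (ipZl _ (l2_displ_tr s m) (l2_displ t n)).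
  rewrite (ipZl _ (l2_displ t n) (l2_displ_tr s m)).
  by rewrite [ip _ (fun k => displ s m k)]ipC; ring.
Qed.

Lemma displ_orthonormal t m n :
  ip (fun k => displ t k m) (fun k => displ t k n) = (m == n)%:R.
Proof.
have := ip_displ (- t) t m n; rewrite addNr displ0 => <-.
by congr ip; apply/funext => k; rewrite displ_tr.
Qed.

Lemma displ_orthonormal_tr t m n :
  ip (fun k => displ t m k) (fun k => displ t n k) = (m == n)%:R.
Proof.
rewrite -(displ_orthonormal (- t) m n).
by congr ip; apply/funext => k; rewrite displ_tr.
Qed.

Lemma sqr_displ_le1 t m n : displ t m n ^+ 2 <= 1.
Proof.
have := sqr_le_ip m (l2_displ t n).
by rewrite displ_orthonormal eqxx.
Qed.

End displacement_group.
Arguments l2_displ {R} t n.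
Arguments l2_displ_tr {R} t m.
Arguments l2_creation {R} t n.
Arguments l2_creation_tr {R} t m.
Arguments l2_annihilation {R} t n.

(** * Size of the matrix elements near the diagonal *)

Section displacement_bound.
Context {R : realType}.
Implicit Types (t : R) (m n k l : nat).

Lemma geometric_comparison (G : nat -> R) (d : R) (p q : nat) : 0 <= d ->
  (forall i, (p <= i < q)%N -> G i.+1 <= (1 + d) * G i /\ G i <= (1 + d) * G i.+1) ->
  forall i k, (p <= i)%N -> (i + k <= q)%N ->
  G (i + k)%N <= (1 + d) ^+ k * G i /\ G i <= (1 + d) ^+ k * G (i + k)%N.
Proof.
move=> d0 H i k pi; elim: k => [|k IH] ikq; first by rewrite addn0 expr0 !mul1r.
have [h1 h2] : G (i + k)%N <= (1 + d) ^+ k * G i /\ G i <= (1 + d) ^+ k * G (i + k)%N.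
  by apply: IH; lia.
have [|h3 h4] := H (i + k)%N; first by lia.
have d1 : 0 <= 1 + d by rewrite addr_ge0.
rewrite addnS; split.
  by apply: (le_trans h3); rewrite exprS -mulrA ler_wpM2l.
by apply: (le_trans h2); rewrite exprSr -mulrA ler_wpM2l // exprn_ge0.
Qed.

Section energy.
Variables (t : R) (l : nat).
Hypothesis t0 : 0 < t.
Let V m := displ t m l.
Let b m : R := t * sqn m.
Let x m : R := m%:R - l%:R + t ^+ 2.

(* For fixed [l] the three-term recurrence [recV] is, when [x m] is small
   compared with [b m], a slowly varying oscillation; this quadratic form is
   then comparable with [b m ^+ 2 * (V m ^+ 2 + V m.-1 ^+ 2)] and varies
   slowly, while the sum of the [V m ^+ 2] is 1. *)
Definition displ_energy m : R :=
  b m ^+ 2 * (V m ^+ 2 + V m.-1 ^+ 2) - x m * b m * V m * V m.-1.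
Let G := displ_energy.

Let b_sqr m : b m ^+ 2 = t ^+ 2 * m%:R.
Proof. by rewrite exprMn [sqn m ^+ 2]expr2 sqn_sqr. Qed.

Let recV m : b m.+1 * V m.+1 = x m * V m - b m * V m.-1.
Proof. by have := displ_jacobi t m l; rewrite /b /x /V; lra. Qed.

(** With [b] and [x] frozen the form would be conserved by the recurrence. The two extra terms come
    from [b m.+1 ^+ 2 - b m ^+ 2 = t ^+ 2] and [x m.+1 - x m = 1]. *)
Lemma displ_energyS m : G m.+1 = G m + t ^+ 2 * V m ^+ 2 - b m.+1 * V m.+1 * V m.
Proof.
rewrite /G /displ_energy -pred_Sn mulrDr -exprMn recV.
rewrite -[x m.+1 * _ * _]mulrA recV b_sqr -natr1.
have -> : x m.+1 = x m + 1 by rewrite /x -natr1; ring.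
have := b_sqr m; set bm := b m; set v := V m; set w := V m.-1.
by move=> e; ring: e.
Qed.

Lemma displ_energy_bounds m : `|x m| <= b m ->
  b m ^+ 2 * (V m ^+ 2 + V m.-1 ^+ 2) <= 2 * G m /\
  G m <= 2 * (b m ^+ 2 * (V m ^+ 2 + V m.-1 ^+ 2)).
Proof.
move=> hx; rewrite /G /displ_energy.
set v := V m; set w := V m.-1.
have b0 : 0 <= b m by apply: le_trans hx.
have : `|x m * b m * v * w| <= b m ^+ 2 * ((v ^+ 2 + w ^+ 2) / 2).
  have -> : x m * b m * v * w = (x m * b m) * (v * w) by ring.
  rewrite normrM [`|x m * b m|]normrM (ger0_norm b0) expr2.
  apply: ler_pM => //; [exact: mulr_ge0|exact: ler_wpM2r|].
  rewrite normrM -(real_normK (num_real v)) -(real_normK (num_real w)).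
  have := sqr_ge0 (`|v| - `|w|); lra.
have : 0 <= b m ^+ 2 * ((v ^+ 2 + w ^+ 2) / 2).
  by rewrite mulr_ge0 ?sqr_ge0 // mulr_ge0 ?addr_ge0 ?sqr_ge0 ?invr_ge0.
rewrite ler_norml => h /andP[h1 h2]; split; lra.
Qed.

(** The relative change per step is of order m^(-1/2), so the energy stays comparable with itself
    over a window of order m^(1/2) steps, in both directions. *)
Lemma displ_energy_step m (d : R) : (0 < m)%N ->
  `|x m| <= b m -> `|x m.+1| <= b m.+1 -> 2 / m%:R + 4 / b m <= d ->
  G m.+1 <= (1 + d) * G m /\ G m <= (1 + d) * G m.+1.
Proof.
move=> m0 hx hx1 hd.
have bm0 : 0 < b m by rewrite mulr_gt0 // sqrtr_gt0 ltr0n.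
have bm10 : 0 < b m.+1 by rewrite mulr_gt0 // sqnS_gt0.
have bb : b m <= b m.+1 by rewrite ler_pM2l // ler_sqrt ?ler0n // ler_nat.
have mR : 0 < m%:R :> R by rewrite ltr0n.
have [l1 _] := displ_energy_bounds hx; have [l2 _] := displ_energy_bounds hx1.
rewrite -pred_Sn in l2; have e := displ_energyS m; rewrite -/G in l1 l2 e *.
have G0 : 0 <= G m.
  rewrite -(@pmulr_rge0 _ 2) //; apply: le_trans l1.
  by rewrite mulr_ge0 ?addr_ge0 ?sqr_ge0.
have G1 : 0 <= G m.+1.
  rewrite -(@pmulr_rge0 _ 2) //; apply: le_trans l2.
  by rewrite mulr_ge0 ?addr_ge0 ?sqr_ge0.
have v2 := sqr_ge0 (V m); have w2 := sqr_ge0 (V m.-1); have u2 := sqr_ge0 (V m.+1).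
have f1 : t ^+ 2 * V m ^+ 2 <= 2 / m%:R * G m.
  rewrite [leRHS]mulrAC ler_pdivlMr //; apply: le_trans l1.
  by rewrite b_sqr mulrAC ler_wpM2l ?lerDl // mulr_ge0 ?sqr_ge0.
have f2 : t ^+ 2 * V m ^+ 2 <= 2 / m%:R * G m.+1.
  rewrite [leRHS]mulrAC ler_pdivlMr //; apply: le_trans l2.
  rewrite b_sqr mulrAC; apply: ler_pM => //; [by rewrite mulr_ge0 ?sqr_ge0|
    by rewrite ler_wpM2l ?sqr_ge0 // ler_nat|by rewrite lerDr].
have f3 : `|b m.+1 * V m.+1 * V m| <= 4 / b m * G m.
  rewrite recV [leRHS]mulrAC ler_pdivlMr // -[X in _ * X](gtr0_norm bm0) -normrM.
  apply: (@le_trans _ _ (2 * (b m ^+ 2 * (V m ^+ 2 + V m.-1 ^+ 2)))); last by lra.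
  have -> : (x m * V m - b m * V m.-1) * V m * b m =
     (x m * b m) * V m ^+ 2 - b m ^+ 2 * (V m * V m.-1) by ring.
  apply: (le_trans (ler_normB _ _)).
  have h1 : `|x m * b m * V m ^+ 2| <= b m ^+ 2 * V m ^+ 2.
    rewrite normrM (ger0_norm v2) ler_wpM2r // normrM (gtr0_norm bm0) expr2.
    by rewrite ler_wpM2r // ltW.
  have h2 : `|b m ^+ 2 * (V m * V m.-1)| <= b m ^+ 2 * (V m ^+ 2 + V m.-1 ^+ 2).
    rewrite normrM (ger0_norm (sqr_ge0 _)) ler_wpM2l ?sqr_ge0 // ler_norml.
    have := sqr_ge0 (V m - V m.-1); have := sqr_ge0 (V m + V m.-1).
    by move=> ? ?; apply/andP; split; nra.
  have h3 : 0 <= b m ^+ 2 * V m.-1 ^+ 2 by rewrite mulr_ge0 // sqr_ge0.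
  lra.
have f4 : `|b m.+1 * V m.+1 * V m| <= 4 / b m * G m.+1.
  rewrite [leRHS]mulrAC ler_pdivlMr //.
  apply: (@le_trans _ _ (b m.+1 ^+ 2 * (V m.+1 ^+ 2 + V m ^+ 2))); last by lra.
  rewrite -mulrA normrM (gtr0_norm bm10) -mulrA expr2 -mulrA ler_pM2l //.
  rewrite mulrC; apply: ler_pM => //; first exact: ltW.
  rewrite ler_norml.
  have := sqr_ge0 (V m.+1 - V m); have := sqr_ge0 (V m.+1 + V m).
  by move=> ? ?; apply/andP; split; nra.
have t2 : 0 <= t ^+ 2 * V m ^+ 2 by rewrite mulr_ge0 ?sqr_ge0.
have k1 : (2 / m%:R + 4 / b m) * G m <= d * G m by rewrite ler_wpM2r.
have k2 : (2 / m%:R + 4 / b m) * G m.+1 <= d * G m.+1 by rewrite ler_wpM2r.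
move: f3 f4; rewrite !ler_norml => /andP[f3 f3'] /andP[f4 f4'].
by split; lra.
Qed.

End energy.
Lemma psum_sqr_displ_le1 t l p w :
  \sum_(0 <= j < w) displ t (p + j) l ^+ 2 <= 1.
Proof.
have := psum_le_ip (p + w) (l2_displ t l).
rewrite displ_orthonormal eqxx; apply: le_trans.
rewrite [leRHS](@big_cat_nat _ _ _ p) ?leq_addr //= -{3}(add0n p).
rewrite big_addn addKn; apply: ler_wpDl.
  by rewrite sumr_ge0 // => i _; rewrite sqr_ge0.
by rewrite le_eqVlt; apply/orP; left; apply/eqP/eq_bigr => j _; rewrite addnC.
Qed.

(** The energy at [m], which dominates l V_m^2, is at most a constant times the energy at each of
    the following W indices, W being of order l^(1/2). Summing over them bounds W l V_m^2 by O(l),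
    since the column is a unit vector; hence V_m^2 = O(l^(-1/2)). *)
Lemma displ_near_diag t : 0 < t -> exists B c : R, [/\ 0 < B, 0 < c &
  forall l m, `|m%:R - l%:R| <= c * sqn l -> displ t m l ^+ 2 * sqn l <= B].
Proof.
(* The bound [t / 8] keeps [|x i| <= b i] on the window, where the energy is definite; [1 / 8] keeps
   [i] within a factor 2 of [l]. *)
move=> t0; pose c : R := Num.min (t / 8) (1 / 8).
have c0 : 0 < c by rewrite lt_min !divr_gt0.
have ct : c <= t / 8 by rewrite ge_min lexx.
have c8 : c <= 1 / 8 by rewrite ge_min lexx orbT.
(* [K] bounds the number of steps times their relative change, so the accumulated factor is at most
   [expR K]. Below the threshold [L0] the trivial bound [V ^+ 2 <= 1] suffices; above it the window
   contains a step and [t ^+ 2] is small against [b]. *)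
pose K : R := (4 + 8 / t) * c; pose L0 : R := 1 + 4 * t + c^-1.
have L00 : 0 < L0 by rewrite !addr_gt0 ?mulr_gt0 ?invr_gt0.
have K0 : 0 < 64 * expR K / c by rewrite divr_gt0 ?mulr_gt0 ?expR_gt0.
exists (L0 + 64 * expR K / c), c; split => //; first by rewrite addr_gt0.
move=> l m; set L := sqn l => ml; set v2 := _ ^+ 2.
have v20 : 0 <= v2 by rewrite sqr_ge0.
have LL : L * L = l%:R by exact: sqn_sqr.
have Lge0 : 0 <= L by exact: sqn_ge0.
have [LL0|L0L] := ltP L L0.
  apply: (@le_trans _ _ L0); last by rewrite lerDl ltW.
  by rewrite -[leRHS]mul1r ler_pM // ?sqr_displ_le1 // ltW.
have [L1 L4 cL] : [/\ 1 <= L, 4 * t <= L & 1 <= c * L].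
  have c1 : 0 < c^-1 by rewrite invr_gt0.
  split.
  - by apply: le_trans L0L; rewrite /L0 -addrA lerDl addr_ge0 ?mulr_ge0 // ltW.
  - by apply: le_trans L0L; rewrite /L0 addrAC lerDr addr_ge0 // ltW.
  - rewrite mulrC -ler_pdivrMr // div1r; apply: le_trans L0L.
    by rewrite /L0 lerDr addr_ge0 ?mulr_ge0 // ltW.
pose W := Num.truncn (c * L).
have cL0 : 0 <= c * L by rewrite mulr_ge0 // ltW.
have /andP[Wle Wgt] := truncn_itv cL0; rewrite -/W in Wle Wgt.
have tt0 : 0 <= t ^+ 2 by exact: sqr_ge0.
have W1 : (1 : R) <= W%:R by rewrite ler1n /W truncn_gt0.
have Wge : c * L / 2 <= W%:R by rewrite -natr1 in Wgt; lra.
have lL : L <= l%:R by rewrite -LL ler_peMl.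
have tL : c * L <= t / 8 * L by rewrite ler_wpM2r.
have L8 : c * L <= L / 8 by have := ler_wpM2r Lge0 c8; lra.
have tL4 : t ^+ 2 <= t * L / 4.
  by have := ler_wpM2l (ltW t0) L4; rewrite expr2; lra.
move: ml; rewrite ler_norml => /andP[ml1 ml2].
pose b i : R := t * sqn i; pose x i : R := i%:R - l%:R + t ^+ 2.
have inW i : (m <= i <= m + W)%N -> [/\ l%:R <= 2 * i%:R :> R, i%:R <= 2 * l%:R :> R,
    t * L / 2 <= b i & `|x i| <= b i].
  move=> /andP[]; rewrite -(ler_nat R) -(ler_nat R) natrD => i1 i2.
  have hl : l%:R <= 2 * i%:R :> R by lra.
  have hs : L / 2 <= sqn i.
    rewrite -(@ler_pXn2r _ 2) ?nnegrE ?sqn_ge0 ?divr_ge0 // [leRHS]expr2 sqn_sqr.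
    by have := LL; lra.
  have hb : t * L / 2 <= b i by rewrite -mulrA ler_wpM2l // ltW.
  split => //; first lra.
  apply: le_trans hb; rewrite /x; clear -i1 i2 ml1 ml2 Wle tL tL4 tt0.
  by rewrite ler_norml; apply/andP; split; lra.
have m0 : (0 < m)%N.
  have [|h _ _ _] := inW m; first by rewrite leqnn leq_addr.
  by rewrite -(ltr_nat R); lra.
have Lgt0 : 0 < L by apply: lt_le_trans L1.
pose d : R := (4 + 8 / t) / L.
have d0 : 0 <= d by rewrite divr_ge0 // addr_ge0 // divr_ge0 // ltW.
have step i : (m <= i < m + W)%N ->
    displ_energy t l i.+1 <= (1 + d) * displ_energy t l i /\
    displ_energy t l i <= (1 + d) * displ_energy t l i.+1.
  move=> /andP[mi iw].
  have [|h1 h2 h3 h4] := inW i; first by rewrite mi ltnW.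
  have [|g1 g2 g3 g4] := inW i.+1; first by rewrite iw leqW.
  apply: (displ_energy_step t0 _ h4 g4); first exact: leq_trans mi.
  have i0 : 0 < i%:R :> R by rewrite ltr0n; exact: leq_trans mi.
  rewrite /d [leRHS]mulrDl; apply: lerD.
    by rewrite ler_pdivrMr // mulrAC ler_pdivlMr //; move: h1 lL; clear; lra.
  rewrite -/(b i) ler_pdivrMr; last first.
    by apply: lt_le_trans h3; rewrite divr_gt0 // mulr_gt0.
  have -> : 8 / t / L * b i = b i * 8 / (t * L).
    by field; rewrite gt_eqF //= gt_eqF.
  by rewrite ler_pdivlMr ?mulr_gt0 //; move: h3; clear; lra.
have comp := geometric_comparison d0 step.
have expK k : (k <= W)%N -> (1 + d) ^+ k <= expR K.
  move=> kW; apply: (@le_trans _ _ (expR d ^+ k)).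
    by rewrite lerXn2r ?nnegrE ?expR_ge0 ?addr_ge0 // expR_ge1Dx.
  rewrite -expRM_natl ler_expR; apply: (@le_trans _ _ (W%:R * d)).
    by rewrite ler_wpM2r // ler_nat.
  apply: (@le_trans _ _ (c * L * d)); first by rewrite ler_wpM2r.
  by rewrite /d /K le_eqVlt; apply/orP; left; apply/eqP; field; rewrite !gt_eqF.
have main k : (k <= W)%N -> t ^+ 2 * m%:R * v2 <=
    8 * expR K * (t ^+ 2 * l%:R) *
      (displ t (m + k) l ^+ 2 + displ t (m + k).-1 l ^+ 2).
  move=> kW.
  have [|h1 h2 h3 h4] := inW m; first by rewrite leqnn leq_addr.
  have [|g1 g2 g3 g4] := inW (m + k)%N; first by rewrite leq_addr leq_add2l.
  have [e1 _] := displ_energy_bounds h4; have [_ e2] := displ_energy_bounds g4.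
  have [|_ e3] := comp m k (leqnn m); first by rewrite leq_add2l.
  set S := _ + _ in e2 *.
  have S0 : 0 <= S by rewrite addr_ge0 ?sqr_ge0.
  have bs i : b i ^+ 2 = t ^+ 2 * i%:R.
    by rewrite exprMn [sqn i ^+ 2]expr2 sqn_sqr.
  rewrite -/(b _) bs in e1; rewrite -/(b _) bs in e2.
  have a1 : t ^+ 2 * m%:R * v2 <= 2 * displ_energy t l m.
    apply: le_trans e1; apply: ler_wpM2l; first by rewrite (mulr_ge0 tt0).
    by rewrite /v2 lerDl sqr_ge0.
  have G0 : 0 <= displ_energy t l (m + k).
    have [f1 _] := displ_energy_bounds g4.
    rewrite -(@pmulr_rge0 _ 2) //; apply: le_trans f1.
    by apply: mulr_ge0 => //; rewrite sqr_ge0.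
  have a2 : displ_energy t l m <= expR K * displ_energy t l (m + k).
    by apply: (le_trans e3); rewrite ler_wpM2r // expK.
  have a3 : displ_energy t l (m + k) <= 4 * (t ^+ 2 * l%:R * S).
    apply: (le_trans e2).
    rewrite (_ : 4 * _ = 2 * (t ^+ 2 * (2 * l%:R) * S)); last by ring.
    by rewrite ler_pM2l // ler_wpM2r // ler_wpM2l ?sqr_ge0.
  have a4 := ler_wpM2l (expR_ge0 K) a3.
  by move: a1 a2 a4; clear; lra.
have sumW : W%:R * (t ^+ 2 * m%:R * v2) <= 16 * expR K * (t ^+ 2 * l%:R).
  have : \sum_(0 <= k < W) (t ^+ 2 * m%:R * v2) <= \sum_(0 <= k < W)
    (8 * expR K * (t ^+ 2 * l%:R) *
      (displ t (m + k) l ^+ 2 + displ t (m + k).-1 l ^+ 2)).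
    by apply: ler_sum_nat => k /andP[_ kW]; apply: main; exact: ltnW.
  rewrite sumr_const_nat subn0 -[leLHS]mulr_natl => /le_trans; apply.
  rewrite -mulr_sumr big_split /=.
  have -> : 16 * expR K * (t ^+ 2 * l%:R) = 8 * expR K * (t ^+ 2 * l%:R) * (1 + 1).
    by ring.
  apply: ler_wpM2l.
    by apply: mulr_ge0 (mulr_ge0 tt0 _) => //; rewrite mulr_ge0 ?expR_ge0.
  apply: lerD; first exact: psum_sqr_displ_le1.
  have := psum_sqr_displ_le1 t l m.-1 W; apply: le_trans.
  by rewrite le_eqVlt; apply/orP; left; apply/eqP/eq_bigr => j _; case: (m) m0.
have [|h1 _ _ _] := inW m; first by rewrite leqnn leq_addr.
have t2 : 0 < t ^+ 2 by rewrite exprn_gt0.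
have l0 : 0 < l%:R :> R by apply: lt_le_trans lL.
have s1 : t ^+ 2 * l%:R * (W%:R * v2) <= t ^+ 2 * l%:R * (32 * expR K).
  apply: (@le_trans _ _ (2 * (W%:R * (t ^+ 2 * m%:R * v2)))); last by move: sumW; clear; lra.
  have := ler_wpM2r (mulr_ge0 (ltW t2) (mulr_ge0 (ler0n R W) v20)) h1; clear; lra.
rewrite ler_pM2l ?mulr_gt0 // in s1.
have s2 : c * (v2 * L) <= 64 * expR K.
  by move: (ler_wpM2r v20 Wge) s1; clear; lra.
apply: (@le_trans _ _ (64 * expR K / c)); last by rewrite lerDr ltW.
by rewrite ler_pdivlMr // mulrC.
Qed.

End displacement_bound.

(** * Eigenvectors in the displaced basis *)

Section eigenvector_coefficients.
Context {R : realType}.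
Implicit Types (g t : R) (m n k l : nat).

Lemma ip_delta k (y : nat -> R) : ip (fun j => (j == k)%:R) y = y k.
Proof.
apply/cvg_lim => //; apply: cvg_near_cst.
exists k.+1 => //= n /= kn; rewrite seriesEnat /=.
rewrite (bigD1_seq k) ?iota_uniq ?mem_index_iota //= eqxx mul1r.
by rewrite big1 ?addr0 // => i /negbTE ->; rewrite mul0r.
Qed.

Lemma l2_delta k : l2 (fun j => (j == k)%:R : R).
Proof.
have := l2_displ (0 : R) k.
by apply: eq_is_cvg_series => j; rewrite displ0.
Qed.

Arguments l2_delta : clear implicits.

Lemma cvg_l2M (x y : nat -> R) : l2 x -> l2 y ->
  (fun k => x k * y k) @ \oo --> (0 : R).
Proof. by move=> hx hy; apply: cvg_series_cvg_0; exact: is_cvg_ip. Qed.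

(* Matrix of the parity operator (-1)^k in the eigenbasis of the displaced
   oscillator. *)
Definition parity_mx t l m : R := (-1) ^+ m * displ t l m.

Lemma sqr_parity_mx t l m : parity_mx t l m ^+ 2 = displ t l m ^+ 2.
Proof. by rewrite exprMn sqrr_sign mul1r. Qed.

Lemma l2_parity_mx t m : l2 (fun l => parity_mx t l m).
Proof. by apply: l2Z; exact: l2_displ. Qed.
Arguments l2_parity_mx : clear implicits.

Lemma parity_mx_orthonormal t m n :
  ip (fun l => parity_mx t l m) (fun l => parity_mx t l n) = (m == n)%:R.
Proof.
rewrite (ipZl _ (l2_displ t m) (l2_parity_mx t n)) ipC.
rewrite (ipZl _ (l2_displ t n) (l2_displ t m)) displ_orthonormal eq_sym mulrA.
by case: eqP => [->|_]; rewrite ?mulr0 // mulr1 -expr2 sqrr_sign.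
Qed.

(** Parity reverses displacements, so conjugating it by D(-g) doubles the displacement instead of
    cancelling it. *)
Lemma ip_parity g l m :
  ip (fun k => displ (- g) k l) (fun k => (-1) ^+ k * displ (- g) k m) =
  parity_mx (2 * g) l m.
Proof.
rewrite (_ : 2 * g = g + g); last by ring.
rewrite /parity_mx -ip_displ -(ipZl _ (l2_displ_tr g l) (l2_displ g m)).
congr (limn (series _)); apply/funext => k.
rewrite displ_tr displN exprD.
have : ((-1) ^+ k * (-1) ^+ k : R) = 1 by rewrite -expr2 sqrr_sign.
by move=> e; ring: e.
Qed.

Lemma displ_eigen g m k :
  g * sqn k * displ (- g) k.-1 m + k%:R * displ (- g) k m
  + g * sqn k.+1 * displ (- g) k.+1 m = (m%:R - g ^+ 2) * displ (- g) k m.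
Proof. by have := displ_jacobi (- g) k m; rewrite sqrrN; lra. Qed.

(** The eigenvalue equation is paired with each displaced state and summed by parts. Nothing is
    known of [sqn k * u k], so the weight [sqn] in the boundary terms is carried by the displaced
    state, which remains square summable. *)
Lemma rabi_eigen_coeffs (s : bool) (Delta g E : R) :
  rabi_eigenvalue s Delta g E ->
  exists c : nat -> R, [/\ l2 c, (exists k, c k != 0) &
   forall m, (E - (m%:R - g ^+ 2)) * c m =
     (if s then 1 else -1) * Delta * ip (fun l => parity_mx (2 * g) l m) c].
Proof.
move=> [u [[k0 uk0] [l2u eig]]].
pose psi l k := displ (- g) k l; pose x m k := (-1) ^+ k * psi m k.
have l2psi l : l2 (psi l) by exact: l2_displ.
have psiP l l' : ip (psi l) (psi l') = (l == l')%:R by exact: displ_orthonormal.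
have l2x m : l2 (x m).
  apply: (@l2_norm _ (psi m)) => // k.
  by rewrite normrM normrX normrN1 expr1n mul1r.
pose c l := ip (psi l) u.
have l2c : l2 c by case: (Bessel l2psi psiP l2u).
exists c; split => //.
(* The rows of the displacement matrix are unit vectors too, so Parseval applies to the basis vector
   at [k0] and recovers [u k0] from the coefficients. *)
- apply: contrapT => /forallNP h; apply/negP: uk0; rewrite negbK.
  rewrite -(ip_delta k0 u) (Parseval l2psi psiP (l2_delta k0) l2u).
    rewrite (_ : (fun l => ip (psi l) u) = fun=> 0).
      by rewrite ipC ip0l.
    by apply/funext => l; apply/eqP; rewrite -[_ == _]negbK; apply/negP; exact: h.
  rewrite ip_delta eqxx (_ : (fun l => ip (psi l) _) = fun l => displ (- g) k0 l).
    by rewrite displ_orthonormal_tr eqxx.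
  by apply/funext => l; rewrite ipC ip_delta.
- move=> m.
  have -> : ip (fun l => parity_mx (2 * g) l m) c = ip (x m) u.
    rewrite (Parseval l2psi psiP (l2x m) l2u).
      by congr ip; apply/funext => l; rewrite ip_parity.
    rewrite (_ : (fun l => ip (psi l) (x m)) = fun l => parity_mx (2 * g) l m).
      rewrite parity_mx_orthonormal -psiP.
      congr (limn (series _)); apply/funext => k; rewrite /x.
      have : ((-1) ^+ k * (-1) ^+ k : R) = 1 by rewrite -expr2 sqrr_sign.
      by move=> e; ring: e.
    by apply/funext => l; rewrite ip_parity.
  pose eps : R := if s then 1 else -1.
  (* The discrete Wronskian: its increments are what the off-diagonal terms leave after pairing, and
     it vanishes at 0 and at infinity. *)
  pose w k := g * ((sqn k * psi m k.-1) * u k - psi m k * (sqn k * u k.-1)).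
  have wS k : w k.+1 - w k + eps * Delta * (x m k * u k) =
      (E - (m%:R - g ^+ 2)) * (psi m k * u k).
    have := eig k; have := displ_eigen g m k.
    rewrite -/(psi m k) -/(psi m k.-1) -/(psi m k.+1).
    rewrite /rabi_a /rabi_d /w /x -/eps -/(sqn _) -/(sqn _) -pred_Sn.
    move=> e1 e2.
    have : (m%:R - g ^+ 2) * psi m k * u k = (m%:R - g ^+ 2) * psi m k * u k by [].
    rewrite -{1}e1.
    have : psi m k * (E * u k) = psi m k * (E * u k) by [].
    by rewrite -{1}e2; lra.
  have wsum K : w K + eps * Delta * series (fun k => x m k * u k) K =
     (E - (m%:R - g ^+ 2)) * series (fun k => psi m k * u k) K.
    rewrite !seriesEnat /= !mulr_sumr.
    under [RHS]eq_bigr do rewrite -wS.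
    rewrite big_split /= telescope_sumr // {3}/w sqn0; ring.
  have w0 : (fun k => w k.+1) @ \oo --> (0 : R).
    have h1 := cvg_l2M (l2_creation (- g) m) l2u.
    have {}h1 : (fun k => sqn k.+1 * psi m k.+1.-1 * u k.+1) @ \oo --> (0 : R).
      by move: h1; rewrite -cvg_shiftS.
    have h2 := cvg_l2M (l2_annihilation (- g) m) l2u.
    have := @cvgMl_tmp _ _ _ _ _ g _ (cvgB h1 h2); rewrite subr0 mulr0 => h3.
    rewrite (_ : (fun k => w k.+1) = fun k => g * (sqn k.+1 * psi m k.+1.-1 * u k.+1
      - sqn k.+1 * displ (- g) k.+1 m * u k)); first exact: h3.
    by apply/funext => k; rewrite /w /= /psi; ring.
  have lhs : (fun K => w K + eps * Delta * series (fun k => x m k * u k) K) @ \oo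
      --> 0 + eps * Delta * ip (x m) u.
    apply: cvgD; last by apply: cvgMl_tmp; exact: cvg_ip.
    by rewrite -cvg_shiftS.
  have rhs : (fun K => (E - (m%:R - g ^+ 2)) * series (fun k => psi m k * u k) K)
      @ \oo --> (E - (m%:R - g ^+ 2)) * c m.
    by apply: cvgMl_tmp; exact: cvg_ip.
  rewrite -[RHS]add0r; apply: (cvg_unique _ rhs) => //.
  by move: lhs; under eq_fun do rewrite wsum.
Qed.

End eigenvector_coefficients.
Arguments l2_delta {R} k.
Arguments l2_parity_mx {R} t m.

Section counting_integers.
Context {R : realType}.

Lemma count_itv (A B : R) N : A <= B ->
  \sum_(0 <= j < N) ((A <= j%:R) && (j%:R <= B))%:R <= B - A + 1.
Proof.
move=> AB.
(* Truncating the interval at [N] makes the bound grow by 1 exactly when [N] itself is counted,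
   which the induction needs. *)
suff H : \sum_(0 <= j < N) ((A <= j%:R) && (j%:R <= B))%:R <=
    Num.max 0 (Num.min N%:R (B + 1) - A).
  apply: (le_trans H); rewrite ge_max; apply/andP; split; first lra.
  by rewrite lerBlDr ge_min; apply/orP; right; lra.
elim: N => [|N IH]; first by rewrite big_nil le_max lexx.
rewrite big_nat_recr //= -natr1.
have mono : Num.max 0 (Num.min N%:R (B + 1) - A) <=
    Num.max 0 (Num.min (N%:R + 1) (B + 1) - A).
  rewrite ge_max le_max lexx /= le_max lerD2r; apply/orP; right.
  by rewrite le_min !ge_min lexx orbT andbT lerDl ler01.
have [AN|_] := leP A N%:R => /=; last by rewrite addr0; exact: le_trans mono.
have [NB|_] := leP N%:R B => /=; last by rewrite addr0; exact: le_trans mono.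
have e1 : Num.min N%:R (B + 1) = N%:R by apply/min_idPl; lra.
have e2 : Num.min (N%:R + 1) (B + 1) = N%:R + 1 by apply/min_idPl; lra.
move: IH; rewrite e1 e2 => IH; rewrite le_max; apply/orP; right.
have e3 : Num.max 0 (N%:R - A) = N%:R - A by apply/max_idPr; lra.
by rewrite e3 in IH; lra.
Qed.

End counting_integers.

(** * First-order perturbation of a single level *)

Section perturbation.
Context {R : realType}.
Implicit Types (t : R) (m n k l : nat).

(** The reduced resolvent of the integer levels; the value 0 at [n] removes the perturbed level from
    sums over all [l]. *)
Definition inv_dist n l : R := if l == n then 0 else `|l%:R - n%:R|^-1.

Lemma inv_dist_ge0 n l : 0 <= inv_dist n l.
Proof. by rewrite /inv_dist; case: ifP => // _; rewrite invr_ge0. Qed.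

(* Telescoping: [1/j^2 <= 1/(j - 1/2) - 1/(j + 1/2)]. *)
Lemma sum_inv_dist_sqr n L : \sum_(0 <= l < L) inv_dist n l ^+ 2 <= 4.
Proof.
pose h (l : nat) : R := if (l <= n)%N then (n%:R - l%:R + 1 / 2)^-1
                 else 4 - (l%:R - n%:R - 1 / 2)^-1.
have tele (j : R) : 1 <= j -> (j ^+ 2)^-1 <= (j - 1 / 2)^-1 - (j + 1 / 2)^-1.
  move=> j1; have -> : (j - 1 / 2)^-1 - (j + 1 / 2)^-1 = (j ^+ 2 - 1 / 4)^-1.
    by field; rewrite ?gt_eqF //; nra.
  by rewrite lef_pV2 ?posrE; nra.
suff H : \sum_(0 <= l < L) inv_dist n l ^+ 2 <= h L.
  apply: (le_trans H); rewrite /h; case: ltnP => Ln.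
    rewrite lerBlDr lerDl invr_ge0 subr_ge0.
    by have : n.+1%:R <= L%:R :> R by [rewrite ler_nat]; rewrite -natr1; lra.
  have : L%:R <= n%:R :> R by rewrite ler_nat.
  move=> h1; apply: (@le_trans _ _ 2); last by rewrite ler_nat.
  by rewrite invf_ple ?posrE; lra.
elim: L => [|L IH].
  by rewrite big_nil /h /= invr_ge0 subr0 addr_ge0.
rewrite big_nat_recr //=; apply: (@le_trans _ _ (h L + inv_dist n L ^+ 2)).
  by rewrite lerD2r.
rewrite /h /inv_dist; case: (ltngtP L n) => Ln /=.
- have h1 : L.+1%:R <= n%:R :> R by rewrite ler_nat.
  rewrite -natr1 in h1 *.
  rewrite distrC exprVn ger0_norm; last lra.
  have := tele (n%:R - L%:R); rewrite (_ : n%:R - L%:R - 1 / 2 = n%:R - (L%:R + 1) + 1 / 2).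
    by move=> h2; have := h2 ltac:(lra); lra.
  lra.
- have h1 : n.+1%:R <= L%:R :> R by rewrite ler_nat.
  rewrite -natr1 in h1 *; rewrite -[L.+1%:R]natr1.
  rewrite exprVn ger0_norm; last lra.
  have := tele (L%:R - n%:R).
  rewrite (_ : L%:R - n%:R + 1 / 2 = L%:R + 1 - n%:R - 1 / 2); last lra.
  by move=> h2; have := h2 ltac:(lra); lra.
- rewrite Ln -[n.+1%:R]natr1 expr0n /= addr0 subrr add0r.
  rewrite (_ : n%:R + 1 - n%:R - 1 / 2 = 1 / 2); last lra.
  by rewrite !div1r !invrK; lra.
Qed.

Section one_eigenvalue.
(* [c] is the eigenvector in the displaced basis; [q] stands for [sqrt n], and
   [K], between [n ^ (1/4)] and [n ^ (1/2)], is the half-width of the window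
   around [n] in which the entries of [V] are known to be of order [n ^ (-1/4)]. *)
Variables (t D q B kap e : R) (n K : nat) (c : nat -> R).
Let V := parity_mx t.
Let sigma m := ip (fun l => V l m) c.
Let r := inv_dist n.
Let near (l : nat) : bool := (n%:R - K%:R <= l%:R :> R) && (l%:R <= n%:R + K%:R :> R).
Let bnear l : R := (near l)%:R.
Hypotheses (D0 : 0 <= D) (B0 : 0 <= B) (q0 : 0 < q) (K1 : 1 <= K%:R :> R)
  (qK : q <= K%:R ^+ 2) (kapD : `|kap| <= D) (e2 : `|e| <= 1 / 2)
  (l2c : l2 c) (c1 : ip c c = 1)
  (eqc : forall m, (e + (n%:R - m%:R)) * c m = kap * sigma m)
  (Vnear : forall l m, near l -> near m -> V l m ^+ 2 <= B / q).

Let sum_r L : \sum_(0 <= l < L) r l ^+ 2 <= 4.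
Proof. exact: sum_inv_dist_sqr. Qed.

Let r_far l : ~~ near l -> r l <= K%:R^-1.
Proof.
move=> nl; rewrite /r /inv_dist; case: eqP => [ln|_].
  by rewrite invr_ge0 ler0n.
have K0 : 0 < K%:R :> R by exact: lt_le_trans K1.
have h : K%:R <= `|l%:R - n%:R| :> R.
  move: nl; rewrite negb_and -!ltNge ler_normr => /orP[] h; apply/orP; [right|left]; lra.
by rewrite lef_pV2 ?posrE //; apply: lt_le_trans h.
Qed.

(** For [l] other than [n] the gap is at least 1, so a shift of at most 1/2 leaves half of it. *)
Let c_le l : l != n -> `|c l| <= 2 * D * `|sigma l| * r l.
Proof.
move=> ln; rewrite /r /inv_dist (negbTE ln).
have d1 : 1 <= `|l%:R - n%:R| :> R.
  move: ln; rewrite neq_ltn => /orP[] h; rewrite ler_normr.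
    by have : l.+1%:R <= n%:R :> R by [rewrite ler_nat]; rewrite -natr1 => ?; apply/orP; right; lra.
  by have : n.+1%:R <= l%:R :> R by [rewrite ler_nat]; rewrite -natr1 => ?; apply/orP; left; lra.
rewrite ler_pdivlMr; last exact: lt_le_trans d1.
have h : `|l%:R - n%:R| <= 2 * `|e + (n%:R - l%:R)|.
  have := ler_normB (e + (n%:R - l%:R)) e.
  have -> : e + (n%:R - l%:R) - e = n%:R - l%:R by ring.
  by rewrite distrC; have := e2; lra.
apply: (@le_trans _ _ (2 * (`|e + (n%:R - l%:R)| * `|c l|))).
  by have := ler_wpM2l (normr_ge0 (c l)) h; lra.
rewrite -normrM eqc normrM -!mulrA ler_pM2l //.
by rewrite ler_wpM2r.
Qed.

Let l2V m : l2 (fun l => V l m).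
Proof. exact: l2_parity_mx. Qed.

Let sum_sigma L : \sum_(0 <= l < L) sigma l ^+ 2 <= 1.
Proof.
have [h1 h2] := Bessel l2V (@parity_mx_orthonormal R t) l2c.
by rewrite c1 in h2; exact: le_trans (psum_le_ip L h1) h2.
Qed.

Let sum_V m L : \sum_(0 <= l < L) V l m ^+ 2 <= 1.
Proof.
have := psum_le_ip L (@l2V m).
by rewrite /V parity_mx_orthonormal eqxx.
Qed.

Let near_n : near n.
Proof.
have K0 : 0 <= K%:R :> R by rewrite ler0n.
by rewrite /near; apply/andP; split; lra.
Qed.

Let c_n_le1 : c n ^+ 2 <= 1.
Proof. by rewrite -c1; exact: sqr_le_ip. Qed.

Let sum_near L : \sum_(0 <= l < L) bnear l <= 3 * K%:R.
Proof.
apply: (@le_trans _ _ ((n%:R + K%:R) - (n%:R - K%:R) + 1)); last by have := K1; lra.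
by apply: count_itv; have := K1; lra.
Qed.

(** The part of [sigma m] due to the levels other than [n]. By [c_le] it is controlled by [sigma]
    itself, which permits a bootstrap. *)
Let T m := sigma m - V n m * c n.

Let T_le m (M : R) :
  (forall L, \sum_(0 <= l < L) `|V l m| * (`|sigma l| * r l) <= M) ->
  `|T m| <= 2 * D * M.
Proof.
move=> hM; have cv := cvg_ip (@l2V m) l2c.
have cT : (fun L => `|series (fun l => V l m * c l) L - V n m * c n|) @ \oo -->
    `|T m|.
  by apply: cvg_norm; apply: cvgB => //; exact: cvg_cst.
apply: (cvgr_to_le cT); exists n.+1 => //= L /= nL.
rewrite seriesEnat /= (bigD1_seq n) ?iota_uniq ?mem_index_iota //=.
rewrite addrAC subrr add0r.
apply: (le_trans (ler_norm_sum _ _ _)).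
apply: (@le_trans _ _ (\sum_(0 <= l < L) 2 * D * (`|V l m| * (`|sigma l| * r l)))).
  rewrite [leRHS](bigD1_seq n) ?iota_uniq ?mem_index_iota //=.
  apply: ler_wpDl; first by rewrite !mulr_ge0 // inv_dist_ge0.
  apply: ler_sum => l ln; rewrite normrM mulrCA ler_wpM2l //.
  by rewrite mulrA; exact: c_le.
by rewrite -mulr_sumr ler_wpM2l // mulr_ge0.
Qed.

Let K0 : 0 < K%:R :> R.
Proof. exact: lt_le_trans K1. Qed.

Let invK2 : (K%:R ^+ 2)^-1 <= q^-1.
Proof. by rewrite lef_pV2 ?posrE // exprn_gt0. Qed.

Let sum_Vr m L : near m -> \sum_(0 <= l < L) V l m ^+ 2 * r l ^+ 2 <= (4 * B + 1) / q.
Proof.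
move=> nm.
apply: (@le_trans _ _ (\sum_(0 <= l < L) (B / q * r l ^+ 2 + V l m ^+ 2 / q))).
  apply: ler_sum => l _; have [nl|nl] := boolP (near l).
    apply: ler_wpDr; first by rewrite divr_ge0 ?sqr_ge0 // ltW.
    by rewrite ler_wpM2r ?sqr_ge0 // Vnear.
  apply: ler_wpDl; first by rewrite mulr_ge0 ?sqr_ge0 // divr_ge0 // ltW.
  rewrite ler_wpM2l ?sqr_ge0 //; apply: le_trans invK2.
  by rewrite -exprVn lerXn2r ?nnegrE ?inv_dist_ge0 ?invr_ge0 ?ler0n // r_far.
rewrite big_split /= -mulr_sumr -mulr_suml mulrDl; apply: lerD.
  have : 0 <= B / q by rewrite divr_ge0 // ltW.
  by move=> h; have := ler_wpM2l h (sum_r L); lra.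
by rewrite ler_wpM2r // invr_ge0 ltW.
Qed.

(** First pass: Cauchy-Schwarz with only the norm of [sigma] known. The remainder comes out of order
    n^(-1/4), no smaller than the main term. *)
Let T_near m : near m -> T m ^+ 2 <= 4 * D ^+ 2 * ((4 * B + 1) / q).
Proof.
move=> nm; set S := (4 * B + 1) / q.
have S0 : 0 <= S by rewrite divr_ge0 ?addr_ge0 ?mulr_ge0 // ltW.
have : `|T m| <= 2 * D * Num.sqrt S.
  apply: T_le => L.
  have -> : \sum_(0 <= l < L) `|V l m| * (`|sigma l| * r l) =
      \sum_(0 <= l < L) (`|V l m| * r l) * `|sigma l|.
    by apply: eq_bigr => l _; ring.
  rewrite -[leLHS]ger0_norm; last first.
    by rewrite sumr_ge0 // => l _; rewrite !mulr_ge0 // inv_dist_ge0.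
  rewrite -sqrtr_sqr ler_sqrt //.
  apply: (le_trans (CauchySchwarz_psum (fun l => `|V l m| * r l) (fun l => `|sigma l|) L)).
  rewrite -[leRHS]mulr1; apply: ler_pM.
  - by rewrite sumr_ge0 // => l _; rewrite sqr_ge0.
  - by rewrite sumr_ge0 // => l _; rewrite sqr_ge0.
  - under eq_bigr do rewrite exprMn real_normK ?num_real //.
    exact: sum_Vr.
  - under eq_bigr do rewrite real_normK ?num_real //.
    exact: sum_sigma.
move=> h; rewrite -(real_normK (num_real (T m))).
have -> : 4 * D ^+ 2 * S = (2 * D * Num.sqrt S) ^+ 2.
  by rewrite !exprMn sqr_sqrtr //; ring.
by rewrite lerXn2r ?nnegrE // !mulr_ge0 // sqrtr_ge0.
Qed.

Let C2 := 2 * B + 8 * D ^+ 2 * (4 * B + 1).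

Let C20 : 0 <= C2.
Proof. by rewrite addr_ge0 ?mulr_ge0 ?addr_ge0 ?mulr_ge0 // ?sqr_ge0. Qed.

(** The gain of the first pass: on the window [sigma] is as small as the entries of [V]. This is fed
    back into the remainder in [T_n]. *)
Let sigma_near m : near m -> sigma m ^+ 2 <= C2 / q.
Proof.
move=> nm; have -> : sigma m = V n m * c n + T m by rewrite /T; ring.
have h1 := T_near nm.
have h2 : (V n m * c n) ^+ 2 <= B / q.
  rewrite exprMn -[leRHS]mulr1; apply: ler_pM; rewrite ?sqr_ge0 //.
  exact: Vnear.
have := sqr_ge0 (V n m * c n - T m).
have -> : C2 / q = 2 * (B / q) + 2 * (4 * D ^+ 2 * ((4 * B + 1) / q)).
  by rewrite /C2; ring.
by move=> ?; nra.
Qed.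

(** The mass outside [n] is O(1/q): on the window by the smallness of [sigma], off it by that of
    [r]. The unit vector is thus concentrated at [n], which allows the final division by [c n]. *)
Let c_n_big : 8 * D ^+ 2 * (4 * C2 + 1) <= q -> 1 / 2 <= c n ^+ 2.
Proof.
move=> hq.
have key L : \sum_(0 <= l < L) c l ^+ 2 <=
    c n ^+ 2 + 4 * D ^+ 2 * ((4 * C2 + 1) / q).
  apply: (@le_trans _ _ (\sum_(0 <= l < L) ((l == n)%:R * c n ^+ 2
     + 4 * D ^+ 2 * (C2 / q * r l ^+ 2 + sigma l ^+ 2 / q)))).
    apply: ler_sum => l _.
    have g0 : 0 <= C2 / q * r l ^+ 2 by rewrite mulr_ge0 ?sqr_ge0 // divr_ge0 // ltW.
    have g1 : 0 <= sigma l ^+ 2 / q by rewrite divr_ge0 ?sqr_ge0 // ltW.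
    have [ln|ln] := eqVneq l n.
      subst l; rewrite mul1r lerDl; apply: mulr_ge0; first by rewrite mulr_ge0 ?sqr_ge0.
      exact: addr_ge0.
    rewrite mul0r add0r.
    apply: (@le_trans _ _ (4 * D ^+ 2 * (sigma l ^+ 2 * r l ^+ 2))).
      rewrite -(real_normK (num_real (c l))) -(real_normK (num_real (sigma l))).
      have -> : 4 * D ^+ 2 * (`|sigma l| ^+ 2 * r l ^+ 2) =
         (2 * D * `|sigma l| * r l) ^+ 2 by ring.
      rewrite lerXn2r ?nnegrE // ?c_le //.
      by rewrite !mulr_ge0 // inv_dist_ge0.
    rewrite ler_wpM2l //; first by rewrite mulr_ge0 ?sqr_ge0.
    have [nl|nl] := boolP (near l).
      by apply: ler_wpDr => //; rewrite ler_wpM2r ?sqr_ge0 // sigma_near.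
    apply: ler_wpDl => //; rewrite ler_wpM2l ?sqr_ge0 //; apply: le_trans invK2.
    by rewrite -exprVn lerXn2r ?nnegrE ?inv_dist_ge0 ?invr_ge0 ?ler0n // r_far.
  rewrite big_split /= -mulr_suml -mulr_sumr big_split /= -mulr_sumr -mulr_suml.
  apply: lerD.
    rewrite -[leRHS]mul1r ler_wpM2r ?sqr_ge0 //.
    case: (ltnP n L) => nL.
      rewrite (bigD1_seq n) ?iota_uniq ?mem_index_iota //= eqxx big1 ?addr0 //.
      by move=> i /negbTE ->.
    rewrite big_nat big1 ?ler01 // => i /andP[_ iL].
    by rewrite ltn_eqF // (leq_trans iL).
  rewrite ler_wpM2l //; first by rewrite mulr_ge0 ?sqr_ge0.
  rewrite [leRHS]mulrDl; apply: lerD.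
    have h : 0 <= C2 / q by rewrite divr_ge0 // ltW.
    by have := ler_wpM2l h (sum_r L); lra.
  by rewrite ler_wpM2r // ?invr_ge0 // ltW.
have [_] := l2_bounded key; rewrite c1 => h.
have : 4 * D ^+ 2 * ((4 * C2 + 1) / q) <= 1 / 2.
  rewrite mulrA ler_pdivrMr //; lra.
lra.
Qed.

Let CB : 0 <= (C2 + B) / q / 2.
Proof. by apply: divr_ge0 => //; apply: divr_ge0; [exact: addr_ge0|exact: ltW]. Qed.

(** Second pass: on the window both [V l n] and [sigma l] are of order n^(-1/4), so the remainder
    now drops below the main term. *)
Let T_n : `|T n| <= 2 * D * ((C2 + B) * (7 * Num.sqrt K%:R / q) + 1 / K%:R).
Proof.
apply: T_le => L.
set s := Num.sqrt K%:R.
have s0 : 0 < s by rewrite sqrtr_gt0.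
have ss : s * s = K%:R by rewrite -expr2 sqr_sqrtr // ler0n.
pose G l : R := (C2 + B) / q / 2 * (s * r l ^+ 2 + bnear l / s)
   + (V l n ^+ 2 + sigma l ^+ 2) / 2 / K%:R.
apply: (@le_trans _ _ (\sum_(0 <= l < L) G l)).
  apply: ler_sum => l _; rewrite /G.
  have v2 : `|V l n| * `|sigma l| <= (V l n ^+ 2 + sigma l ^+ 2) / 2.
    rewrite -(real_normK (num_real (V l n))) -(real_normK (num_real (sigma l))).
    by have := sqr_ge0 (`|V l n| - `|sigma l|); lra.
  have v0 : 0 <= (V l n ^+ 2 + sigma l ^+ 2) / 2.
    by apply: le_trans v2; rewrite mulr_ge0.
  have g0 : 0 <= (V l n ^+ 2 + sigma l ^+ 2) / 2 / K%:R by rewrite divr_ge0 // ltW.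
  have [nl|nl] := boolP (near l).
    have bn : bnear l = 1 by rewrite /bnear nl.
    apply: ler_wpDr => //; rewrite bn mulrA.
    have h1 : (V l n ^+ 2 + sigma l ^+ 2) / 2 <= (C2 + B) / q / 2.
      rewrite ler_pM2r ?invr_gt0 // mulrDl addrC lerD // ?sigma_near //.
      exact: Vnear.
    have h2 := le_trans v2 h1.
    (* The sum of [r] over the window is logarithmic in [K]; this arithmetic-geometric bound gives
       the weaker order [Num.sqrt K%:R] from the sum of squares and the number of terms, which is
       enough. *)
    have h3 : 2 * r l <= s * r l ^+ 2 + 1 / s.
      rewrite -subr_ge0 (_ : _ - _ = (s * r l - 1) ^+ 2 / s); last by field; rewrite gt_eqF.
      by rewrite divr_ge0 ?sqr_ge0 // ltW.
    have h4 : 0 <= `|V l n| * `|sigma l| by rewrite mulr_ge0.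
    have h5 := inv_dist_ge0 n l; rewrite -/r in h5.
    have h6 : 0 <= (C2 + B) / q / 2 by apply: le_trans h2.
    apply: ler_pM => //; lra.
  apply: ler_wpDl.
    apply: mulr_ge0; first exact: CB.
    apply: addr_ge0; first by apply: mulr_ge0 (sqr_ge0 _); exact: ltW.
    by rewrite divr_ge0 ?ler0n // ltW.
  by rewrite mulrA; apply: ler_pM => //; [exact: inv_dist_ge0|exact: r_far].
rewrite big_split /= -mulr_sumr -!mulr_suml !big_split /= -mulr_sumr -mulr_suml.
apply: lerD.
  have h := CB.
  have -> : (C2 + B) * (7 * s / q) = (C2 + B) / q / 2 * (14 * s).
    by field; rewrite gt_eqF.
  rewrite ler_wpM2l //.
  have h1 := ler_wpM2l (ltW s0) (sum_r L).
  have h2 : (\sum_(0 <= l < L) bnear l) / s <= 3 * s.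
    by rewrite ler_pdivrMr // -mulrA ss; exact: sum_near.
  lra.
rewrite ler_pM2r ?invr_gt0 //; have := sum_V n L; have := sum_sigma L; lra.
Qed.

Lemma first_order_perturbation :
  8 * D ^+ 2 * (4 * C2 + 1) <= q ->
  `|e - kap * V n n| <=
    4 * D ^+ 2 * ((C2 + B) * (7 * Num.sqrt K%:R / q) + 1 / K%:R).
Proof.
move=> /c_n_big cn; have Tn := T_n.
set Y := _ + _ in Tn *.
have cn2 : 1 / 2 <= `|c n|.
  rewrite leNgt; apply/negP => h; move: cn; rewrite -(real_normK (num_real (c n))).
  have := normr_ge0 (c n); nra.
have e1 : (e - kap * V n n) * c n = kap * T n.
  by have := eqc n; rewrite subrr addr0 /T => h; rewrite mulrBl h; ring.
have e3 : `|e - kap * V n n| * `|c n| <= D * (2 * D * Y).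
  by rewrite -normrM e1 normrM ler_pM.
have := ler_wpM2l (normr_ge0 (e - kap * V n n)) cn2.
lra.
Qed.

End one_eigenvalue.
End perturbation.

(** * Eigenvalue shifts to first order *)

Section eigenvalue_asymptotics.
Context {R : realType}.

(* The powers of [n ^ (1/16)] provide all the fractional powers of [n] that are
   needed: the window has half-width of order [n ^ (6/16)]. *)
Definition root16 (n : nat) : R :=
  Num.sqrt (Num.sqrt (Num.sqrt (Num.sqrt n%:R))).

Lemma root16_ge0 n : 0 <= root16 n.
Proof. exact: sqrtr_ge0. Qed.

Lemma root16_X4 n : root16 n ^+ 4 = Num.sqrt (Num.sqrt n%:R).
Proof. by rewrite (exprM _ 2 2) !sqr_sqrtr ?sqrtr_ge0. Qed.

Lemma root16_X8 n : root16 n ^+ 8 = sqn n.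
Proof. by rewrite (exprM _ 4 2) root16_X4 sqr_sqrtr ?sqrtr_ge0. Qed.

Lemma root16_X16 n : root16 n ^+ 16 = n%:R.
Proof. by rewrite (exprM _ 8 2) root16_X8 expr2 sqn_sqr. Qed.

Lemma root16_large (M : R) : \forall n \near \oo, M <= root16 n.
Proof.
have [M0|M0] := leP M 0.
  by apply: nearW => n; apply: le_trans M0 (root16_ge0 n).
exists (Num.truncn (M ^+ 16)).+1 => // n /= hn.
rewrite -(@ler_pXn2r _ 16) ?nnegrE ?root16_ge0 ?(ltW M0) // root16_X16.
have /andP[_ h] := truncn_itv (exprn_ge0 16 (ltW M0)).
by apply: le_trans (ltW h) _; rewrite ler_nat.
Qed.

Lemma eigenvalue_first_order (s : bool) (Delta g : R) (m : int) (E : int -> R) :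
  0 < Delta -> 0 < g ->
  (forall x : R, rabi_eigenvalue s Delta g x <-> exists n : int, (m <= n)%R /\ E n = x) ->
  (fun n : nat => E n%:Z - (n%:R - g ^+ 2)) @ \oo --> (0 : R) ->
  (fun n : nat => root16 n ^+ 4 * (E n%:Z - (n%:R - g ^+ 2)
     - (if s then 1 else -1) * Delta * parity_mx (2 * g) n n)) @ \oo --> (0 : R).
Proof.
move=> D0 g0 spec E0; set t := 2 * g; set kap := _ * Delta.
have t0 : 0 < t by rewrite mulr_gt0.
have kapD : `|kap| <= Delta.
  by rewrite normrM (gtr0_norm D0); case: s {spec kap}; rewrite ?normrN normr1 mul1r.
have [B [c1 [B0 c10 HB]]] := displ_near_diag t0.
(* The perturbation constant with [2 * B] for [B]: on the window [sqn j] is only known to be at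
   least half of [sqn n]. *)
pose C2 : R := 2 * (2 * B) + 8 * Delta ^+ 2 * (4 * (2 * B) + 1).
have C20 : 0 <= C2.
  have h : 0 <= Delta ^+ 2 by exact: sqr_ge0.
  have : 0 <= Delta ^+ 2 * B by rewrite mulr_ge0 // ltW.
  by move=> ?; rewrite /C2; nra.
pose C3 : R := 4 * Delta ^+ 2 * ((C2 + 2 * B) * 7 + 2).
have C30 : 0 <= C3.
  apply: mulr_ge0; first by rewrite mulr_ge0 ?sqr_ge0.
  by rewrite addr_ge0 // mulr_ge0 // addr_ge0 // mulr_ge0 // ltW.
apply/cvgr0Pnorm_le => eps eps0.
have mN : \forall n \near \oo, (`|m|%N <= n)%N by exists `|m|%N.
have half0 : (0 : R) < 1 / 2 by [].
have /cvgr0Pnorm_le/(_ _ half0) small := E0.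
near=> n.
have C6 : 8 * Delta ^+ 2 * (4 * C2 + 1) <= root16 n by near: n; exact: root16_large.
have C7 : 4 / c1 <= root16 n by near: n; exact: root16_large.
have C8 : 2 <= root16 n by near: n; exact: root16_large.
have C9 : C3 / eps <= root16 n by near: n; exact: root16_large.
have en : `|E n%:Z - (n%:R - g ^+ 2)| <= 1 / 2 by near: n.
have mn : (`|m|%N <= n)%N by near: n.
move: (root16_ge0 n) (root16_X8 n) (root16_X16 n) C6 C7 C8 C9.
set r := root16 n => r0 r8 r16 C6 C7 C8 C9.
set e := E n%:Z - _ in en *.
have r1 : 1 <= r by move: C8; clear; lra.
(* With [r ^+ 16 = n] the two errors, [Num.sqrt K / r ^+ 8] and [1 / K], are of orders r^(-5) and
   r^(-6), against the scale r^(-4) of the main term. *)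
pose K := Num.truncn (r ^+ 6).
have /andP[K1 K2] := truncn_itv (exprn_ge0 6 r0); rewrite -/K in K1 K2.
have r6 : 2 <= r ^+ 6.
  apply: (le_trans C8); rewrite -{1}(expr1 r); apply: ler_weXn2l => //.
have K3 : r ^+ 6 / 2 <= K%:R by rewrite -natr1 in K2; move: K2 r6; clear; lra.
have K0 : 1 <= K%:R :> R by move: K3 r6; clear; lra.
have q0 : 0 < r ^+ 8 by rewrite exprn_gt0 //; move: r1; clear; lra.
have r0' : 0 < r by move: r1; clear; lra.
have qK : r ^+ 8 <= K%:R ^+ 2.
  have : (r ^+ 6 / 2) ^+ 2 <= K%:R ^+ 2.
    by rewrite lerXn2r ?nnegrE ?divr_ge0 ?exprn_ge0.
  apply: le_trans; rewrite (_ : _ ^+ 2 = r ^+ 8 * (r ^+ 4 / 4)); last by field.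
  rewrite ler_peMr ?exprn_ge0 // ler_pdivlMr // mul1r.
  have : 2 ^+ 4 <= r ^+ 4 by rewrite lerXn2r ?nnegrE.
  by clear; lra.
have q1 : 8 * Delta ^+ 2 * (4 * C2 + 1) <= r ^+ 8.
  by apply: (le_trans C6); rewrite -{1}(expr1 r); apply: ler_weXn2l.
have Eeig : rabi_eigenvalue s Delta g (E n%:Z).
  by apply/spec; exists n%:Z; split => //; apply: le_trans (lez_abs m) _; rewrite lez_nat.
have [c [l2c [k0 ck0] eqc]] := @rabi_eigen_coeffs R s Delta g (E n%:Z) Eeig.
have A0 : 0 < ip c c.
  apply: lt_le_trans (sqr_le_ip k0 l2c).
  by rewrite lt_neqAle sqr_ge0 andbT eq_sym sqrf_eq0.
pose a := (Num.sqrt (ip c c))^-1; pose c' l := a * c l.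
have l2c' : l2 c' by exact: l2Z.
have c'1 : ip c' c' = 1.
  rewrite (ipZl _ l2c l2c') ipC (ipZl _ l2c l2c) mulrA -expr2 exprVn.
  by rewrite sqr_sqrtr ?ltW // mulVf // gt_eqF.
have eqc' j : (e + (n%:R - j%:R)) * c' j = kap * ip (fun l => parity_mx t l j) c'.
  rewrite [in RHS]ipC (ipZl _ l2c (l2_parity_mx t j)) [ip c _]ipC.
  have h := eqc j; rewrite -/t -/kap in h.
  by rewrite [RHS]mulrCA -h /c' /e; ring.
have Kr6 : K%:R <= r ^+ 8 / 2.
  apply: (le_trans K1); rewrite ler_pdivlMr // (exprD r 2 6) mulrC.
  rewrite ler_wpM2r ?exprn_ge0 //; apply: (le_trans C8).
  by rewrite -{1}(expr1 r); apply: ler_weXn2l.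
have q2 : 1 <= r ^+ 8 by rewrite exprn_ege1.
have rr : r ^+ 16 = r ^+ 8 * r ^+ 8 by rewrite -exprD.
have qn : r ^+ 8 / 2 <= n%:R - K%:R.
  by rewrite -r16 rr; move: (ler_wpM2r (ltW q0) q2) Kr6; clear; lra.
have Vn l j : (n%:R - K%:R <= l%:R :> R) && (l%:R <= n%:R + K%:R :> R) ->
    (n%:R - K%:R <= j%:R :> R) && (j%:R <= n%:R + K%:R :> R) ->
    parity_mx t l j ^+ 2 <= 2 * B / r ^+ 8.
  move=> /andP[l1 l2] /andP[j1 j2].
  have sj : r ^+ 8 / 2 <= sqn j.
    rewrite -(@ler_pXn2r _ 2) ?nnegrE ?sqn_ge0 ?divr_ge0 ?exprn_ge0 //.
    rewrite [leRHS]expr2 sqn_sqr; apply: le_trans j1; rewrite -r16 rr.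
    by move: (ler_wpM2r (ltW q0) q2) Kr6 (ltW q0); set q := r ^+ 8; clear; lra.
  have jl : `|l%:R - j%:R| <= c1 * sqn j.
    apply: (@le_trans _ _ (2 * K%:R)).
      by clear -l1 l2 j1 j2; rewrite ler_norml; apply/andP; split; lra.
    apply: (@le_trans _ _ (c1 * (r ^+ 8 / 2))); last by rewrite ler_pM2l.
    apply: (@le_trans _ _ (2 * r ^+ 6)); first by rewrite ler_pM2l.
    have h4 : 4 <= c1 * r by rewrite mulrC -ler_pdivrMr.
    have h5 : 4 * 1 <= c1 * r * r by apply: ler_pM.
    have h6 := ler_wpM2r (exprn_ge0 6 r0) h5.
    rewrite (_ : c1 * (r ^+ 8 / 2) = c1 * r * r * r ^+ 6 / 2); last by ring.
    by move: h6; clear; lra.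
  rewrite sqr_parity_mx ler_pdivlMr //; have h := HB j l jl.
  by move: (ler_wpM2l (sqr_ge0 (displ t l j)) sj) h; clear; lra.
have B20 : 0 <= 2 * B by rewrite mulr_ge0 // ltW.
have := first_order_perturbation (ltW D0) B20 q0 K0 qK kapD en l2c' c'1 eqc' Vn q1.
rewrite -/C2 -/kap => h.
have sK : Num.sqrt K%:R <= r ^+ 3.
  rewrite -(@ler_pXn2r _ 2) ?nnegrE ?sqrtr_ge0 ?exprn_ge0 //.
  by rewrite sqr_sqrtr ?ler0n // -exprM.
have KV : 1 / K%:R <= 2 / r ^+ 6.
  rewrite div1r -[leRHS]invf_div lef_pV2 ?posrE ?divr_gt0 ?exprn_gt0 //.
  exact: lt_le_trans K0.
rewrite normrM (ger0_norm (exprn_ge0 4 r0)).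
apply: (@le_trans _ _ (C3 / r)); last by rewrite ler_pdivrMr // mulrC -ler_pdivrMr.
apply: (@le_trans _ _ (r ^+ 4 * (4 * Delta ^+ 2 *
    ((C2 + 2 * B) * (7 * r ^+ 3 / r ^+ 8) + 2 / r ^+ 6)))).
  rewrite ler_wpM2l ?exprn_ge0 //; apply: (le_trans h).
  apply: ler_wpM2l; first by rewrite mulr_ge0 // sqr_ge0.
  apply: lerD => //.
  apply: ler_wpM2l; first exact: addr_ge0.
  by rewrite ler_pM2r ?invr_gt0 // ler_pM2l.
have -> : r ^+ 4 * (4 * Delta ^+ 2 *
    ((C2 + 2 * B) * (7 * r ^+ 3 / r ^+ 8) + 2 / r ^+ 6)) =
    4 * Delta ^+ 2 * ((C2 + 2 * B) * 7 + 2 / r) / r.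
  by field; rewrite gt_eqF.
rewrite ler_pM2r ?invr_gt0 //; apply: ler_wpM2l; first by rewrite mulr_ge0 // sqr_ge0.
rewrite lerD2l.
by rewrite ler_pdivrMr // ler_peMr.
Unshelve. all: by end_near. Qed.

End eigenvalue_asymptotics.

(** * Asymptotics of the diagonal matrix elements *)

Section derivative_rules.
Context {R : realType}.
Implicit Types (f g : R -> R) (x a b : R).

(** The rules below are stated for pointwise expressions so that [isd] can chain them by
    unification; [isdE] then reduces the computed derivative to the wanted one by algebra. *)
Lemma isdE f x a b : is_derive x (1 : R) f a -> a = b -> is_derive x (1 : R) f b.
Proof. by move=> ? <-. Qed.

Lemma isdD f g x a b : is_derive x (1 : R) f a -> is_derive x (1 : R) g b ->
  is_derive x (1 : R) (fun y => f y + g y) (a + b).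
Proof. exact: is_deriveD. Qed.

Lemma isdN f x a : is_derive x (1 : R) f a ->
  is_derive x (1 : R) (fun y => - f y) (- a).
Proof. exact: is_deriveN. Qed.

Lemma isdM f g x a b : is_derive x (1 : R) f a -> is_derive x (1 : R) g b ->
  is_derive x (1 : R) (fun y => f y * g y) (a * g x + f x * b).
Proof.
move=> hf hg; have h := is_deriveM hf hg; refine (isdE h _).
by rewrite /GRing.scale /=; ring.
Qed.

Lemma isdX f n x a : is_derive x (1 : R) f a ->
  is_derive x (1 : R) (fun y => f y ^+ n) (n%:R * f x ^+ n.-1 * a).
Proof.
move=> hf; have h := is_deriveX n hf.
have -> : (fun y => f y ^+ n) = f ^+ n by apply/funext => y; rewrite exprfctE.
by refine (isdE h _).
Qed.

Lemma isdV f x a : f x != 0 -> is_derive x (1 : R) f a ->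
  is_derive x (1 : R) (fun y => (f y)^-1) (- a / f x ^+ 2).
Proof.
move=> fx hf; have h := is_deriveV fx hf; refine (isdE h _).
by rewrite /GRing.scale /= !mulNr mulrC.
Qed.

Lemma isdC (c x : R) : is_derive x (1 : R) (fun=> c) 0.
Proof. exact: is_derive_cst. Qed.

Lemma isdI x : is_derive x (1 : R) (fun y => y) 1.
Proof. exact: is_derive_id. Qed.

Lemma isd_comp f g x a b : is_derive (g x) (1 : R) f a -> is_derive x (1 : R) g b ->
  is_derive x (1 : R) (fun y => f (g y)) (a * b).
Proof. by move=> hf hg; have := @is_derive1_comp _ f g x a b hf hg. Qed.

Lemma is_derive_continuous f x a : is_derive x (1 : R) f a -> {for x, continuous f}.
Proof.
move=> h; apply: differentiable_continuous; apply/derivable1_diffP.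
by have [] := h.
Qed.

Lemma is_derive_nincr f (df : R -> R) a b : a <= b ->
  (forall x, a <= x <= b -> is_derive x (1 : R) f (df x)) ->
  (forall x, a <= x <= b -> df x <= 0) -> f b <= f a.
Proof.
move=> ab h hle.
case: (@MVT_segment _ f df a b ab) => [x||c cab e].
- by rewrite in_itv /= => /andP[/ltW ? /ltW ?]; apply: h; apply/andP.
- apply: derivable_within_continuous => x; rewrite in_itv /= => /h.
  by case.
- rewrite -subr_le0 e mulr_le0_ge0 ?subr_ge0 //; apply: hle.
  by rewrite in_itv in cab.
Qed.

End derivative_rules.

Ltac isd := repeat first
  [ eassumption | eapply isdI | eapply isdC | eapply isdD | eapply isdN
  | eapply isdX | eapply isdM | eapply is_derive_sin | eapply is_derive_cos
  | eapply (isd_comp (is_derive_expR _)) ].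

(** * Differential equation of the diagonal entries *)

Section diagonal_ode.
Context {R : realType}.
Implicit Types (t : R) (n : nat).

(** This is exp(-t^2/2) L_n(t^2), with L_n the Laguerre polynomial. The companion [de] closes the
    recursion in [n], and [dq1] turns out to be the derivative of [dq]. *)
Definition dq n t : R := displ t n n.
Definition de n t : R := sqn n * displ t n n.-1.
Definition dq1 n t : R := - (t * dq n t) - 2 * de n t.

Lemma deS n t : de n.+1 t = de n t + t * dq n t.
Proof. exact: displ_annihilation. Qed.

Lemma dqS n t : dq n.+1 t = dq n t - t * de n.+1 t / n.+1%:R.
Proof.
have := displ_creation t n.+1 n; rewrite -pred_Sn => h.
have s0 := @sqnS_neq0 R n.
rewrite /dq /de -pred_Sn -(@sqn_sqr R n.+1); apply: (mulfI s0).
by rewrite h; field.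
Qed.

Lemma de0 t : de 0 t = 0.
Proof. by rewrite /de sqn0 mul0r. Qed.

Lemma is_derive_dq_de n t : t != 0 ->
  is_derive t (1 : R) (dq n) (dq1 n t) /\
  is_derive t (1 : R) (de n) (t * de n t + 2 * n%:R * dq n t - de n t / t).
Proof.
move=> t0; elim: n => [|n [hq he]].
  split.
    rewrite /dq1 de0 mulr0 subr0.
    have e : dq 0 = fun t => expR (- (t ^+ 2 * 2^-1)) * ((Num.sqrt (0`!)%:R)^-1 : R).
      by apply/funext => u; rewrite /dq /= expr0 div1r.
    rewrite e; eapply isdE; first by isd.
    by rewrite /=; field; rewrite fact0 sqrtr1 oner_neq0.
  have -> : de 0 = fun=> 0 by apply/funext => u; rewrite de0.
  by eapply isdE; [exact: isdC|rewrite mulr0 mul0r mulr0 mul0r; ring].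
have n1 : 1 + n%:R != 0 :> R by rewrite addrC natr1 pnatr_eq0.
have he1 : is_derive t (1 : R) (de n.+1)
    (t * de n.+1 t + 2 * n.+1%:R * dq n.+1 t - de n.+1 t / t).
  have -> : de n.+1 = fun t => de n t + t * dq n t by apply/funext => u; rewrite deS.
  eapply isdE; first by isd.
  rewrite dqS deS /dq1 -natr1; by field; rewrite t0 n1.
split; last exact: he1.
have -> : dq n.+1 = fun t => dq n t - t * de n.+1 t * (n.+1%:R)^-1.
  by apply/funext => u; rewrite dqS.
eapply isdE; first by isd.
by rewrite /dq1 dqS deS -natr1; field; rewrite t0 n1.
Qed.

Lemma is_derive_dq n t : t != 0 -> is_derive t (1 : R) (dq n) (dq1 n t).
Proof. by move=> t0; have [] := is_derive_dq_de n t0. Qed.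

Lemma is_derive_dq1 n t : t != 0 -> is_derive t (1 : R) (dq1 n)
  (- (4 * n%:R + 2) * dq n t + t ^+ 2 * dq n t - dq1 n t / t).
Proof.
move=> t0; have [h1 h2] := is_derive_dq_de n t0.
rewrite /dq1 in h1 *; eapply isdE; first by isd.
by rewrite /=; field.
Qed.

(** The derivative formulas divide by [t]; continuity supplies the initial values at 0. *)
Lemma continuous_dq_de n : continuous (dq n) /\ continuous (de n).
Proof.
elim: n => [|n [hq he]].
  split => t.
    have e : dq 0 = fun t => expR (- (t ^+ 2 * 2^-1)) * ((Num.sqrt (0`!)%:R)^-1 : R).
      by apply/funext => u; rewrite /dq /= expr0 div1r.
    rewrite e; eapply is_derive_continuous; by isd.
  have -> : de 0 = fun=> 0 by apply/funext => u; rewrite de0.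
  exact: cst_continuous.
have he1 : continuous (de n.+1).
  have -> : de n.+1 = fun t => de n t + t * dq n t by apply/funext => u; rewrite deS.
  by move=> t; apply: cvgD; [exact: he|apply: cvgM; [exact: cvg_id|exact: hq]].
split; last exact: he1.
move=> t.
have -> : dq n.+1 = fun t => dq n t - t * de n.+1 t * (n.+1%:R)^-1.
  by apply/funext => u; rewrite dqS.
apply: cvgB; first exact: hq.
apply: cvgM; last exact: cvg_cst.
by apply: cvgM; [exact: cvg_id|exact: he1].
Qed.

Lemma continuous_dq1 n : continuous (dq1 n).
Proof.
have [c1 c2] := continuous_dq_de n => t.
have -> : dq1 n = fun t => - (t * dq n t) - 2 * de n t by [].
apply: cvgB; last by apply: cvgM; [exact: cvg_cst|exact: c2].
by apply: cvgN; apply: cvgM; [exact: cvg_id|exact: c1].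
Qed.

Lemma dq_at0 n : dq n 0 = 1.
Proof. by rewrite /dq displ0 eqxx. Qed.

Lemma de_at0 n : de n 0 = 0.
Proof.
rewrite /de displ0; case: n => [|n]; first by rewrite sqn0 mul0r.
by rewrite /= gtn_eqF // mulr0.
Qed.

Lemma normr_displ_le1 t m n : `|displ t m n| <= 1.
Proof.
rewrite -(@ler_pXn2r _ 2) ?nnegrE // expr1n real_normK ?num_real //.
exact: sqr_displ_le1.
Qed.

Lemma normr_dq1 n t : 0 <= t -> `|dq1 n t| <= t + 2 * sqn n.
Proof.
move=> t0; rewrite /dq1; apply: (le_trans (ler_normB _ _)).
rewrite normrN !normrM (ger0_norm t0) (ger0_norm (sqn_ge0 n)) normr_nat.
apply: lerD; first by rewrite -[leRHS]mulr1 ler_wpM2l // normr_displ_le1.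
by rewrite ler_pM2l // -[leRHS]mulr1 ler_wpM2l ?sqn_ge0 // normr_displ_le1.
Qed.

End diagonal_ode.

(** * Legendre polynomials and Wallis integrals *)

Section legendre.
Context {R : realType}.
Implicit Types (c th : R) (n k : nat).

(* The pair (P_n, P_{n+1}) of Legendre polynomials, which makes Bonnet's
   recursion structural. *)
Fixpoint legendre_pair n c : R * R :=
  if n is n'.+1 then
    let: (a, b) := legendre_pair n' c in
    (b, ((2 * n'%:R + 3) * c * b - (n'%:R + 1) * a) / (n'%:R + 2))
  else (1, c).

Fixpoint dlegendre_pair n c : R * R :=
  if n is n'.+1 then
    let: (a, b) := legendre_pair n' c in
    let: (a', b') := dlegendre_pair n' c in
    (b', ((2 * n'%:R + 3) * (b + c * b') - (n'%:R + 1) * a') / (n'%:R + 2))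
  else (0, 1).

Definition lp n c := (legendre_pair n c).1.
Definition ld n c := (dlegendre_pair n c).1.

Let nat2_neq0 n : n%:R + 2 != 0 :> R.
Proof. by rewrite gt_eqF // ltr_wpDl ?ler0n. Qed.

Lemma lpSS n c : lp n.+2 c =
  ((2 * n%:R + 3) * c * lp n.+1 c - (n%:R + 1) * lp n c) / (n%:R + 2).
Proof.
by rewrite /lp /=; case: (legendre_pair n c).
Qed.

Lemma ldSS n c : ld n.+2 c =
  ((2 * n%:R + 3) * (lp n.+1 c + c * ld n.+1 c) - (n%:R + 1) * ld n c) / (n%:R + 2).
Proof.
by rewrite /lp /ld /=; case: (legendre_pair n c) => a b; case: (dlegendre_pair n c).
Qed.

Lemma pair_ind (P : nat -> Prop) :
  P 0%N -> P 1%N -> (forall n, P n -> P n.+1 -> P n.+2) -> forall n, P n.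
Proof.
move=> P0 P1 PS n; suff : P n /\ P n.+1 by case.
by elim: n => [//|n [h1 h2]]; split => //; exact: PS.
Qed.

Lemma lp_at1 n : lp n 1 = 1.
Proof.
elim/pair_ind: n => // n h1 h2; rewrite lpSS h1 h2.
by have := nat2_neq0 n => ?; field.
Qed.

Lemma is_derive_lp n c : is_derive c (1 : R) (lp n) (ld n c).
Proof.
elim/pair_ind: n => [||n h1 h2].
- exact: isdC.
- exact: isdI.
have -> : lp n.+2 = fun c => ((2 * n%:R + 3) * c * lp n.+1 c - (n%:R + 1) * lp n c) * (n%:R + 2)^-1.
  by apply/funext => d; rewrite lpSS.
eapply isdE; first by isd.
by rewrite /= ldSS; have := nat2_neq0 n => ?; field.
Qed.

Lemma continuous_ld n : continuous (ld n).
Proof.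
elim/pair_ind: n => [||n h1 h2].
- exact: cst_continuous.
- exact: cst_continuous.
have -> : ld n.+2 = fun c => ((2 * n%:R + 3) * (lp n.+1 c + c * ld n.+1 c) - (n%:R + 1) * ld n c) * (n%:R + 2)^-1.
  by apply/funext => d; rewrite ldSS.
move=> c; apply: cvgM; last exact: cvg_cst.
apply: cvgB; last by apply: cvgM; [exact: cvg_cst|exact: h1].
apply: cvgM; first exact: cvg_cst.
apply: cvgD; first exact: (is_derive_continuous (is_derive_lp _ _)).
by apply: cvgM; [exact: cvg_id|exact: h2].
Qed.

Lemma ld_lp n c :
  (1 - c ^+ 2) * ld n.+1 c = (n%:R + 1) * (lp n c - c * lp n.+1 c) /\
  (1 - c ^+ 2) * ld n c = (n%:R + 1) * (c * lp n c - lp n.+1 c).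
Proof.
elim: n => [|n [hA hB]]; first by rewrite /lp /ld /=; split; ring.
have n2 := nat2_neq0 n.
have e : (n%:R + 2) * lp n.+2 c =
    (2 * n%:R + 3) * c * lp n.+1 c - (n%:R + 1) * lp n c.
  by rewrite lpSS mulrC divfK.
split; last by rewrite hA -[n.+1%:R]natr1; lra.
rewrite ldSS -[n.+1%:R]natr1; apply: (mulfI n2).
have -> : (n%:R + 2) * ((1 - c ^+ 2) * (((2 * n%:R + 3) * (lp n.+1 c + c * ld n.+1 c)
     - (n%:R + 1) * ld n c) / (n%:R + 2))) =
   (2 * n%:R + 3) * ((1 - c ^+ 2) * lp n.+1 c + c * ((1 - c ^+ 2) * ld n.+1 c))
     - (n%:R + 1) * ((1 - c ^+ 2) * ld n c) by field.
rewrite hA hB.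
have -> : (n%:R + 2) * ((n%:R + 1 + 1) * (lp n.+1 c - c * lp n.+2 c)) =
  (n%:R + 1 + 1) * ((n%:R + 2) * lp n.+1 c - c * ((n%:R + 2) * lp n.+2 c)) by ring.
by rewrite e; ring.
Qed.

(* [wallis k] is 'C(2k, k) / 4^k. *)
Fixpoint wallis k : R :=
  if k is k'.+1 then wallis k' * (2 * k'%:R + 1) / (2 * k'%:R + 2) else 1.

Lemma lp_at0 k : lp k.*2 0 = (-1) ^+ k * wallis k /\ lp k.*2.+1 0 = 0.
Proof.
elim: k => [|k [h1 h2]]; first by rewrite /lp /= mul1r.
have n2 := nat2_neq0 k.*2.
have n2' : 2 * k%:R + 2 != 0 :> R.
  by rewrite gt_eqF // ltr_wpDl ?mulr_ge0 ?ler0n.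
have n2'' : k%:R * 2 + 2 != 0 :> R by rewrite mulrC.
have h3 : lp k.+1.*2 0 = (-1) ^+ k.+1 * wallis k.+1.
  rewrite doubleS lpSS h1 h2 -muln2 natrM exprS /=; field.
  by rewrite ?n2' ?n2''.
split => //; rewrite doubleS lpSS -doubleS h2 !mulr0 mul0r; ring.
Qed.

Lemma wallis_gt0 k : 0 < wallis k.
Proof.
by elim: k => [|k IH] //=; rewrite divr_gt0 // ?mulr_gt0 // ltr_wpDl ?mulr_ge0 ?ler0n.
Qed.

Lemma wallis_le1 k : wallis k <= 1.
Proof.
elim: k => [|k IH] //=.
have h : 0 < 2 * k%:R + 2 :> R by rewrite ltr_wpDl ?mulr_ge0 ?ler0n.
rewrite ler_pdivrMr // mul1r; apply: (@le_trans _ _ (2 * k%:R + 1)); last lra.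
by rewrite -[leRHS]mul1r ler_wpM2r // addr_ge0 ?mulr_ge0 ?ler0n.
Qed.

(** The primitives of sin^n and sin^(n+1) vanishing at 0, defined through the reduction formula of
    integration by parts, so that the Wallis integrals involve no integration. *)
Fixpoint sin_pair n th : R * R :=
  if n is n'.+1 then
    let: (a, b) := sin_pair n' th in
    (b, ((n'%:R + 1) * a - cos th * sin th ^+ n'.+1) / (n'%:R + 2))
  else (th, 1 - cos th).

Definition int_sin n th := (sin_pair n th).1.

Lemma int_sinSS n th : int_sin n.+2 th =
  ((n%:R + 1) * int_sin n th - cos th * sin th ^+ n.+1) / (n%:R + 2).
Proof. by rewrite /int_sin /=; case: (sin_pair n th). Qed.

Lemma is_derive_int_sin n th : is_derive th (1 : R) (int_sin n) (sin th ^+ n).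
Proof.
elim/pair_ind: n => [||n h1 h2].
- by rewrite expr0; exact: isdI.
- rewrite expr1; eapply isdE; first by rewrite /int_sin /=; isd.
  by ring.
have -> : int_sin n.+2 = fun th => ((n%:R + 1) * int_sin n th - cos th * sin th ^+ n.+1) * (n%:R + 2)^-1.
  by apply/funext => d; rewrite int_sinSS.
eapply isdE; first by isd.
rewrite /= exprS [sin th ^+ n.+2]exprS [sin th ^+ n.+1]exprS -[n.+1%:R]natr1.
have hs := sin2cos2 th; have n2 := nat2_neq0 n.
set S := sin th ^+ n; have hs' : cos th * cos th = 1 - sin th * sin th.
  by rewrite -!expr2 hs; ring.
by field: hs'.
Qed.

Lemma int_sin_at0 n : int_sin n 0 = 0.
Proof.
elim/pair_ind: n => [||n h1 h2]; first by [].
  by rewrite /int_sin /= cos0 subrr.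
by rewrite int_sinSS h1 sin0 expr0n /= !mulr0 subrr mul0r.
Qed.

Lemma int_sin_pihalf k : int_sin k.*2 (pi / 2) = wallis k * (pi / 2) /\
  (2 * k%:R + 1) * wallis k * int_sin k.*2.+1 (pi / 2) = 1.
Proof.
elim: k => [|k [h1 h2]].
  by rewrite /int_sin /= cos_pihalf mul1r; split => //; ring.
have w0 := wallis_gt0 k.
have k0 : 0 <= 2 * k%:R :> R by rewrite mulr_ge0 ?ler0n.
have e2 : k.*2%:R = 2 * k%:R :> R by rewrite -muln2 natrM mulrC.
rewrite doubleS !int_sinSS cos_pihalf !mul0r !subr0; split.
  rewrite h1 e2 /=; field; rewrite gt_eqF //; lra.
rewrite -[k.*2.+1%:R]natr1 -[k.+1%:R]natr1 e2 /= -[RHS]h2.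
field; apply/andP; split; rewrite gt_eqF //; lra.
Qed.

Lemma int_sin_nincr n : int_sin n.+1 (pi / 2) <= int_sin n (pi / 2) :> R.
Proof.
rewrite -subr_le0.
have := @is_derive_nincr R (fun x => int_sin n.+1 x - int_sin n x)
  (fun x => sin x ^+ n.+1 - sin x ^+ n) 0 (pi / 2).
rewrite !int_sin_at0 subrr; apply.
- by rewrite divr_ge0 // pi_ge0.
- move=> x _; have h1 := is_derive_int_sin n x; have h2 := is_derive_int_sin n.+1 x.
  by isd.
- move=> x /andP[x0 x1]; rewrite subr_le0 exprS ler_piMl ?sin_le1 // exprn_ge0 //.
  apply: sin_ge0_pi; rewrite x0 /=; apply: (le_trans x1).
  by have := @pi_ge0 R; lra.
Qed.

(** The Wallis integrals decrease, I_(2k+2) <= I_(2k+1) <= I_(2k), and the odd one is the inverse of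
    [(2 * k%:R + 1) * wallis k]. The right inequality gives the lower bound, the left one the upper
    bound. *)
Lemma wallis_bounds k :
  2 <= pi * (2 * k%:R + 1) * wallis k ^+ 2 :> R /\ pi * k%:R * wallis k ^+ 2 <= 1 :> R.
Proof.
have [h1 h2] := int_sin_pihalf k; have [h3 _] := int_sin_pihalf k.+1.
have m1 := int_sin_nincr k.*2; have m2 := int_sin_nincr k.*2.+1.
have w0 := wallis_gt0 k; have k0 : 0 <= k%:R :> R by rewrite ler0n.
have c0 : 0 < (2 * k%:R + 1) * wallis k by rewrite mulr_gt0 //; lra.
rewrite h1 in m1; rewrite -doubleS h3 in m2.
have n1 := ler_wpM2l (ltW c0) m1; have n2 := ler_wpM2l (ltW c0) m2.
rewrite h2 in n1 n2; split; first by rewrite expr2; lra.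
have e : (2 * k%:R + 1) * wallis k * (wallis k.+1 * (pi / 2)) * (4 * (k%:R + 1)) =
   pi * (2 * k%:R + 1) ^+ 2 * wallis k ^+ 2.
  by rewrite /=; field; rewrite gt_eqF //; lra.
have k1 : 0 <= 4 * (k%:R + 1) :> R by lra.
have := ler_wpM2r k1 n2; rewrite e mul1r => h.
have p0 : 0 < pi * wallis k ^+ 2 by rewrite mulr_gt0 ?pi_gt0 ?exprn_gt0.
have : 4 * (k%:R + 1) * (pi * k%:R * wallis k ^+ 2) <= 4 * (k%:R + 1).
  apply: le_trans h; rewrite -subr_ge0.
  have -> : pi * (2 * k%:R + 1) ^+ 2 * wallis k ^+ 2 - 4 * (k%:R + 1) *
    (pi * k%:R * wallis k ^+ 2) = pi * wallis k ^+ 2 by ring.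
  exact: ltW.
by rewrite -[leRHS]mulr1 ler_pM2l //; lra.
Qed.

Lemma sin_le x : 0 <= x -> sin x <= x :> R.
Proof.
move=> x0; rewrite -subr_le0.
have := @is_derive_nincr R (fun y => sin y - y) (fun y => cos y - 1) 0 x x0.
rewrite sin0 subrr; apply => y _.
by rewrite subr_le0 cos_le1.
Qed.

Lemma cos_ge x : 0 <= x -> 1 - x ^+ 2 / 2 <= cos x :> R.
Proof.
move=> x0; rewrite -subr_le0.
have := @is_derive_nincr R (fun y => 1 - y ^+ 2 * 2^-1 - cos y) (fun y => sin y - y) 0 x x0.
rewrite cos0 expr0n /= mul0r subr0 subrr; apply => y.
  by move=> _; eapply isdE; [isd|rewrite /=; field].
by move=> /andP[y0 _]; rewrite subr_le0 sin_le.
Qed.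

Lemma sin_ge x : 0 <= x -> x - x ^+ 3 / 6 <= sin x :> R.
Proof.
move=> x0; rewrite -subr_le0.
have := @is_derive_nincr R (fun y => y - y ^+ 3 * 6^-1 - sin y)
   (fun y => 1 - y ^+ 2 / 2 - cos y) 0 x x0.
rewrite sin0 expr0n /= mul0r subr0 subrr; apply => y.
  by move=> _; eapply isdE; [isd|rewrite /=; field].
by move=> /andP[y0 _]; rewrite subr_le0 cos_ge.
Qed.

End legendre.

(** * Comparison of Laguerre functions with Legendre polynomials *)

Section hilb_comparison.
Context {R : realType}.
Variables (n N' : nat) (b : R).
Let N := N'.+1.
Let M : R := N%:R + 1 / 2.
Hypotheses (b0 : 0 < b) (Mb : (4 * n%:R + 2) * b ^+ 2 = M ^+ 2).

(* [Q] solves [Q'' + Q' / th + M ^+ 2 * Q = b ^+ 4 * th ^+ 2 * Q] and [H], the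
   Liouville transform of the Legendre polynomial, solves
   [H'' + H' / th + M ^+ 2 * H = - Psi * H] with [Psi] bounded at 0; both equal
   1 at 0. *)
Let Q th := dq n (b * th).
Let Q1 th := b * dq1 n (b * th).
Let P (th : R) := lp N (cos th).
Let P1 (th : R) := - (N%:R * (lp N' (cos th) - cos th * lp N (cos th))) / sin th.
Let phi (th : R) : R := Num.sqrt (sin th / th).
(** The logarithmic derivative of [phi]. *)
Let kap (th : R) : R := (cos th / sin th - th^-1) / 2.
Let H th := phi th * P th.
Let H1 th := phi th * (P1 th + kap th * P th).
Let Psi (th : R) : R := (sin th ^+ 2)^-1 / 4 - (th ^+ 2)^-1 / 4.

Let dQ th : th != 0 -> is_derive th (1 : R) Q (Q1 th).
Proof.
move=> h0; have h : b * th != 0 by rewrite mulf_neq0 // gt_eqF.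
eapply isdE; first by eapply (isd_comp (is_derive_dq n h)); isd.
by rewrite /Q1 /=; ring.
Qed.

Let dQ1 th : th != 0 -> is_derive th (1 : R) Q1
  (- M ^+ 2 * Q th + b ^+ 4 * th ^+ 2 * Q th - Q1 th / th).
Proof.
move=> h0; have h : b * th != 0 by rewrite mulf_neq0 // gt_eqF.
eapply isdE.
  by rewrite /Q1; eapply isdM; [exact: isdC|eapply (isd_comp (is_derive_dq1 n h)); isd].
rewrite -Mb /Q /Q1 /=; field.
by rewrite h0 gt_eqF.
Qed.

Let dP th : sin th != 0 -> is_derive th (1 : R) P (P1 th).
Proof.
move=> s0; have [hA _] := ld_lp N' (cos th).
eapply isdE; first by eapply (isd_comp (is_derive_lp N _)); isd.
rewrite /P1; apply: (mulIf s0); rewrite divfK //.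
by rewrite /N -natr1 -hA -sin2cos2; ring.
Qed.

Let dP1 th : sin th != 0 -> is_derive th (1 : R) P1
  (- (M ^+ 2 - 1 / 4) * P th - cos th / sin th * P1 th).
Proof.
move=> s0; have [hA hB] := ld_lp N' (cos th).
have h1 := isd_comp (is_derive_lp N (cos th)) (is_derive_cos th).
have h2 := isd_comp (is_derive_lp N' (cos th)) (is_derive_cos th).
have s2 : 1 - cos th ^+ 2 != 0 by rewrite -sin2cos2 sqrf_eq0.
have key : cos th * ld N (cos th) - ld N' (cos th) = N%:R * lp N (cos th).
  apply: (mulfI s2); rewrite mulrBr mulrCA /N hA hB -natr1; ring.
have hs : is_derive th (1 : R) (fun y => (sin y)^-1) (- cos th / sin th ^+ 2).
  by apply: isdV => //; exact: is_derive_sin.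
eapply isdE; first by rewrite /P1; isd.
have -> : ld N' (cos th) = cos th * ld N (cos th) - N%:R * lp N (cos th).
  by rewrite -key; ring.
by rewrite /P1 /P /M /=; field.
Qed.

Let dphi th : 0 < th -> 0 < sin th -> is_derive th (1 : R) phi (phi th * kap th).
Proof.
move=> t0 s0; have u0 : 0 < sin th / th by rewrite divr_gt0.
have tn0 := lt0r_neq0 t0; have sn0 := lt0r_neq0 s0.
have hi := isdV tn0 (isdI th).
have hu := isdM (is_derive_sin th) hi.
have h := @isd_comp R Num.sqrt (fun y => sin y / y) th _ _ (is_derive1_sqrt u0) hu.
rewrite /phi; apply: (isdE h).
have r0 : Num.sqrt (sin th / th) != 0 by rewrite gt_eqF // sqrtr_gt0.
have e : sin th / th = Num.sqrt (sin th / th) * Num.sqrt (sin th / th).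
  by rewrite -expr2 sqr_sqrtr // ltW.
rewrite /kap; set r := Num.sqrt _ in r0 e *.
have -> : (cos th * th^-1 + sin th * (- 1 / th ^+ 2)) = 2 * (sin th / th) * ((cos th / sin th - th^-1) / 2).
  by field; rewrite tn0 sn0.
by rewrite e; field; rewrite r0 tn0 sn0.
Qed.

Let dH th : 0 < th -> 0 < sin th -> is_derive th (1 : R) H (H1 th).
Proof.
move=> t0 s0; have h1 := dphi t0 s0; have h2 := dP (lt0r_neq0 s0).
by rewrite /H; eapply isdE; [isd|rewrite /H1; ring].
Qed.

Let dH1 th : 0 < th -> 0 < sin th -> is_derive th (1 : R) H1
  (- M ^+ 2 * H th - Psi th * H th - H1 th / th).
Proof.
move=> t0 s0; have h1 := dphi t0 s0; have h2 := dP (lt0r_neq0 s0).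
have h3 := dP1 (lt0r_neq0 s0).
have tn0 := lt0r_neq0 t0; have sn0 := lt0r_neq0 s0.
have h4 : is_derive th (1 : R) kap ((- (sin th ^+ 2)^-1 + (th ^+ 2)^-1) / 2).
  have hi := isdV tn0 (isdI th).
  have hs := isdV sn0 (is_derive_sin th).
  eapply isdE; first by rewrite /kap; isd.
  have := sin2cos2 th => e; rewrite /=.
  have e' : cos th * cos th = 1 - sin th * sin th by rewrite -!expr2 e; ring.
  by field: e'; rewrite tn0 sn0.
eapply isdE; first by rewrite /H1; isd.
rewrite /H1 /H /kap /Psi /=.
have := sin2cos2 th => e.
have e' : cos th * cos th = 1 - sin th * sin th by rewrite -!expr2 e; ring.
by field: e'; rewrite tn0 sn0.
Qed.

Let sin_lb (th : R) : 0 < th -> th <= 2 -> th / 3 <= sin th.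
Proof.
move=> t0 t2; apply: le_trans (sin_ge (ltW t0)).
have : th ^+ 2 <= 4 by rewrite (_ : 4 = 2 ^+ 2) ?lerXn2r ?nnegrE ?(ltW t0) //; ring.
move=> /(ler_wpM2l (ltW t0)); rewrite (_ : th * th ^+ 2 = th ^+ 3); last by ring.
lra.
Qed.

Let Psi_bound (th : R) : 0 < th -> th <= 2 -> `|Psi th| <= 1.
Proof.
move=> t0 t2; have s1 := sin_lb t0 t2; have s2 := sin_le (ltW t0).
have s3 := sin_ge (ltW t0).
have s0 : 0 < sin th by apply: lt_le_trans s1; rewrite divr_gt0.
have tn0 := lt0r_neq0 t0; have sn0 := lt0r_neq0 s0.
have -> : Psi th = (th ^+ 2 - sin th ^+ 2) / (4 * (th ^+ 2 * sin th ^+ 2)).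
  by rewrite /Psi; field; rewrite tn0 sn0.
have d0 : 0 < 4 * (th ^+ 2 * sin th ^+ 2) by rewrite !mulr_gt0 // exprn_gt0.
have n0 : 0 <= th ^+ 2 - sin th ^+ 2.
  by rewrite subr_ge0 lerXn2r ?nnegrE // ltW.
rewrite ger0_norm; last by rewrite divr_ge0 // ltW.
rewrite ler_pdivrMr // mul1r.
apply: (@le_trans _ _ (th ^+ 4 / 3)).
  have -> : th ^+ 2 - sin th ^+ 2 = (th - sin th) * (th + sin th) by ring.
  have -> : th ^+ 4 / 3 = (th ^+ 3 / 6) * (2 * th) by field.
  apply: ler_pM; rewrite ?subr_ge0 ?addr_ge0 ?(ltW t0) ?(ltW s0) //; lra.
have : (th / 3) ^+ 2 <= sin th ^+ 2 by rewrite lerXn2r ?nnegrE ?(ltW s0) ?divr_ge0 ?(ltW t0).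
have t20 : 0 <= th ^+ 2 by rewrite sqr_ge0.
move=> /(ler_wpM2l t20).
rewrite (_ : th ^+ 2 * (th / 3) ^+ 2 = th ^+ 4 / 9); last by field.
lra.
Qed.

Let En (th : R) := (Q1 th - H1 th) ^+ 2 + M ^+ 2 * (Q th - H th) ^+ 2.
Let C : R := 4 * b ^+ 4 + 1.

Let C0 : 0 <= C.
Proof. by rewrite addr_ge0 // mulr_ge0 // exprn_ge0 // ltW. Qed.

Let dEn (th : R) := 2 * (Q1 th - H1 th) * (- M ^+ 2 * Q th + b ^+ 4 * th ^+ 2 * Q th - Q1 th / th
   - (- M ^+ 2 * H th - Psi th * H th - H1 th / th))
   + M ^+ 2 * (2 * (Q th - H th) * (Q1 th - H1 th)).

Let is_derive_En (th : R) : 0 < th -> 0 < sin th -> is_derive th (1 : R) En (dEn th).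
Proof.
move=> t0 s0; have h1 := dQ (lt0r_neq0 t0); have h2 := dQ1 (lt0r_neq0 t0).
have h3 := dH t0 s0; have h4 := dH1 t0 s0.
by rewrite /En; eapply isdE; [isd|rewrite /dEn /=; ring].
Qed.

Let M1 : 1 <= M.
Proof.
have : (1 : R) <= N%:R by rewrite ler1n.
by rewrite /M; lra.
Qed.

(** The terms in [M ^+ 2] cancel and the singular damping [w1 ^+ 2 / th] has the favourable sign.
    The forcing [F] is bounded because [|Q| <= 1] by unitarity and [H = Q - w]. No constant depends
    on [M], so [Q - H] ends up of order 1/M. *)
Let dEn_le (th : R) : 0 < th -> th <= 2 -> dEn th <= 2 * En th + 2 * C ^+ 2.
Proof.
move=> t0 t2.
have q1 : `|Q th| <= 1 by exact: normr_displ_le1.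
have psi1 := Psi_bound t0 t2.
set w := Q th - H th; set w1 := Q1 th - H1 th.
pose F := b ^+ 4 * th ^+ 2 * Q th + Psi th * H th.
have b40 : 0 <= b ^+ 4 by rewrite exprn_ge0 // ltW.
have F1 : `|F| <= C + `|w|.
  apply: (le_trans (ler_normD _ _)).
  have : `|b ^+ 4 * th ^+ 2 * Q th| <= 4 * b ^+ 4.
    rewrite normrM -[leRHS]mulr1; apply: ler_pM => //.
    rewrite ger0_norm; last by rewrite mulr_ge0 // sqr_ge0.
    rewrite mulrC ler_wpM2r //.
    by rewrite (_ : 4 = 2 ^+ 2) ?lerXn2r ?nnegrE ?(ltW t0) //; ring.
  have : `|Psi th * H th| <= 1 + `|w|.
    rewrite normrM; apply: (@le_trans _ _ (1 * `|H th|)); first by rewrite ler_wpM2r.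
    rewrite mul1r (_ : H th = Q th - w); last by rewrite /w; ring.
    by apply: (le_trans (ler_normB _ _)); lra.
  by rewrite /C; lra.
have F2 : F ^+ 2 <= 2 * C ^+ 2 + 2 * w ^+ 2.
  rewrite -(real_normK (num_real F)) -(real_normK (num_real w)).
  apply: (@le_trans _ _ ((C + `|w|) ^+ 2)).
    have Cw : 0 <= C + `|w| := addr_ge0 C0 (normr_ge0 w).
    by rewrite lerXn2r ?nnegrE //.
  by have := sqr_ge0 (C - `|w|); lra.
have tn0 := lt0r_neq0 t0.
have -> : dEn th = 2 * w1 * F - 2 * (w1 ^+ 2 / th).
  by rewrite /dEn /F /w1; field.
have p1 : 0 <= w1 ^+ 2 / th by rewrite divr_ge0 ?sqr_ge0 ?ltW.
have p2 := sqr_ge0 (w1 - F).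
have M2 : 1 <= M ^+ 2 by rewrite exprn_ege1.
have w2 := sqr_ge0 w.
have p3 := ler_wpM2r w2 M2.
have p4 := sqr_ge0 w1.
rewrite /En -/w -/w1; lra.
Qed.

(** [Q] and [H] share the limits 1 of the values and 0 of the derivatives at 0, but the equations
    are singular there; the Gronwall argument therefore starts at a positive point of small
    energy. *)
Let En_small (eta : R) : 0 < eta -> exists th, [/\ 0 < th, th <= 1 & En th <= eta].
Proof.
move=> eta0.
have cQ : Q th @[th --> 0^'+] --> (1 : R).
  have h : continuous (fun th : R => dq n (b * th)).
    move=> x; apply: (@continuous_comp _ _ _ (fun th => b * th)).
      by apply: cvgM; [exact: cvg_cst|exact: cvg_id].
    exact: (continuous_dq_de n).1.
  by have /cvg_at_right_filter := h 0; rewrite mulr0 dq_at0.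
have cQ1 : Q1 th @[th --> 0^'+] --> (0 : R).
  have h : continuous (fun th : R => b * dq1 n (b * th)).
    move=> x; apply: cvgM; first exact: cvg_cst.
    apply: (@continuous_comp _ _ _ (fun th => b * th)).
      by apply: cvgM; [exact: cvg_cst|exact: cvg_id].
    exact: continuous_dq1.
  have /cvg_at_right_filter := h 0.
  by rewrite /dq1 mulr0 mul0r oppr0 de_at0 mulr0 subr0 mulr0.
have near0 : \forall th \near (0 : R)^'+, 0 < th < 1.
  near=> th; apply/andP; split; first by near: th; exact: nbhs_right_gt.
  by near: th; exact: nbhs_right_lt.
have cP : P th @[th --> 0^'+] --> (1 : R).
  have h : continuous (fun th : R => lp N (cos th)).
    move=> x; have := isd_comp (is_derive_lp N (cos x)) (is_derive_cos x).
    exact: is_derive_continuous.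
  by have /cvg_at_right_filter := h 0; rewrite cos0 lp_at1.
have cP1 : P1 th @[th --> 0^'+] --> (0 : R).
  have h : continuous (fun th : R => - (sin th * ld N (cos th))).
    move=> x; apply: cvgN; apply: cvgM; first exact: continuous_sin.
    have := @continuous_comp _ _ _ (@cos R) (@ld R N) x (@continuous_cos R x) (@continuous_ld R N (cos x)); exact.
  have /cvg_at_right_filter := h 0; rewrite sin0 mul0r oppr0.
  apply: cvg_trans; apply: near_eq_cvg; near=> th.
  have /andP[t0 t1] : 0 < th < 1 by near: th.
  have s0 : 0 < sin th.
    by apply: lt_le_trans (sin_lb t0 _); [rewrite divr_gt0|lra].
  have [hA _] := ld_lp N' (cos th).
  rewrite /P1; apply: (mulIf (lt0r_neq0 s0)); rewrite divfK ?lt0r_neq0 //.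
  by rewrite /N -natr1 -hA -sin2cos2; ring.
have cid : (fun th : R => th) @ 0^'+ --> (0 : R).
  by apply: cvg_at_right_filter; exact: cvg_id.
have cphi : phi th @[th --> 0^'+] --> (1 : R).
  apply: (@squeeze_cvgr _ _ _ _ (fun th => 1 - th * th) (cst 1)).
  - near=> th; have /andP[t0 t1] : 0 < th < 1 by near: th.
    have s0 : 0 < sin th.
      by apply: lt_le_trans (sin_lb t0 _); [rewrite divr_gt0|lra].
    have u1 : sin th / th <= 1 by rewrite ler_pdivrMr // mul1r sin_le // ltW.
    have p1 : phi th <= 1 by rewrite /phi -sqrtr1 ler_sqrt.
    rewrite p1 andbT; apply: (@le_trans _ _ (phi th ^+ 2)); last first.
      by rewrite expr2 ler_piMl // sqrtr_ge0.
    rewrite sqr_sqrtr; last by rewrite divr_ge0 ?ltW.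
    rewrite ler_pdivlMr //; apply: le_trans (sin_ge (ltW t0)).
    have : 0 <= th ^+ 3 by rewrite exprn_ge0 // ltW.
    lra.
  - rewrite -[X in _ --> X]subr0 -[X in _ - X](mul0r (0 : R)).
    by apply: cvgB; [exact: cvg_cst|exact: cvgM].
  - exact: cvg_cst.
have ckap : kap th @[th --> 0^'+] --> (0 : R).
  apply: (@squeeze_cvgr _ _ _ _ (fun th => - th) (fun th => th)) => //.
  - near=> th; have /andP[t0 t1] : 0 < th < 1 by near: th.
    have s1 : th / 3 <= sin th by apply: sin_lb => //; lra.
    have s0 : 0 < sin th by apply: lt_le_trans s1; rewrite divr_gt0.
    have s2 := sin_le (ltW t0); have s3 := sin_ge (ltW t0).
    have c2 := cos_ge (ltW t0); have c1 := cos_le1 th.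
    have t3 : 0 <= th ^+ 3 by rewrite exprn_ge0 // ltW.
    have e : kap th = (th * cos th - sin th) / (2 * (th * sin th)).
      by rewrite /kap; field; rewrite !gt_eqF.
    have d0 : 0 < 2 * (th * sin th) by rewrite !mulr_gt0.
    have d1 : th ^+ 3 / 3 <= th * (th * sin th).
      have := ler_wpM2l (sqr_ge0 th) s1.
      rewrite (_ : th ^+ 2 * (th / 3) = th ^+ 3 / 3); last by ring.
      by rewrite (_ : th ^+ 2 * sin th = th * (th * sin th)); last by ring.
    have k1 := ler_wpM2l (ltW t0) c2; have k2 := ler_wpM2l (ltW t0) c1.
    rewrite e -ler_norml normrM normfV (gtr0_norm d0) ler_pdivrMr // ler_norml.
    by apply/andP; split; lra.
  - by rewrite -[X in _ --> X]oppr0; exact: cvgN.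
have cEn : En th @[th --> 0^'+] --> (0 : R).
  have h1 : (Q1 th - H1 th) @[th --> 0^'+] --> (0 - 1 * (0 + 0 * 1) : R).
    apply: cvgB => //; apply: cvgM => //; apply: cvgD => //; exact: cvgM.
  have h2 : (Q th - H th) @[th --> 0^'+] --> (1 - 1 * 1 : R).
    by apply: cvgB => //; exact: cvgM.
  have := cvgD (cvgM h1 h1) (cvgM (cvg_cst (M ^+ 2)) (cvgM h2 h2)).
  rewrite !(mul0r, mulr0, mul1r, addr0, subrr, subr0).
  exact.
have /cvgr0Pnorm_le/(_ _ eta0) small := cEn.
have [th [/andP[t0 t1] hth]] := filter_ex (filterI near0 small).
exists th; split => //; first exact: ltW.
exact: le_trans (ler_norm _) hth.
Unshelve. all: by end_near. Qed.

(** At th = pi/2 everything about [H] is explicit: [phi] is sqrt(2/pi) and [kap] is -1/pi. The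
    factor [expR 4] majorizes the Gronwall factor exp(pi). *)
Lemma hilb_energy :
  (b * dq1 n (b * (pi / 2)) -
     Num.sqrt (2 / pi) * (- (N%:R * lp N' 0) - lp N 0 / pi)) ^+ 2
  + M ^+ 2 * (dq n (b * (pi / 2)) - Num.sqrt (2 / pi) * lp N 0) ^+ 2
  <= expR 4 * (1 + (4 * b ^+ 4 + 1) ^+ 2).
Proof.
have p0 := @pi_gt0 R; have p1 := @pihalf_ge1 R; have p2 := @pihalf_lt2 R.
have pn0 := lt0r_neq0 p0.
have phiE : phi (pi / 2) = Num.sqrt (2 / pi) by rewrite /phi sin_pihalf div1r invf_div.
have PE : P (pi / 2) = lp N 0 by rewrite /P cos_pihalf.
have kE : kap (pi / 2) = - pi^-1.
  have aux (p : R) : p != 0 -> (0 - (p / 2)^-1) / 2 = - p^-1 by move=> h; field.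
  by rewrite /kap cos_pihalf mul0r aux.
have P1E : P1 (pi / 2) = - (N%:R * lp N' 0).
  by rewrite /P1 cos_pihalf sin_pihalf mul0r subr0 divr1.
have -> : Num.sqrt (2 / pi) * (- (N%:R * lp N' 0) - lp N 0 / pi) = H1 (pi / 2).
  by rewrite /H1 phiE PE kE P1E; ring.
rewrite -phiE -PE -/(H _) -/(Q _) -/(Q1 _) -/(En _) -/C.
have [t [t0 t1 hEn]] := En_small (@ltr01 R).
pose G x := expR (- (2 * x)) * (En x + C ^+ 2).
pose dG x := expR (- (2 * x)) * (dEn x - 2 * (En x + C ^+ 2)).
have : G (pi / 2) <= G t.
  apply: (@is_derive_nincr R G dG); first exact: le_trans p1.
  - move=> x /andP[tx xp]; have x0 : 0 < x by apply: lt_le_trans tx.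
    have s0 : 0 < sin x.
      apply: lt_le_trans (sin_lb x0 _); first by rewrite divr_gt0.
      by apply: ltW; apply: le_lt_trans p2.
    have h := is_derive_En x0 s0.
    by rewrite /G; eapply isdE; [isd|rewrite /dG /=; ring].
  - move=> x /andP[tx xp]; have x0 : 0 < x by apply: lt_le_trans tx.
    have x2 : x <= 2 by apply: ltW; apply: le_lt_trans p2.
    rewrite /dG pmulr_rle0 ?expR_gt0 //; have := dEn_le x0 x2; lra.
rewrite /G => hG.
have c2 := sqr_ge0 C.
have e1 : expR (- (2 * t)) * (En t + C ^+ 2) <= 1 + C ^+ 2.
  apply: (@le_trans _ _ (1 * (En t + C ^+ 2))); last by rewrite mul1r lerD2r.
  apply: ler_wpM2r.
    by apply: addr_ge0 => //; apply: addr_ge0; [|apply: mulr_ge0]; exact: sqr_ge0.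
  by rewrite expR_le1 oppr_le0 mulr_ge0 // ltW.
have e2 : En (pi / 2) + C ^+ 2 <= expR (2 * (pi / 2)) * (1 + C ^+ 2).
  rewrite -ler_pdivrMl ?expR_gt0 // -expRN; exact: le_trans hG e1.
have e3 : expR (2 * (pi / 2)) <= expR 4 :> R by rewrite ler_expR; lra.
have e4 : expR (2 * (pi / 2)) * (1 + C ^+ 2) <= expR 4 * (1 + C ^+ 2).
  by rewrite ler_wpM2r // addr_ge0.
lra.
Qed.

End hilb_comparison.

(** * From the Legendre polynomial to the cosine *)

Section diagonal_asymptotics.
Context {R : realType}.
Implicit Types (t : R) (n k : nat).

Definition nu n : R := Num.sqrt (4 * n%:R + 2).

Lemma nu_sqr n : nu n ^+ 2 = 4 * n%:R + 2.
Proof. by rewrite sqr_sqrtr // addr_ge0 // mulr_ge0. Qed.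

Lemma nu_ge1 n : 1 <= nu n.
Proof.
rewrite -sqrtr1 ler_sqrt ?addr_ge0 ?mulr_ge0 //.
have : 0 <= n%:R :> R by rewrite ler0n.
lra.
Qed.

Lemma sqn_nu n : 2 * sqn n <= nu n.
Proof.
rewrite -(@ler_pXn2r _ 2) ?nnegrE ?mulr_ge0 ?sqrtr_ge0 // nu_sqr exprMn.
by rewrite [sqn n ^+ 2]expr2 sqn_sqr; lra.
Qed.

Lemma norm_le_sqr (x e : R) : x ^+ 2 <= e -> `|x| <= 1 + e.
Proof.
rewrite -(real_normK (num_real x)); have := normr_ge0 x.
by have := sqr_ge0 (`|x| - 1); lra.
Qed.

(* Over a distance [4 / nu n], [dq n] is a solution of [y'' + nu n ^+ 2 * y = 0]
   up to lower order terms, and its derivative at [T'] is negligible. *)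
Lemma oscillator_transport n (T' T D : R) : 0 < T' -> T' <= T ->
  nu n * (T - T') <= 4 -> T ^+ 2 + 1 + T'^-1 <= D ->
  (nu n * (dq n T - dq n T' * cos (nu n * (T - T')))) ^+ 2 <=
  expR 4 * (dq1 n T' ^+ 2 + D ^+ 2).
Proof.
move=> T0 TT nT hD; set s := nu n; set q := dq n T'.
have s1 : 1 <= s by exact: nu_ge1.
have s0 : 0 < s by apply: lt_le_trans s1.
have T'V : 0 < T'^-1 by rewrite invr_gt0.
have D0 : 0 <= D by apply: le_trans hD; rewrite !addr_ge0 ?sqr_ge0 // ltW.
pose e (x : R) : R := dq n x - q * cos (s * (x - T')).
pose e1 (x : R) : R := dq1 n x + q * s * sin (s * (x - T')).
pose F (x : R) : R := x ^+ 2 * dq n x - dq1 n x / x.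
pose En x := e1 x ^+ 2 + s ^+ 2 * e x ^+ 2.
pose dEn x := 2 * e1 x * F x.
(* A growth rate as large as [s] is affordable, because the distance covered is at most [4 / s]; it
   absorbs a forcing of size [D * s], coming from [dq1 n x / x]. *)
pose G x := expR (- (s * (x - T'))) * (En x + D ^+ 2).
pose dG x := expR (- (s * (x - T'))) * (dEn x - s * (En x + D ^+ 2)).
have dG_ok x : T' <= x -> is_derive x (1 : R) G (dG x).
  move=> Tx; have x0 : x != 0 by rewrite gt_eqF // (lt_le_trans T0).
  have h1 := is_derive_dq n x0; have h2 := is_derive_dq1 n x0.
  have hl : is_derive x (1 : R) (fun y => s * (y - T')) s.
    by eapply isdE; [isd|rewrite /=; ring].
  have hc := @isd_comp R cos (fun y => s * (y - T')) x _ _ (is_derive_cos _) hl.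
  have hs := @isd_comp R sin (fun y => s * (y - T')) x _ _ (is_derive_sin _) hl.
  have he := @isd_comp R expR (fun y => - (s * (y - T'))) x _ _ (is_derive_expR _) (isdN hl).
  rewrite /G /En /e /e1; eapply isdE; first by isd.
  rewrite /= /dG /dEn /En /F /e /e1 -(nu_sqr n) -/s; ring.
have F_le x : T' <= x -> x <= T -> `|F x| <= D * s.
  move=> Tx xT; have x0 : 0 < x by apply: lt_le_trans Tx.
  apply: (@le_trans _ _ (T ^+ 2 * s + (s + T'^-1 * s))).
    apply: (le_trans (ler_normB _ _)); apply: lerD.
      rewrite normrM ger0_norm ?sqr_ge0 //; apply: ler_pM => //.
      - exact: sqr_ge0.
      - by rewrite lerXn2r ?nnegrE // ltW // (lt_le_trans x0).
      - by apply: le_trans s1; exact: normr_displ_le1.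
    rewrite normrM normfV (gtr0_norm x0) ler_pdivrMr //.
    apply: (le_trans (normr_dq1 n (ltW x0))).
    have h1 := sqn_nu n; rewrite -/s in h1.
    have h2 : s <= T'^-1 * s * x.
      rewrite mulrAC ler_peMl ?(ltW s0) // mulrC ler_pdivlMr // mul1r //.
    have h3 := ler_wpM2r (ltW x0) s1.
    rewrite mulrDl; lra.
  have := ler_wpM2r (ltW s0) hD; lra.
have : G T <= G T'.
  apply: (@is_derive_nincr R G dG T' T TT).
  - by move=> x /andP[Tx _]; exact: dG_ok.
  - move=> x /andP[Tx xT]; rewrite /dG pmulr_rle0 ?expR_gt0 // subr_le0.
    have F1 := F_le x Tx xT.
    have F2 : F x ^+ 2 <= (D * s) ^+ 2.
      rewrite -(real_normK (num_real (F x))) lerXn2r ?nnegrE //.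
      by rewrite mulr_ge0 // ltW.
    have p1 := sqr_ge0 (s * e1 x - F x).
    have p2 := mulr_ge0 (sqr_ge0 s) (mulr_ge0 (sqr_ge0 s) (sqr_ge0 (e x))).
    rewrite /dEn -(ler_pM2l s0) /En.
    have -> : s * (s * (e1 x ^+ 2 + s ^+ 2 * e x ^+ 2 + D ^+ 2)) =
      s ^+ 2 * e1 x ^+ 2 + s ^+ 2 * (s ^+ 2 * e x ^+ 2) + (D * s) ^+ 2 by ring.
    have : (s * e1 x - F x) ^+ 2 = s ^+ 2 * e1 x ^+ 2 - s * (2 * e1 x * F x) + F x ^+ 2.
      by ring.
    lra.
rewrite /G subrr mulr0 oppr0 expR0 mul1r => hG.
have EnT' : En T' = dq1 n T' ^+ 2.
  by rewrite /En /e /e1 subrr mulr0 cos0 sin0 mulr1 mulr0 addr0 /q subrr; ring.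
rewrite EnT' in hG.
have h1 : En T + D ^+ 2 <= expR (s * (T - T')) * (dq1 n T' ^+ 2 + D ^+ 2).
  by rewrite -ler_pdivrMl ?expR_gt0 // -expRN.
have h2 : expR (s * (T - T')) * (dq1 n T' ^+ 2 + D ^+ 2) <=
    expR 4 * (dq1 n T' ^+ 2 + D ^+ 2).
  by rewrite ler_wpM2r ?addr_ge0 ?sqr_ge0 // ler_expR.
have h3 : (s * (dq n T - q * cos (s * (T - T')))) ^+ 2 <= En T + D ^+ 2.
  rewrite exprMn -/(e T) /En; have := sqr_ge0 (e1 T); have := sqr_ge0 D; lra.
by apply: (le_trans h3); exact: le_trans h2.
Qed.

Lemma cosBpiM (x : R) k : cos (x - k%:R * pi) = (-1) ^+ k * cos x.
Proof.
elim: k => [|k IH]; first by rewrite mul0r subr0 mul1r.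
have := cosDpi (x - k.+1%:R * pi).
have -> : x - k.+1%:R * pi + pi = x - k%:R * pi by rewrite -natr1; ring.
rewrite IH exprS => e.
by rewrite mulN1r mulNr e opprK.
Qed.

(** Here [k] counts the half turns of the phase completed at [t], and the Legendre degree is
    [2 * k]. Since the odd polynomial below it vanishes at 0, the derivative at the junction is
    bounded, negligible against [nu n]. *)
Lemma dq_wallis t : 0 < t -> exists C : R, forall n, 8 <= nu n * t ->
  exists k : nat, [/\ k%:R * pi <= nu n * t - pi / 4,
    nu n * t - pi / 4 <= (k%:R + 1) * pi &
    `|dq n t - Num.sqrt (2 / pi) * wallis k * cos (nu n * t - pi / 4)| <= C / nu n].
Proof.
move=> t0; have p0 := @pi_gt0 R; have p1 := @pihalf_ge1 R; have p2 := @pihalf_lt2 R.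
pose E1 : R := expR 4 * (1 + (4 * t ^+ 4 + 1) ^+ 2).
have E10 : 0 <= E1 by rewrite mulr_ge0 ?expR_ge0 // addr_ge0 ?sqr_ge0.
pose E2 : R := ((2 + E1) * 4 / t) ^+ 2.
pose D : R := t ^+ 2 + 1 + 2 / t.
pose E3 : R := expR 4 * (E2 + D ^+ 2).
exists (1 + E3 + (1 + E1) * 4 / t) => n.
set s := nu n => st.
have s1 : 1 <= s by exact: nu_ge1.
have s0 : 0 < s by apply: lt_le_trans s1.
pose K := Num.truncn ((s * t - pi / 4) / pi).
have x0 : 0 <= (s * t - pi / 4) / pi by rewrite divr_ge0 //; lra.
have /andP[K1 K2] := truncn_itv x0; rewrite -/K in K1 K2.
rewrite ler_pdivlMr // in K1; rewrite ltr_pdivrMr // -[K.+1%:R]natr1 in K2.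
exists K; split => //; first exact: ltW.
have K0 : (0 < K)%N.
  rewrite lt0n; apply/eqP => K0; rewrite K0 add0r mul1r in K2; lra.
case: K K0 K1 K2 => [//|k] _ K1 K2.
pose N' := k.*2.+1.
have NE : N'.+1%:R = 2 * k.+1%:R :> R.
  by rewrite /N' -doubleS -muln2 natrM mulrC.
pose M : R := N'.+1%:R + 1 / 2.
have M0 : 0 < M by rewrite /M ltr_wpDl.
(* This puts th = pi/2 at [T'] with [s * T' = k.+1%:R * pi + pi / 4], an extremum of the expected
   cosine. The phase shift pi/4 stems from the summand 1/2 in [M]. *)
pose b := M / s.
have b0 : 0 < b by rewrite divr_gt0.
have Mb : (4 * n%:R + 2) * b ^+ 2 = M ^+ 2.
  by rewrite -(nu_sqr n) -/s /b; field; rewrite gt_eqF.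
have sT : s * (b * (pi / 2)) = k.+1%:R * pi + pi / 4.
  have aux (p kk : R) : s * ((2 * kk + 1 / 2) / s * (p / 2)) = kk * p + p / 4.
    by field; rewrite gt_eqF.
  by rewrite /b /M NE aux.
have := hilb_energy b0 Mb.
have [lpN _] := @lp_at0 R k.+1; have [_ lpN'] := @lp_at0 R k.
have -> : lp N' 0 = 0 :> R by [].
have -> : lp N'.+1 0 = (-1) ^+ k.+1 * wallis k.+1 :> R by rewrite -lpN.
rewrite mulr0 oppr0 sub0r.
set w := wallis k.+1; set T' := b * (pi / 2) in sT *.
set r := Num.sqrt (2 / pi) => hE.
have T'0 : 0 < T' by rewrite mulr_gt0 // divr_gt0.
have T't : T' <= t by rewrite -(ler_pM2l s0) sT; lra.
have T'2 : t / 2 <= T'.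
  rewrite -(ler_pM2l s0) sT -[k.+1%:R]natr1; rewrite -[k.+1%:R]natr1 in K2.
  have : 0 <= k%:R * pi :> R by rewrite mulr_ge0 // ltW.
  lra.
have bt : b <= t.
  apply: le_trans T't; rewrite /T' -[leLHS]mulr1 ler_wpM2l //; exact: ltW.
have bt4 : t / 4 <= b.
  have : T' <= b * 2 by rewrite ler_wpM2l // ltW.
  lra.
have b4 : b ^+ 4 <= t ^+ 4 by rewrite lerXn2r ?nnegrE // ltW.
have b40 : 0 <= b ^+ 4 by rewrite exprn_ge0 // ltW.
have hE1 : expR 4 * (1 + (4 * b ^+ 4 + 1) ^+ 2) <= E1.
  by rewrite ler_wpM2l ?expR_ge0 // lerD2l lerXn2r ?nnegrE //; move: b4 b40; clear; lra.
set A := _ * (- _) in hE.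
have M2 : 0 <= M ^+ 2 * (dq n T' - r * ((-1) ^+ k.+1 * w)) ^+ 2.
  by rewrite mulr_ge0 ?sqr_ge0.
have hq1 : `|b * dq1 n T' - A| <= 1 + E1.
  by apply: norm_le_sqr; rewrite -/M in hE; move: hE hE1 M2; clear; lra.
have hq : `|M * (dq n T' - r * ((-1) ^+ k.+1 * w))| <= 1 + E1.
  apply: norm_le_sqr; rewrite exprMn; rewrite -/M in hE.
  by have := sqr_ge0 (b * dq1 n T' - A); move: hE hE1; clear; lra.
have r1 : `|r| <= 1.
  rewrite ger0_norm ?sqrtr_ge0 // -sqrtr1 ler_sqrt // ler_pdivrMr // mul1r; move: p1; clear; lra.
have w0 : 0 <= w by rewrite ltW // wallis_gt0.
have w1 : w <= 1 by exact: wallis_le1.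
have nw : `|(-1) ^+ k.+1 * w| <= 1 by rewrite normrM normrX normrN1 expr1n mul1r ger0_norm.
have A1 : `|A| <= 1.
  rewrite /A normrM -[leRHS]mulr1; apply: ler_pM => //.
  rewrite normrN normrM -[leRHS]mulr1; apply: ler_pM => //.
  by rewrite normfV (gtr0_norm p0) invf_le1 //; move: p1; clear; lra.
have hq1' : `|dq1 n T'| <= (2 + E1) * 4 / t.
  rewrite ler_pdivlMr //.
  have : `|b * dq1 n T'| <= 2 + E1.
    by have := ler_normD (b * dq1 n T' - A) A; rewrite subrK; move: hq1 A1; clear; lra.
  rewrite normrM (gtr0_norm b0).
  by have := ler_wpM2l (normr_ge0 (dq1 n T')) bt4; clear; lra.
have hq2 : dq1 n T' ^+ 2 <= E2.
  rewrite -(real_normK (num_real (dq1 n T'))) /E2 lerXn2r ?nnegrE //.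
  by apply: le_trans hq1'.
have sTT : s * (t - T') <= 4 by rewrite mulrBr sT; move: K2 p2; clear; lra.
have hD : t ^+ 2 + 1 + T'^-1 <= D.
  rewrite /D lerD2l (_ : 2 / t = (t / 2)^-1) ?invf_div //.
  by rewrite -invf_div lef_pV2 ?posrE // divr_gt0.
have := oscillator_transport T'0 T't sTT hD; rewrite -/s => ht.
have {ht} : `|s * (dq n t - dq n T' * cos (s * (t - T')))| <= 1 + E3.
  apply: norm_le_sqr; apply: (le_trans ht).
  by rewrite ler_wpM2l ?expR_ge0 // lerD2r.
have -> : s * (t - T') = s * t - pi / 4 - k.+1%:R * pi by rewrite mulrBr sT; ring.
rewrite cosBpiM; set x := s * t - pi / 4; set ct := cos x => ht.
have c1 : `|(-1) ^+ k.+1 * ct| <= 1.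
  by rewrite normrM normrX normrN1 expr1n mul1r cos_max.
have -> : dq n t - r * w * ct = (dq n t - dq n T' * ((-1) ^+ k.+1 * ct))
   + (dq n T' - r * ((-1) ^+ k.+1 * w)) * ((-1) ^+ k.+1 * ct).
  have e : ((-1) ^+ k.+1 * (-1) ^+ k.+1 : R) = 1 by rewrite -expr2 sqrr_sign.
  by ring: e.
apply: (le_trans (ler_normD _ _)); rewrite ler_pdivlMr // mulrDl.
apply: lerD; first by rewrite normrM (gtr0_norm s0) mulrC in ht.
rewrite normrM.
have h1 : `|dq n T' - r * ((-1) ^+ k.+1 * w)| * `|(-1) ^+ k.+1 * ct| <=
    `|dq n T' - r * ((-1) ^+ k.+1 * w)| by rewrite ler_piMr.
have h2 : `|dq n T' - r * ((-1) ^+ k.+1 * w)| * s * t <= (1 + E1) * 4.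
  rewrite normrM (gtr0_norm M0) in hq.
  have e : M = b * s by rewrite /b divfK // gt_eqF.
  rewrite e in hq.
  have h3 := ler_wpM2l (mulr_ge0 (normr_ge0 (dq n T' - r * ((-1) ^+ k.+1 * w))) (ltW s0)) bt4.
  by move: hq h3; clear; lra.
rewrite ler_pdivlMr //.
by move: (ler_wpM2r (mulr_ge0 (ltW s0) (ltW t0)) h1) h2; clear; lra.
Qed.

End diagonal_asymptotics.

(** * Amplitude and phase of the rescaled shifts *)

Section delta_asymptotics.
Context {R : realType}.
Implicit Types (t : R) (n k : nat).

(** The squared Wallis ratio is close to 1/(pi k), and pi k is close to nu_n t, hence to 2 t
    n^(1/2); the powers of [n] cancel. *)
Lemma wallis_amplitude t n k (w := wallis k : R) : 0 < t -> 8 <= nu n * t ->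
  k%:R * pi <= nu n * t - pi / 4 -> nu n * t - pi / 4 <= (k%:R + 1) * pi ->
  `|Num.sqrt (Num.sqrt n%:R) * (Num.sqrt (2 / pi) * w) - (Num.sqrt (pi * t))^-1| <=
  (15 + 2 * t) / (t * Num.sqrt (pi * t)) / nu n.
Proof.
move=> t0 st hk1 hk2; have p0 := @pi_gt0 R; have p1 := @pihalf_ge1 R.
have p2 := @pihalf_lt2 R.
set s := nu n in st hk1 hk2 *; set A := _ * (_ * _).
have s1 : 1 <= s by exact: nu_ge1.
have s0 : 0 < s by apply: lt_le_trans s1.
have w0 : 0 < w by exact: wallis_gt0.
have q2 := @sqn_nu R n; rewrite -/s in q2.
have q0 : 0 <= sqn n :> R by exact: sqn_ge0.
have q3 : s - 2 <= 2 * sqn n.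
  have [h|h] := leP (s - 2) 0; first by apply: (le_trans h); rewrite mulr_ge0.
  rewrite -(@ler_pXn2r _ 2) ?nnegrE ?mulr_ge0 ?(ltW h) // exprMn.
  rewrite [sqn n ^+ 2]expr2 sqn_sqr.
  have := @nu_sqr R n; rewrite -/s; lra.
have [hW1 hW2] := @wallis_bounds R k; rewrite -/w in hW1 hW2.
have pt0 : 0 < pi * t by rewrite mulr_gt0.
have A0 : 0 <= A by rewrite !mulr_ge0 ?sqrtr_ge0 // ltW.
(* Squaring removes the roots: it remains to see that [a] is close to 1, and the factor [A * L + 1],
   at least 1, brings this back to [A]. *)
pose a := A ^+ 2 * (pi * t).
have aE : a = 2 * sqn n * w ^+ 2 * t.
  have e : 0 <= 2 / pi :> R by rewrite divr_ge0 // ltW.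
  rewrite /a /A !exprMn (sqr_sqrtr (sqrtr_ge0 _)) (sqr_sqrtr e) -/(sqn n).
  move: (pi : R) p0 => p p0; field; exact: lt0r_neq0.
have a0 : 0 <= a by rewrite /a mulr_ge0 ?sqr_ge0 // ltW.
have up : a * (s * t - 5) <= s * t.
  apply: (@le_trans _ _ (a * (k%:R * pi))); first by rewrite ler_wpM2l //; lra.
  have -> : a * (k%:R * pi) = 2 * sqn n * t * (pi * k%:R * w ^+ 2) by rewrite aE; ring.
  apply: (@le_trans _ _ (2 * sqn n * t * 1)); first by rewrite ler_wpM2l // !mulr_ge0 // ltW.
  by rewrite mulr1 ler_wpM2r // ltW.
have a3 : a <= 3.
  rewrite leNgt; apply/negP => a3.
  have : 3 * (s * t - 5) <= a * (s * t - 5) by rewrite ler_wpM2r ?ltW //; lra.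
  lra.
have lo : s * t - 2 * t <= a * (s * t + 1).
  have h : 2 * (s - 2) * t <= a * (pi * (2 * k%:R + 1)).
    have -> : a * (pi * (2 * k%:R + 1)) = 2 * sqn n * t * (pi * (2 * k%:R + 1) * w ^+ 2).
      by rewrite aE; ring.
    apply: (@le_trans _ _ (2 * sqn n * t * 2)); last by rewrite ler_wpM2l // !mulr_ge0 // ltW.
    have := ler_wpM2r (ltW t0) q3; lra.
  have h2 : a * (pi * (2 * k%:R + 1)) <= a * (2 * (s * t + 1)).
    by rewrite ler_wpM2l //; lra.
  lra.
have ha : `|a - 1| <= (15 + 2 * t) / (s * t).
  have st0 : 0 < s * t by rewrite mulr_gt0.
  rewrite ler_pdivlMr // -[X in _ * X](gtr0_norm st0) -normrM ler_norml.
  by apply/andP; split; lra.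
have sp0 : 0 < Num.sqrt (pi * t) by rewrite sqrtr_gt0.
set L := Num.sqrt (pi * t) in sp0 *.
have LL : L ^+ 2 = pi * t by rewrite sqr_sqrtr // ltW.
have e : (A - L^-1) * (A * L + 1) = (a - 1) / L.
  by rewrite /a -LL; field; exact: lt0r_neq0.
have AL0 : 0 <= A * L by rewrite mulr_ge0 // ltW.
have h1 : `|A - L^-1| <= `|a - 1| / L.
  rewrite -[X in _ / X](gtr0_norm sp0) -normf_div -e normrM ler_peMr //.
  by rewrite ger0_norm; lra.
apply: (le_trans h1).
have -> : (15 + 2 * t) / (t * L) / s = (15 + 2 * t) / (s * t) / L.
  by field; rewrite !gt_eqF.
by rewrite ler_wpM2r // invr_ge0 ltW.
Qed.

Lemma dq_asymptotics t : 0 < t ->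
  (fun n => root16 n ^+ 4 * dq n t - (Num.sqrt (pi * t))^-1 * cos (nu n * t - pi / 4))
  @ \oo --> (0 : R).
Proof.
move=> t0; have [C HC] := dq_wallis t0.
set L := (Num.sqrt (pi * t))^-1.
pose C4 := (15 + 2 * t) / (t * Num.sqrt (pi * t)).
have sp0 : 0 < Num.sqrt (pi * t) by rewrite sqrtr_gt0 mulr_gt0 // pi_gt0.
have C40 : 0 <= C4 by rewrite divr_ge0 ?mulr_ge0 ?addr_ge0 ?mulr_ge0 // ltW.
apply/cvgr0Pnorm_le => eps eps0.
near=> n.
have C6 : 8 / t <= root16 n by near: n; exact: root16_large.
have C7 : 1 <= root16 n :> R by near: n; exact: root16_large.
have C8 : (`|C| + C4) / eps <= root16 n by near: n; exact: root16_large.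
have r4 := @root16_X4 R n; have r8 := @root16_X8 R n.
move: C6 C7 C8 r4 r8; set r := root16 n => C6 C7 C8 r4 r8.
have r0 : 0 < r by apply: lt_le_trans C7.
have rn : 2 * r ^+ 8 <= nu n by rewrite r8; exact: sqn_nu.
have r8r : r <= r ^+ 8 by rewrite -{1}(expr1 r); apply: ler_weXn2l.
have rr4 : r * r ^+ 4 <= r ^+ 8.
  by rewrite -exprS; apply: ler_weXn2l.
have n0 : 0 < nu n :> R by apply: lt_le_trans (nu_ge1 n).
have st : 8 <= nu n * t by rewrite -ler_pdivrMr //; lra.
have [k [hk1 hk2 hk3]] := HC n st.
have hA := wallis_amplitude t0 st hk1 hk2.
rewrite -/L -/C4 -r4 in hA.
set w := Num.sqrt (2 / pi) * wallis k in hk3 hA *.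
set ct := cos _ in hk3 *.
have -> : r ^+ 4 * dq n t - L * ct = r ^+ 4 * (dq n t - w * ct) + (r ^+ 4 * w - L) * ct.
  by ring.
apply: (le_trans (ler_normD _ _)).
apply: (@le_trans _ _ (`|C| / r + C4 / r)); last first.
  by rewrite -mulrDl ler_pdivrMr // mulrC -ler_pdivrMr.
apply: lerD.
  rewrite normrM (ger0_norm (exprn_ge0 4 (ltW r0))) ler_pdivlMr //.
  apply: (@le_trans _ _ (r ^+ 4 * (`|C| / nu n) * r)).
    rewrite ler_pM2r // ler_wpM2l ?exprn_ge0 ?(ltW r0) //; apply: (le_trans hk3).
    by rewrite ler_pM2r ?invr_gt0 // ler_norm.
  rewrite (_ : r ^+ 4 * (`|C| / nu n) * r = `|C| * (r * r ^+ 4) / nu n); last by ring.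
  rewrite ler_pdivrMr // ler_wpM2l //; have := exprn_gt0 8 r0; lra.
rewrite normrM; apply: (@le_trans _ _ (`|r ^+ 4 * w - L|)).
  by rewrite ler_piMr // cos_max.
apply: (le_trans hA); rewrite ler_wpM2l // lef_pV2 ?posrE //.
have := exprn_gt0 8 r0; lra.
Unshelve. all: by end_near. Qed.

Lemma eigenvalue_oscillation (s : bool) (Delta g : R) (m : int) (E : int -> R)
  (eps := if s then 1 else -1 : R) (A := Delta / Num.sqrt (2 * pi * g)) :
  0 < Delta -> 0 < g ->
  (forall x : R, rabi_eigenvalue s Delta g x <-> exists n : int, (m <= n)%R /\ E n = x) ->
  (fun n : nat => E n%:Z - (n%:R - g ^+ 2)) @ \oo --> (0 : R) ->
  (fun n : nat => rabi_delta g E n / A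
     - eps * (-1) ^+ n * cos (nu n * (2 * g) - pi / 4)) @ \oo --> (0 : R).
Proof.
move=> D0 g0 spec E0.
have t0 : 0 < 2 * g by rewrite mulr_gt0.
have h1 := eigenvalue_first_order D0 g0 spec E0.
have h2 := dq_asymptotics t0.
have p0 := @pi_gt0 R.
have sE : Num.sqrt (pi * (2 * g)) = Num.sqrt (2 * pi * g) by congr Num.sqrt; ring.
have s0 : 0 < Num.sqrt (2 * pi * g) by rewrite sqrtr_gt0 !mulr_gt0.
have A0 : 0 < A by rewrite divr_gt0.
pose sg n : R := eps * (-1) ^+ n.
have sg1 n : `|sg n| = 1.
  by rewrite normrM normrX normrN1 expr1n mulr1 /eps; case: (s); rewrite ?normrN normr1.
have h3 : (fun n => sg n * Delta * (root16 n ^+ 4 * dq n (2 * g) -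
   (Num.sqrt (pi * (2 * g)))^-1 * cos (nu n * (2 * g) - pi / 4))) @ \oo --> (0 : R).
  apply/cvgr0Pnorm_le => e e0.
  have eD : 0 < e / Delta by rewrite divr_gt0.
  move/cvgr0Pnorm_le: h2 => /(_ _ eD); apply: filterS => n.
  by rewrite normrM [`|sg n * Delta|]normrM sg1 mul1r (gtr0_norm D0) ler_pdivlMr // mulrC.
have h4 := @cvgMr_tmp _ _ _ _ _ _ A^-1 (cvgD h1 h3).
rewrite addr0 mul0r in h4.
rewrite (_ : (fun n => _) = (fun n => (root16 n ^+ 4 * (E n%:Z - (n%:R - g ^+ 2)
     - eps * Delta * parity_mx (2 * g) n n) + sg n * Delta * (root16 n ^+ 4 * dq n (2 * g) -
   (Num.sqrt (pi * (2 * g)))^-1 * cos (nu n * (2 * g) - pi / 4))) / A)).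
  exact: h4.
apply/funext => n; rewrite /rabi_delta /parity_mx -/(dq n (2 * g)).
have -> : (n%:R : R) `^ (4%:R^-1) = root16 n ^+ 4.
  rewrite root16_X4 -!powR12_sqrt ?powR_ge0 // -powRrM.
  by congr (_ `^ _); rewrite -invfM -natrM.
rewrite sE /sg /A; set S := Num.sqrt _ in s0 *.
by field; rewrite !gt_eqF.
Qed.

End delta_asymptotics.

(** * Counting phases *)

Lemma leq_b1_imp (b1 b2 : bool) : (b1 -> b2) -> (b1 <= b2)%N.
Proof. by case: b1; case: b2 => // /(_ isT). Qed.

Section equidistribution.
Context {R : realType}.
Implicit Types (t th al be : R) (n k N : nat).

Lemma cosB2pi th k : cos (th - k%:R * (2 * pi)) = cos th.
Proof.
have -> : k%:R * (2 * pi) = (k * 2)%:R * pi :> R by rewrite natrM; ring.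
by rewrite cosBpiM exprM sqrr_sign mul1r.
Qed.

Lemma cos_arc th al be : - pi <= th -> 0 <= al -> al <= be -> be <= pi ->
  cos be <= cos th -> cos th <= cos al ->
  exists k : nat, al <= `|th - k%:R * (2 * pi)| <= be.
Proof.
move=> th0 al0 ab bp h1 h2; have p0 := @pi_gt0 R.
(* The multiple of 2 pi nearest to [th]; it is a natural number because [th >= - pi]. On the
   remaining half turn [cos] is injective. *)
pose k := Num.truncn ((th + pi) / (2 * pi)); exists k.
have x0 : 0 <= (th + pi) / (2 * pi) by apply: divr_ge0; [lra|rewrite mulr_ge0 // ltW].
have /andP[k1 k2] := truncn_itv x0; rewrite -/k in k1 k2.
have pp : 0 < 2 * pi :> R by rewrite mulr_gt0.
rewrite ler_pdivlMr // in k1; rewrite ltr_pdivrMr // -[k.+1%:R]natr1 in k2.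
set d := th - _; have dp : `|d| <= pi by rewrite ler_norml; apply/andP; split; rewrite /d; lra.
have cd : cos `|d| = cos th by rewrite cos_norm /d cosB2pi.
rewrite -cd in h1 h2.
have dI : `|d| \in `[0, pi] by rewrite in_itv /= normr_ge0.
have aI : al \in `[0, pi] by rewrite in_itv /= al0 (le_trans ab).
have bI : be \in `[0, pi] by rewrite in_itv /= bp (le_trans al0).
rewrite leNgt ltr_cos // -leNgt in h1; rewrite leNgt ltr_cos // -leNgt in h2.
by rewrite h1 h2.
Qed.

(** The radicand is [4 * n%:R + 2] along a parity class: [c = 2] for n = 2j and [c = 6] for n = 2j +
    1. Squaring turns the condition into one on an interval of [j]; the maxima with 0 allow negative
    end points. *)
Lemma count_sqrt t (X Y c : R) N : 0 < t -> X <= Y -> 0 <= c ->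
  \sum_(0 <= j < N) ((X <= Num.sqrt (8 * j%:R + c) * t) &&
                     (Num.sqrt (8 * j%:R + c) * t <= Y))%:R <=
  (Num.max 0 Y ^+ 2 - Num.max 0 X ^+ 2) / (8 * t ^+ 2) + 1 :> R.
Proof.
move=> t0 XY c0; set Y' := Num.max 0 Y; set X' := Num.max 0 X.
have X'0 : 0 <= X' by rewrite le_max lexx.
have Y'0 : 0 <= Y' by rewrite le_max lexx.
have XY' : X' <= Y' by rewrite ge_max Y'0 /= le_max XY orbT.
have t20 : 0 < t ^+ 2 by rewrite exprn_gt0.
have tn0 := lt0r_neq0 t0.
pose A := (X' ^+ 2 / t ^+ 2 - c) / 8; pose B := (Y' ^+ 2 / t ^+ 2 - c) / 8.
have -> : (Y' ^+ 2 - X' ^+ 2) / (8 * t ^+ 2) = B - A by rewrite /A /B; field.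
have AB : A <= B.
  rewrite ler_pM2r ?invr_gt0 // lerD2r ler_pM2r ?invr_gt0 //.
  by rewrite lerXn2r ?nnegrE.
apply: le_trans (count_itv N AB).
apply: ler_sum => j _; rewrite ler_nat; apply: leq_b1_imp.
move=> /andP[h1 h2].
have r0 : 0 <= 8 * j%:R + c by rewrite addr_ge0 ?mulr_ge0.
have e : (Num.sqrt (8 * j%:R + c) * t) ^+ 2 = (8 * j%:R + c) * t ^+ 2.
  by rewrite exprMn sqr_sqrtr.
have z0 : 0 <= Num.sqrt (8 * j%:R + c) * t by rewrite mulr_ge0 ?sqrtr_ge0 // ltW.
have h1' : X' <= Num.sqrt (8 * j%:R + c) * t by rewrite ge_max z0.
have h2' : Num.sqrt (8 * j%:R + c) * t <= Y' by rewrite le_max h2 orbT.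
have g1 : X' ^+ 2 / t ^+ 2 <= 8 * j%:R + c.
  by rewrite ler_pdivrMr // -e lerXn2r ?nnegrE.
have g2 : 8 * j%:R + c <= Y' ^+ 2 / t ^+ 2.
  by rewrite ler_pdivlMr // -e lerXn2r ?nnegrE.
by apply/andP; split; rewrite /A /B; lra.
Qed.

Lemma count_arc t (u v c : R) k N : 0 < t -> - pi <= u -> u <= v -> v <= pi -> 0 <= c ->
  \sum_(0 <= j < N) ((k%:R * (2 * pi) + u <= Num.sqrt (8 * j%:R + c) * t - pi / 4) &&
     (Num.sqrt (8 * j%:R + c) * t - pi / 4 <= k%:R * (2 * pi) + v))%:R <=
  (v - u) * (4 * pi * k%:R + 3 * pi) / (8 * t ^+ 2) + 1 :> R.
Proof.
move=> t0 u0 uv v0 c0; have p0 := @pi_gt0 R.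
have kp : 0 <= k%:R * pi :> R by rewrite mulr_ge0 // ltW.
pose X := k%:R * (2 * pi) + u + pi / 4; pose Y := k%:R * (2 * pi) + v + pi / 4.
have XY : X <= Y by rewrite /X /Y; lra.
apply: (@le_trans _ _ ((Num.max 0 Y ^+ 2 - Num.max 0 X ^+ 2) / (8 * t ^+ 2) + 1)).
  apply: le_trans (count_sqrt N t0 XY c0).
  apply: ler_sum => j _; rewrite ler_nat; apply: leq_b1_imp => /andP[h1 h2].
  by apply/andP; split; rewrite /X /Y; lra.
rewrite lerD2r ler_pM2r ?invr_gt0 ?mulr_gt0 ?exprn_gt0 //.
have vu : 0 <= v - u by lra.
have S0 : 0 <= 4 * pi * k%:R + 3 * pi :> R by lra.
have [Y0|Y0] := leP Y 0.
  have X0 : X <= 0 by apply: le_trans Y0.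
  by rewrite (max_idPl X0) subrr mulr_ge0.
have [X0|X0] := leP X 0.
  rewrite expr0n subr0 expr2; apply: ler_pM; rewrite ?(ltW Y0) //.
    by rewrite /X /Y in X0 *; lra.
  by rewrite /Y; lra.
have -> : Y ^+ 2 - X ^+ 2 = (v - u) * (Y + X) by rewrite /X /Y; ring.
by apply: ler_wpM2l => //; rewrite /X /Y; lra.
Qed.

Lemma sum_even_odd (f : nat -> R) N :
  \sum_(0 <= n < N.*2) f n = \sum_(0 <= j < N) (f j.*2 + f j.*2.+1).
Proof.
elim: N => [|N IH]; first by rewrite !big_nil.
by rewrite doubleS !big_nat_recr //= IH addrA.
Qed.

Lemma sum_affine (a b : R) K : \sum_(0 <= k < K.+1) (a * k%:R + b) =
  a * (K%:R * (K%:R + 1) / 2) + b * (K%:R + 1).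
Proof.
elim: K => [|K IH]; first by rewrite big_nat_recr //= big_nil; ring.
by rewrite big_nat_recr //= IH -natr1; field.
Qed.

Lemma sum_sym_arc t (al be c : R) k N : 0 < t -> 0 <= al -> al <= be -> be <= pi -> 0 <= c ->
  \sum_(0 <= j < N)
     ((al <= `|Num.sqrt (8 * j%:R + c) * t - pi / 4 - k%:R * (2 * pi)| <= be)%R : bool)%:R <=
  (be - al) * (4 * pi * k%:R + 3 * pi) / (4 * t ^+ 2) + 2 :> R.
Proof.
move=> t0 al0 ab bp c0; have p0 := @pi_gt0 R; have tn0 := lt0r_neq0 t0.
have h1 := @count_arc t al be c k N t0 (le_trans _ al0) ab bp c0.
have h2 := @count_arc t (- be) (- al) c k N t0 _ _ _ c0.
set th := fun j : nat => Num.sqrt (8 * j%:R + c) * t - pi / 4.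
apply: (@le_trans _ _ (\sum_(0 <= j < N)
   (((k%:R * (2 * pi) + al <= th j) && (th j <= k%:R * (2 * pi) + be))%:R +
    ((k%:R * (2 * pi) - be <= th j) && (th j <= k%:R * (2 * pi) - al))%:R))).
  apply: ler_sum => j _; rewrite -/(th j) -natrD ler_nat.
  have [|_] := boolP (al <= _ <= be); last by [].
  move=> /andP[g1 g2].
  have [d0|d0] := leP 0 (th j - k%:R * (2 * pi)).
    rewrite ger0_norm // in g1 g2.
    have -> : (k%:R * (2 * pi) + al <= th j) && (th j <= k%:R * (2 * pi) + be).
      by apply/andP; split; lra.
    by rewrite leq_addr.
  rewrite ltr0_norm // in g1 g2.
  have -> : (k%:R * (2 * pi) - be <= th j) && (th j <= k%:R * (2 * pi) - al).
    by apply/andP; split; lra.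
  by rewrite leq_addl.
rewrite big_split /=.
have {}h1 := h1 ltac:(lra); have {}h2 := h2 ltac:(lra) ltac:(lra) ltac:(lra).
have e : - al - - be = be - al by ring.
rewrite e in h2.
apply: (le_trans (lerD h1 h2)).
by rewrite le_eqVlt; apply/orP; left; apply/eqP; field.
Qed.

Variables (t eps : R).
Hypotheses (t0 : 0 < t) (eps1 : `|eps| = 1).
Let th n : R := nu n * t - pi / 4.
Let x n : R := eps * (-1) ^+ n * cos (th n).

(* For [n = 2j] and [n = 2j + 1] the sign is constant and the points to be counted
   lie in arcs of the circle. *)
Lemma count_phase al be : 0 <= al -> al <= be -> be <= pi ->
  exists C : R, forall N,
    \sum_(0 <= n < N) ((cos be <= x n <= cos al)%R : bool)%:R <=
    (be - al) / pi * N%:R + C * nu N.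
Proof.
move=> al0 ab bp; have p0 := @pi_gt0 R; have p1 := @pihalf_ge1 R.
have p2 := @pihalf_lt2 R.
pose sg n : R := eps * (-1) ^+ n.
have sgE n : sg n = 1 \/ sg n = -1.
  have : `|sg n| = 1 by rewrite normrM eps1 normrX normrN1 expr1n mul1r.
  by case: ger0P => _ e; [left|right]; lra.
have sg2 j : sg j.*2 = eps by rewrite /sg -mul2n exprM sqrrN expr1n expr1n mulr1.
have sg21 j : sg j.*2.+1 = - eps by rewrite /sg exprS -mul2n exprM sqrrN !expr1n; ring.
(* For the sign -1 the cosine is reflected, and the arc from [al] to [be] becomes the arc from
   [pi - be] to [pi - al], of the same length. *)
pose A (z : R) := if z == 1 then al else pi - be.
pose B (z : R) := if z == 1 then be else pi - al.
have AB z : [/\ 0 <= A z, A z <= B z, B z <= pi & B z - A z = be - al].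
  by rewrite /A /B; case: ifP => _; split; lra.
pose W n k : R := ((A (sg n) <= `|th n - k%:R * (2 * pi)| <= B (sg n))%R : bool)%:R.
have W0 n k : 0 <= W n k by rewrite /W ler0n.
have thge n : - pi <= th n.
  have : 0 <= nu n * t by rewrite mulr_ge0 ?sqrtr_ge0 ?ltW.
  by rewrite /th; lra.
pose d := be - al; have d0 : 0 <= d by rewrite /d; lra.
have d4 : d <= 4 by rewrite /d; lra.
exists ((2 * t ^+ 2 + 8 * t + 16) / t ^+ 2 + (2 * (5 / 2 * (t + 4) + 12)) / t ^+ 2
  + 4 * (t + 5)) => N.
set nuN := nu N; have nuN1 : 1 <= nuN by exact: nu_ge1.
have nuN0 : 0 < nuN by apply: lt_le_trans nuN1.
pose K := Num.truncn ((nuN * t + pi) / (2 * pi)).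
have y0 : 0 <= (nuN * t + pi) / (2 * pi).
  apply: divr_ge0; last by rewrite mulr_ge0 // ltW.
  by rewrite addr_ge0 ?mulr_ge0 // ltW.
have pp : 0 < 2 * pi :> R by rewrite mulr_gt0.
have /andP[K1 K2] := truncn_itv y0; rewrite -/K in K1 K2.
rewrite ler_pdivlMr // in K1; rewrite ltr_pdivrMr // in K2.
(* Doubling the range makes the split by parity exact and costs nothing: the bound for each turn [k]
   does not depend on the range. Only the number of turns is tied to [N]. *)
have step1 : \sum_(0 <= n < N) ((cos be <= x n <= cos al)%R : bool)%:R <=
    \sum_(0 <= n < N.*2) \sum_(0 <= k < K.+1) W n k.
  have -> : N.*2 = (N + N)%N by rewrite addnn.
  rewrite [leRHS](@big_cat_nat _ _ _ N) ?leq_addr //=; apply: ler_wpDr.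
    by rewrite sumr_ge0 // => n _; rewrite sumr_ge0.
  apply: ler_sum_nat => n /andP[_ nN].
  have [|_] := boolP (cos be <= x n <= cos al); last by rewrite sumr_ge0.
  move=> /andP[h1 h2]; rewrite /x -/(sg n) in h1 h2.
  have [k hk] : exists k : nat, A (sg n) <= `|th n - k%:R * (2 * pi)| <= B (sg n).
    have [hA hAB hB _] := AB (sg n).
    have n1 : (-1 == 1 :> R) = false by apply/negbTE; rewrite lt_eqF //; lra.
    apply: cos_arc => //; rewrite /A /B; case: (sgE n) => e; rewrite e in h1 h2 *;
      rewrite ?eqxx ?n1 ?[pi - _]addrC ?cosDpi ?cosN //; lra.
  have kK : (k < K.+1)%N.
    rewrite -(ltr_nat R) -(ltr_pM2r pp); apply: le_lt_trans K2.
    have [_ _ hB _] := AB (sg n).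
    move: hk => /andP[_ hk2]; have := le_trans hk2 hB; rewrite ler_norml => /andP[g1 g2].
    have nn : nu n <= nuN.
      by rewrite ler_sqrt ?addr_ge0 ?mulr_ge0 // lerD2r ler_pM2l // ler_nat ltnW.
    have := ler_wpM2r (ltW t0) nn; rewrite /th in g1 g2; lra.
  rewrite (bigD1_seq k) ?iota_uniq ?mem_index_iota //=.
  by rewrite {1}/W hk; apply: ler_wpDr => //; rewrite sumr_ge0.
apply: (le_trans step1); rewrite exchange_big /=.
have step2 k : \sum_(0 <= n < N.*2) W n k <=
    d * (4 * pi * k%:R + 3 * pi) / (2 * t ^+ 2) + 4.
  rewrite sum_even_odd big_split /=.
  have hp (z c : R) : 0 <= c -> \sum_(0 <= j < N)
     ((A z <= `|Num.sqrt (8 * j%:R + c) * t - pi / 4 - k%:R * (2 * pi)| <= B z)%R : bool)%:R <=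
     d * (4 * pi * k%:R + 3 * pi) / (4 * t ^+ 2) + 2.
    move=> c0; have [a1 a2 a3 a4] := AB z.
    by rewrite /d -a4; exact: sum_sym_arc.
  have e1 : \sum_(0 <= j < N) W j.*2 k <= d * (4 * pi * k%:R + 3 * pi) / (4 * t ^+ 2) + 2.
    apply: le_trans (hp eps 2 _) => //; rewrite le_eqVlt; apply/orP; left; apply/eqP.
    apply: eq_bigr => j _; rewrite /W sg2 /th /nu.
    by have -> : 4 * j.*2%:R + 2 = 8 * j%:R + 2 :> R by rewrite -muln2 natrM; ring.
  have e2 : \sum_(0 <= j < N) W j.*2.+1 k <= d * (4 * pi * k%:R + 3 * pi) / (4 * t ^+ 2) + 2.
    apply: le_trans (hp (- eps) 6 _) => //; rewrite le_eqVlt; apply/orP; left; apply/eqP.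
    apply: eq_bigr => j _; rewrite /W sg21 /th /nu.
    have -> : 4 * j.*2.+1%:R + 2 = 8 * j%:R + 6 :> R by rewrite -[j.*2.+1%:R]natr1 -muln2 natrM; ring.
    by [].
  apply: (le_trans (lerD e1 e2)).
  by rewrite le_eqVlt; apply/orP; left; apply/eqP; field; rewrite lt0r_neq0.
apply: (le_trans (ler_sum _ (fun k _ => step2 k))).
have tn0 := lt0r_neq0 t0; have pn0 := lt0r_neq0 p0.
have t20 : 0 < t ^+ 2 by rewrite exprn_gt0.
(* [S] is the phase covered by [K] turns. As [T ^+ 2 / t ^+ 2] is 4N up to O(N^(1/2)), the quadratic
   term of the sum over turns yields [d / pi * N%:R]. *)
pose S := 2 * pi * K%:R : R; pose T := nuN * t + 4.
have S0 : 0 <= S by rewrite !mulr_ge0 // ltW.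
have ST : S <= T by rewrite /S /T; lra.
have sumE : \sum_(0 <= k < K.+1) (d * (4 * pi * k%:R + 3 * pi) / (2 * t ^+ 2) + 4) =
   d / (4 * pi) * (S ^+ 2 / t ^+ 2) + d / 2 * ((5 / 2 * S + 3 * pi) / t ^+ 2)
     + 4 * (K%:R + 1).
  rewrite /S; move: (pi : R) pn0 => p pn0.
  rewrite (eq_bigr (fun k : nat => d * 4 * p / (2 * t ^+ 2) * k%:R
    + (d * 3 * p / (2 * t ^+ 2) + 4))); last by move=> k _; field.
  by rewrite sum_affine; field; rewrite tn0 pn0.
have aux (a1 a2 a3 z w : R) : z + (a1 + a2 + a3) * w = (z + a1 * w) + a2 * w + a3 * w.
  by ring.
rewrite sumE aux; apply: lerD; last first.
  have : K%:R <= S.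
    by rewrite /S -[leLHS]mul1r ler_wpM2r ?ler0n //; lra.
  have := ler_wpM2r (ltW t0) nuN1; rewrite /T in ST; lra.
apply: lerD.
  have S2 : S ^+ 2 <= T ^+ 2.
    by rewrite lerXn2r ?nnegrE // (le_trans S0).
  have c1 : d / (4 * pi) <= 1 by rewrite ler_pdivrMr ?mulr_gt0 // mul1r; lra.
  have c0 : 0 <= d / (4 * pi) by rewrite divr_ge0 // mulr_ge0 // ltW.
  apply: (@le_trans _ _ (d / (4 * pi) * (T ^+ 2 / t ^+ 2))).
    by rewrite ler_wpM2l // ler_pM2r ?invr_gt0.
  have n2 : nuN ^+ 2 = 4 * N%:R + 2 by exact: nu_sqr.
  have -> : d / (4 * pi) * (T ^+ 2 / t ^+ 2) = d / pi * N%:R +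
      d / (4 * pi) * ((2 * t ^+ 2 + 8 * t * nuN + 16) / t ^+ 2).
    have -> : T ^+ 2 = (4 * N%:R + 2) * t ^+ 2 + 8 * t * nuN + 16.
      by rewrite -n2 /T; ring.
    move: (pi : R) pn0 => p pn0.
    by field; rewrite tn0 pn0.
  rewrite lerD2l.
  have z0 : 0 <= (2 * t ^+ 2 + 8 * t * nuN + 16) / t ^+ 2.
    rewrite divr_ge0 ?(ltW t20) //; have := mulr_ge0 (ltW t0) (ltW nuN0); lra.
  apply: (@le_trans _ _ (1 * ((2 * t ^+ 2 + 8 * t * nuN + 16) / t ^+ 2))).
    by rewrite ler_wpM2r.
  rewrite mul1r [leRHS]mulrAC ler_pM2r ?invr_gt0 //.
  have := ler_wpM2l (ltW t20) nuN1; lra.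
have z0 : 0 <= (5 / 2 * S + 3 * pi) / t ^+ 2 by rewrite divr_ge0 ?(ltW t20) //; lra.
apply: (@le_trans _ _ (2 * ((5 / 2 * S + 3 * pi) / t ^+ 2))).
  by rewrite ler_wpM2r //; lra.
rewrite [leLHS]mulrA [leRHS]mulrAC ler_pM2r ?invr_gt0 //.
have := ler_wpM2r (ltW t0) nuN1; rewrite /T in ST; lra.
Qed.

End equidistribution.

(** * Stability of arcs under small perturbations *)

Section arccosine_perturbation.
Context {R : realType}.
Implicit Types (a b u v e : R).

Lemma acos_le u be : -1 <= u <= 1 -> 0 <= be <= pi -> cos be <= u -> acos u <= be.
Proof.
move=> hu hb h; have [h1 h2] := acos_def hu.
have aI : acos u \in `[0, pi] by rewrite in_itv.
have bI : be \in `[0, pi] by rewrite in_itv.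
by rewrite leNgt -ltr_cos // h2 -leNgt.
Qed.

Lemma acos_ge u al : -1 <= u <= 1 -> 0 <= al <= pi -> u <= cos al -> al <= acos u.
Proof.
move=> hu hb h; have [h1 h2] := acos_def hu.
have aI : acos u \in `[0, pi] by rewrite in_itv.
have bI : al \in `[0, pi] by rewrite in_itv.
by rewrite leNgt -ltr_cos // h2 -leNgt.
Qed.

(** The margin is the strict decrease of [cos] from [acos a] to [acos a + e]. If the angle has to be
    clamped at [pi], the conclusion is just [-1 <= v]. *)
Lemma acos_margin_lo a e : -1 <= a <= 1 -> 0 < e ->
  exists2 eta, 0 < eta & forall u v, a <= u -> `|u - v| <= eta -> -1 <= v ->
    cos (Num.min pi (acos a + e)) <= v.
Proof.
move=> ha e0; have [/andP[a0 ap] ca] := acos_def ha.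
have [h|h] := leP pi (acos a + e).
  by exists 1 => // u v _ _; rewrite cospi.
exists (a - cos (acos a + e)).
  rewrite subr_gt0 -[ltRHS]ca ltr_cos ?in_itv /= ?a0 ?ap // ?ltrDl //.
  by rewrite (ltW h) andbT addr_ge0 // ltW.
by move=> u v au; rewrite ler_norml => /andP[_ h2] _; lra.
Qed.

Lemma acos_margin_hi b e : -1 <= b <= 1 -> 0 < e ->
  exists2 eta, 0 < eta & forall u v, u <= b -> `|u - v| <= eta -> v <= 1 ->
    v <= cos (Num.max 0 (acos b - e)).
Proof.
move=> hb e0; have [/andP[b0 bp] cb] := acos_def hb.
have [h|h] := leP (acos b - e) 0.
  by exists 1 => // u v _ _; rewrite cos0.
exists (cos (acos b - e) - b).
  rewrite subr_gt0 -[ltLHS]cb ltr_cos ?in_itv /= ?b0 ?bp // ?gtrBl //.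
  by rewrite (ltW h) /=; lra.
by move=> u v au; rewrite ler_norml => /andP[h2 _] _; lra.
Qed.

Lemma acos_continuous_within a e : -1 <= a <= 1 -> 0 < e ->
  exists2 eta, 0 < eta & forall v, -1 <= v <= 1 -> `|a - v| <= eta ->
    `|acos a - acos v| <= e.
Proof.
move=> ha e0; have [/andP[a0 ap] ca] := acos_def ha.
have [eta1 h1 H1] := acos_margin_lo ha e0; have [eta2 h2 H2] := acos_margin_hi ha e0.
exists (Num.min eta1 eta2); first by rewrite lt_min h1.
move=> v hv; rewrite le_min => /andP[g1 g2]; have /andP[v1 v2] := hv.
have := H1 a v (lexx _) g1 v1; have := H2 a v (lexx _) g2 v2.
have p0 := @pi_ge0 R.
move=> /(acos_ge hv) k2 /(acos_le hv) k1.
have : acos v <= Num.min pi (acos a + e).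
  apply: k1; rewrite le_min p0 /= ge_min lexx /= andbT; lra.
have : Num.max 0 (acos a - e) <= acos v.
  apply: k2; rewrite le_max lexx /= ge_max p0 /=; lra.
rewrite ge_max le_min => /andP[_ i1] /andP[_ i2].
by rewrite ler_norml; apply/andP; split; lra.
Qed.

End arccosine_perturbation.

(** * Limiting frequencies *)

Section limiting_distribution.
Context {R : realType}.
Variables (t eps : R) (y : nat -> R).
Hypotheses (t0 : 0 < t) (eps1 : `|eps| = 1).
Let x n : R := eps * (-1) ^+ n * cos (nu n * t - pi / 4).
Hypothesis yx : (fun n => y n - x n) @ \oo --> (0 : R).

Let x1 n : -1 <= x n <= 1.
Proof.
rewrite -ler_norml normrM normrM eps1 normrX normrN1 expr1n !mul1r.
exact: cos_max.
Qed.

(** Beyond some index [y] and [x] differ by at most [eta], so the count for [y] is bounded by an arc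
    count for [x]. The indices before it and the error of order N^(1/2) are absorbed in
    [e * N%:R]. *)
Lemma count_perturbed (p : R -> bool) (al be eta e : R) :
  0 <= al -> al <= be -> be <= pi -> 0 < eta -> 0 < e ->
  (forall u v, p u -> `|u - v| <= eta -> -1 <= v <= 1 -> cos be <= v <= cos al) ->
  \forall N \near \oo,
    \sum_(0 <= n < N) (p (y n))%:R <= ((be - al) / pi + e) * N%:R.
Proof.
move=> al0 ab bp eta0 e0 hp.
have [C HC] := count_phase t0 eps1 al0 ab bp.
move/cvgr0Pnorm_le: yx => /(_ _ eta0) [n0 _ hn0].
have key N : \sum_(0 <= n < N) (p (y n))%:R <=
    n0%:R + 1 + ((be - al) / pi * N%:R + C * nu N).
  apply: (@le_trans _ _ (\sum_(0 <= n < N)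
    ((((0 : R) <= n%:R) && (n%:R <= n0%:R :> R))%:R +
     ((cos be <= x n <= cos al)%R : bool)%:R))).
    apply: ler_sum => n _; rewrite -natrD ler_nat ler0n ler_nat /=.
    have [_|nn] := leqP n n0; first by case: (p (y n)).
    rewrite add0n; apply: leq_b1_imp => pn.
    by apply: hp pn _ (x1 n); apply: hn0; rewrite /= ltnW.
  rewrite big_split /=; apply: lerD (HC N).
  by apply: (le_trans (count_itv N (ler0n R n0))); rewrite subr0.
near=> N.
have N1 : 1 <= root16 N :> R by near: N; exact: root16_large.
have N2 : (n0%:R + 1 + 3 * `|C|) / e <= root16 N by near: N; exact: root16_large.
have r16 := @root16_X16 R N.
set r := root16 N in N1 N2 r16.
have r0 : 0 < r by apply: lt_le_trans N1.
have r8 : 0 < r ^+ 8 by rewrite exprn_gt0.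
have r81 : 1 <= r ^+ 8 by rewrite exprn_ege1.
have r8r : r <= r ^+ 8 by rewrite -{1}(expr1 r); apply: ler_weXn2l.
have rr : r ^+ 16 = r ^+ 8 * r ^+ 8 by rewrite -exprD.
have nuN : nu N <= 3 * r ^+ 8.
  have r83 : 0 <= 3 * r ^+ 8 by rewrite pmulr_rge0 // ltW.
  rewrite -(@ler_pXn2r _ 2) ?nnegrE ?sqrtr_ge0 //.
  rewrite nu_sqr exprMn [(r ^+ 8) ^+ 2]expr2 -rr r16.
  have : 1 * 1 <= r ^+ 8 * r ^+ 8 by apply: ler_pM.
  by rewrite -rr r16; lra.
apply: (le_trans (key N)); rewrite [leRHS]mulrDl.
have h1 : C * nu N <= `|C| * (3 * r ^+ 8).
  apply: (@le_trans _ _ (`|C| * nu N)); first by rewrite ler_wpM2r ?sqrtr_ge0 ?ler_norm.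
  by rewrite ler_wpM2l.
have h2 : (n0%:R + 1) * 1 <= (n0%:R + 1) * r ^+ 8 by rewrite ler_wpM2l ?addr_ge0.
have h3 : n0%:R + 1 + 3 * `|C| <= r ^+ 8 * e.
  by rewrite -ler_pdivrMr //; apply: le_trans r8r.
have h4 := ler_wpM2r (ltW r8) h3.
have h5 : e * N%:R = r ^+ 8 * e * r ^+ 8 by rewrite -r16 rr; ring.
rewrite h5; lra.
Unshelve. all: by end_near. Qed.

Lemma limiting_frequency (a b : R) : -1 <= a -> a <= b -> b <= 1 ->
  (fun N => (N%:R)^-1 * \sum_(0 <= n < N.+1) ((a <= y n) && (y n <= b))%:R) @ \oo
  --> (acos a - acos b) / pi.
Proof.
move=> a1 ab b1; have ha : -1 <= a <= 1 by rewrite a1 (le_trans ab).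
have hb : -1 <= b <= 1 by rewrite b1 (le_trans a1).
have p0 := @pi_gt0 R; have p1 := @pihalf_ge1 R.
have [/andP[A0 Ap] ca] := acos_def ha; have [/andP[B0 Bp] cb] := acos_def hb.
have AB : acos b <= acos a by apply: acos_le; rewrite ?A0 ?Ap // ca.
apply/cvgrPdist_le => e e0.
(* Each of the three upper frequencies exceeds its limit by at most [2 * e']. The lower estimate
   subtracts two of them; the upper one adds the last index [n = N], at most [e' * N%:R]. *)
pose e' := e / 8; have e'0 : 0 < e' by rewrite divr_gt0.
pose A := acos a / pi; pose B := acos b / pi.
have LE : (acos a - acos b) / pi = A - B by rewrite /A /B mulrBl.
have small z : z <= 2 * e' -> z / pi <= e'.
  move=> hz; rewrite ler_pdivrMr // mulrC; apply: (le_trans hz).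
  by rewrite ler_wpM2r ?(ltW e'0) //; lra.
have q1 : (Num.min pi (acos a + e') - Num.max 0 (acos b - e')) / pi <= A - B + e'.
  have : Num.min pi (acos a + e') - Num.max 0 (acos b - e') - (acos a - acos b) <= 2 * e'.
    have m1 : Num.min pi (acos a + e') <= acos a + e' by rewrite ge_min lexx orbT.
    have m2 : acos b - e' <= Num.max 0 (acos b - e') by rewrite le_max lexx orbT.
    lra.
  by move/small; rewrite mulrBl LE; lra.
have q2 : (pi - Num.max 0 (acos a - e')) / pi <= 1 - A + e'.
  have : pi - Num.max 0 (acos a - e') - (pi - acos a) <= 2 * e'.
    have m2 : acos a - e' <= Num.max 0 (acos a - e') by rewrite le_max lexx orbT.
    lra.
  by move/small; rewrite mulrBl [(pi - acos a) / pi]mulrBl divff ?gt_eqF // -/A; lra.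
have q3 : (Num.min pi (acos b + e') - 0) / pi <= B + e'.
  have : Num.min pi (acos b + e') - 0 - acos b <= 2 * e'.
    have m1 : Num.min pi (acos b + e') <= acos b + e' by rewrite ge_min lexx orbT.
    lra.
  by move/small; rewrite mulrBl -/B; lra.
have [l1 l10 Hl1] := acos_margin_lo ha e'0; have [h1 h10 Hh1] := acos_margin_hi hb e'0.
have [l2 l20 Hl2] := acos_margin_lo hb e'0; have [h2 h20 Hh2] := acos_margin_hi ha e'0.
have U1 : \forall N \near \oo, \sum_(0 <= n < N) ((a <= y n) && (y n <= b))%:R <=
   ((Num.min pi (acos a + e') - Num.max 0 (acos b - e')) / pi + e') * N%:R.
  apply: (@count_perturbed (fun u => (a <= u) && (u <= b)) _ _ (Num.min l1 h1)).
  - by rewrite le_max lexx.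
  - by rewrite ge_max !le_min (ltW p0) /=; clear -A0 Ap B0 Bp AB e'0 p0; apply/and3P; split; lra.
  - by rewrite ge_min lexx.
  - by rewrite lt_min l10.
  - exact: e'0.
  - move=> u v /andP[au ub]; rewrite le_min => /andP[g1 g2] /andP[v1 v2].
    by rewrite (Hl1 u v) // (Hh1 u v).
have U2 : \forall N \near \oo, \sum_(0 <= n < N) ((y n <= a)%R : bool)%:R <=
   ((pi - Num.max 0 (acos a - e')) / pi + e') * N%:R.
  apply: (@count_perturbed (fun u => u <= a) _ _ h2) => //.
  - by rewrite le_max lexx.
  - by rewrite ge_max (ltW p0) /=; lra.
  - by move=> u v au g1 /andP[v1 v2]; rewrite cospi v1 (Hh2 u v).
have U3 : \forall N \near \oo, \sum_(0 <= n < N) ((b <= y n)%R : bool)%:R <=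
   ((Num.min pi (acos b + e') - 0) / pi + e') * N%:R.
  apply: (@count_perturbed (fun u => b <= u) _ _ l2) => //.
  - by rewrite le_min (ltW p0) /=; lra.
  - by rewrite ge_min lexx.
  - by move=> u v au g1 /andP[v1 v2]; rewrite cos0 v2 (Hl2 u v).
near=> N.
have V1 : \sum_(0 <= n < N) ((a <= y n) && (y n <= b))%:R <=
   ((Num.min pi (acos a + e') - Num.max 0 (acos b - e')) / pi + e') * N%:R.
  by near: N; exact: U1.
have V2 : \sum_(0 <= n < N) ((y n <= a)%R : bool)%:R <=
   ((pi - Num.max 0 (acos a - e')) / pi + e') * N%:R by near: N; exact: U2.
have V3 : \sum_(0 <= n < N) ((b <= y n)%R : bool)%:R <=
   ((Num.min pi (acos b + e') - 0) / pi + e') * N%:R by near: N; exact: U3.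
have N1 : 1 / e' <= root16 N by near: N; exact: root16_large.
have N2 : 1 <= root16 N :> R by near: N; exact: root16_large.
have N0 : 1 / e' <= N%:R.
  apply: (le_trans N1); rewrite -root16_X16 -{1}(expr1 (root16 N)).
  exact: ler_weXn2l.
have N00 : 0 < N%:R :> R by apply: lt_le_trans N0; rewrite divr_gt0.
have eN : 1 <= e' * N%:R by rewrite mulrC -ler_pdivrMr.
have total : N%:R <= \sum_(0 <= n < N) ((a <= y n) && (y n <= b))%:R +
    \sum_(0 <= n < N) ((y n <= a)%R : bool)%:R + \sum_(0 <= n < N) ((b <= y n)%R : bool)%:R :> R.
  rewrite -!big_split /= -[X in X%:R <= _]subn0 -sumr_const_nat.
  apply: ler_sum => n _; rewrite -!natrD ler1n.
  by clear; have [|/ltW ->] := leP a (y n); have [|/ltW ->] := leP (y n) b; rewrite ?addn1 ?addnS.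
rewrite big_nat_recr //=.
set S := \sum_(0 <= n < N) _ in V1 total *; set c := (_ && _)%:R.
have c01 : 0 <= c <= 1 by rewrite ler0n lern1 leq_b1.
have N0' := ltW N00.
have w1 := ler_wpM2r N0' q1; have w2 := ler_wpM2r N0' q2; have w3 := ler_wpM2r N0' q3.
rewrite LE distrC -(ler_pM2r N00) -[X in _ * X <= _](gtr0_norm N00) -normrM.
rewrite mulrBl mulrAC mulVf ?gt_eqF // mul1r ler_norml.
rewrite /e' in eN V1 V2 V3 w1 w2 w3 *.
move: c01 => /andP[c0 c1].
have eE : 0 <= e * N%:R by rewrite mulr_ge0 // ltW.
clear -V1 V2 V3 w1 w2 w3 total c0 c1 eE eN; apply/andP; split; lra.
Unshelve. all: by end_near. Qed.

End limiting_distribution.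

(** * The limiting density *)

Section arcsine_density.
Context {R : realType}.
Variables (A : R).
Hypothesis A0 : 0 < A.
Implicit Types (x y : R).
Let f y : R := (pi * Num.sqrt (A ^+ 2 - y ^+ 2))^-1.
Let F y : R := - acos (y / A) / pi.

Let gap y : - A < y < A -> 0 < A ^+ 2 - y ^+ 2.
Proof.
move=> /andP[h1 h2]; rewrite subr_sqr.
by have := mulr_gt0 (_ : 0 < A - y) (_ : 0 < A + y); apply; lra.
Qed.

Let scaled y : - A <= y <= A -> -1 <= y / A <= 1.
Proof. by rewrite ler_pdivrMr // ler_pdivlMr // mulN1r mul1r. Qed.

Let is_derive_F y : - A < y < A -> is_derive y 1 F (f y).
Proof.
move=> hy; have yA : -1 < y / A < 1 by rewrite ltr_pdivrMr // ltr_pdivlMr // mulN1r mul1r.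
have g0 := gap hy.
have hA : is_derive y (1 : R) (fun z : R => z / A) (1 * A^-1 + y * 0).
  exact: isdM (isdI y) (isdC A^-1 y).
have hac := @isd_comp _ _ (fun z => z / A) _ _ _ (is_derive1_acos yA) hA.
have h : is_derive y (1 : R) F (- (- (Num.sqrt (1 - (y / A) ^+ 2))^-1 *
    (1 * A^-1 + y * 0)) * pi^-1 + - acos (y / A) * 0).
  exact: isdM (isdN hac) (isdC pi^-1 y).
eapply isdE; first exact: h.
have -> : 1 - (y / A) ^+ 2 = (A ^+ 2 - y ^+ 2) / A ^+ 2 by field; rewrite gt_eqF.
rewrite sqrtrM ?(ltW g0) // sqrtrV ?exprn_ge0 ?(ltW A0) // sqrtr_sqr (gtr0_norm A0).
move: g0; rewrite -sqrtr_gt0 /f => s0; have := @pi_gt0 R.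
move: (pi : R) (Num.sqrt _) s0 => p s s0 pp0.
by field; rewrite !gt_eqF.
Qed.

Let continuous_f y : - A < y < A -> {for y, continuous f}.
Proof.
move=> hy; have g0 := gap hy; apply: cvgV.
  by rewrite mulf_neq0 ?gt_eqF ?pi_gt0 ?sqrtr_gt0.
apply: cvgMr; apply: (@cvg_comp _ _ _ (fun y => A ^+ 2 - y ^+ 2) Num.sqrt); last exact: sqrt_continuous.
by apply: cvgB; [exact: cvg_cst|exact: exprn_continuous].
Qed.

Let integral_inner a b : - A < a -> a < b -> b < A ->
  (\int[lebesgue_measure]_(y in `[a, b]) (f y)%:E = (F b - F a)%:E)%E.
Proof.
move=> a1 ab b1.
have I x : a <= x <= b -> - A < x < A by move=> /andP[? ?]; apply/andP; split; lra.
have cF x : a <= x <= b -> {for x, continuous F}.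
  move=> /I /is_derive_F [hx _].
  by apply: differentiable_continuous; apply/derivable1_diffP.
rewrite EFinB; apply: continuous_FTC2 => //.
- by apply: continuous_in_subspaceT => x; rewrite inE/= in_itv/= => /I/continuous_f.
- split.
  + by move=> x; rewrite in_itv/= => /andP[x1 x2]; have [] := @is_derive_F x; rewrite ?(I x)// !ltW.
  + by apply: cvg_at_right_filter; apply: cF; rewrite lexx ltW.
  + by apply: cvg_at_left_filter; apply: cF; rewrite lexx ltW.
- move=> x; rewrite in_itv/= => /andP[x1 x2]; have hx : - A < x < A by rewrite I // !ltW.
  by rewrite derive1E; have -> := @derive_val _ _ _ _ _ _ _ (is_derive_F hx).
Qed.

(** At the end points [- A] and [A] the density is unbounded and the primitive is not
    differentiable. The fundamental theorem is applied on inner intervals, and monotone convergence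
    meets the continuity of [acos] in the limit. *)
Lemma integral_arcsine_density (al be : R) : - A <= al -> al <= be -> be <= A ->
  (\int[lebesgue_measure]_(y in `[al, be]) ((pi * Num.sqrt (A ^+ 2 - y ^+ 2))^-1)%:E =
   ((acos (al / A) - acos (be / A)) / pi)%:E)%E.
Proof.
move=> a1 ab b1; have p0 := @pi_gt0 R.
move: ab; rewrite le_eqVlt => /orP[/eqP <-|ab].
  by rewrite set_itv1 integral_set1 subrr mul0r.
(* The offset 3 keeps every inner interval nondegenerate, also for [n = 0]. *)
pose d n : R := (be - al) / n.+3%:R.
have d0 n : 0 < d n by rewrite divr_gt0 ?subr_gt0.
have d3 n : 3 * d n <= be - al.
  by rewrite /d mulrCA ler_piMr ?subr_ge0 ?(ltW ab) // ler_pdivrMr // mul1r ler_nat.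
pose E n := [set` `[al + d n, be - d n]].
have dE n m : (n <= m)%N -> d m <= d n.
  move=> nm; rewrite /d ler_wpM2l ?subr_ge0 ?(ltW ab) // lef_pV2 ?posrE // ler_nat.
  by rewrite !ltnS.
have mE n : measurable (E n) by exact: measurable_itv.
have inn n x : E n x -> - A < x < A.
  rewrite /E /= in_itv/= => /andP[x1 x2]; have := d0 n => dn.
  by apply/andP; split; lra.
have mfI : measurable_fun `]al, be[ (EFin \o f).
  apply/measurable_EFinP; apply: open_continuous_measurable_fun => //.
  move=> x; rewrite inE/= in_itv/= => /andP[x1 x2]; apply: continuous_f.
  by apply/andP; split; lra.
have bU : \bigcup_n E n = `]al, be[%classic.
  apply/seteqP; split => x.
    move=> [n _]; rewrite /E /= !in_itv/= => /andP[x1 x2]; have := d0 n => dn.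
    by apply/andP; split; lra.
  rewrite /= in_itv/= => /andP[x1 x2].
  have m0 : 0 < Num.min (x - al) (be - x) by rewrite lt_min !subr_gt0 x1.
  pose n := Num.truncn ((be - al) / Num.min (x - al) (be - x)).
  exists n => //; rewrite /E /= in_itv /=.
  have : d n <= Num.min (x - al) (be - x).
    rewrite /d ler_pdivrMr // mulrC -ler_pdivrMr //.
    by apply: le_trans (ltW (truncnS_gt _)) _; rewrite ler_nat -/n; apply/leqW/leqW.
  by rewrite le_min => /andP[h1 h2]; apply/andP; split; lra.
have step n : (\int[lebesgue_measure]_(y in E n) (f y)%:E = (F (be - d n) - F (al + d n))%:E)%E.
  by have := d0 n; have := d3 n => h1 h2; apply: integral_inner; lra.
have C1 : (\int[lebesgue_measure]_(y in E n) (f y)%:E)%E @[n --> \oo] -->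
    (\int[lebesgue_measure]_(y in `]al, be[) (f y)%:E)%E.
  rewrite -bU; apply: ge0_nondecreasing_set_cvg_integral => //.
  - move=> n m nm; rewrite subsetEset => x; rewrite /E/= !in_itv/= => /andP[x1 x2].
    by have := dE _ _ nm => h; apply/andP; split; lra.
  - move=> n; apply: measurable_funS mfI => // x; rewrite /E/= !in_itv/= => /andP[x1 x2].
    by have := d0 n => h; apply/andP; split; lra.
  - by move=> n x _; rewrite lee_fin invr_ge0 mulr_ge0 ?sqrtr_ge0 // ltW.
have C2 : (fun n => F (be - d n) - F (al + d n)) @ \oo --> F be - F al.
  have dc : d @ \oo --> (0 : R).
    rewrite -(mulr0 (be - al)).
    have -> : d = (fun n => (be - al) * [sequence harmonic (k + 2)%N]_k n).
      by apply/funext => n; rewrite /d /= addn2.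
    by apply: cvgMr; rewrite cvg_shiftn; exact: cvg_harmonic.
  have cv u v : -A <= v <= A -> (forall n, - A <= u n <= A) -> (forall n, `|v - u n| <= d n) ->
      (fun n => F (u n)) @ \oo --> F v.
    move=> hv hu uv; apply: cvgMl; apply: cvgN; apply/cvgrPdist_le => e e0.
    have [eta eta0 H] := acos_continuous_within (scaled hv) e0.
    move/cvgr0Pnorm_le: dc => /(_ _ (mulr_gt0 eta0 A0)) [N _ HN].
    exists N => // n Nn; apply: H; first exact: scaled.
    rewrite -mulrBl normrM normfV (gtr0_norm A0) ler_pdivrMr //.
    by apply: (le_trans (uv n)); have := HN n Nn; rewrite gtr0_norm.
  apply: cvgB; apply: cv.
  - by apply/andP; split; lra.
  - by move=> n; have := d0 n; have := d3 n => h1 h2; apply/andP; split; lra.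
  - by move=> n; rewrite opprB addrC subrK gtr0_norm.
  - by apply/andP; split; lra.
  - by move=> n; have := d0 n; have := d3 n => h1 h2; apply/andP; split; lra.
  - by move=> n; rewrite opprD addrA subrr sub0r normrN gtr0_norm.
have C3 : (\int[lebesgue_measure]_(y in E n) (f y)%:E)%E @[n --> \oo] --> (F be - F al)%:E.
  under eq_fun do rewrite step.
  by apply: cvg_EFin C2; apply: nearW.
rewrite (integral_itv_bndoo _ _ mfI).
rewrite (cvg_unique _ C1 C3) //.
by rewrite /F -mulrBl opprK addrC.
Qed.

End arcsine_density.

(** * Arcsine law for the rescaled eigenvalue shifts *)

Theorem theorem1p2 (R : realType) (Delta g : R) (s : bool)
  (m : int) (E : int -> R) (alpha beta : R) :
  0 < Delta -> 0 < g ->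
  (* E_m < E_{m+1} < ... is the increasing enumeration of the spectrum *)
  (forall i j : int, (m <= i)%R -> (i < j)%R -> E i < E j) ->
  (forall x : R, rabi_eigenvalue s Delta g x <-> exists n : int, (m <= n)%R /\ E n = x) ->
  (* indexing normalized so that E_n = n - g^2 + o(1) *)
  (fun n : nat => E n%:Z - (n%:R - g ^+ 2)) @ \oo --> (0 : R) ->
  - (Delta / Num.sqrt (2 * pi * g)) <= alpha -> alpha <= beta ->
  beta <= Delta / Num.sqrt (2 * pi * g) ->
  (fun N : nat =>
     ((N%:R)^-1 * \sum_(n < N.+1)
        (if (alpha <= rabi_delta g E n) && (rabi_delta g E n <= beta)
         then 1 else 0) : R)%:E)
  @ \oo -->
  (\int[lebesgue_measure]_(y in `[alpha, beta])
     ((pi * Num.sqrt (Delta ^+ 2 / (2 * pi * g) - y ^+ 2))^-1)%:E)%E.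
Proof.
move=> D0 g0 _ spec E0 a1 ab b1.
have osc := eigenvalue_oscillation D0 g0 spec E0.
have pg0 : 0 < 2 * pi * g by rewrite !mulr_gt0 ?pi_gt0.
set A := Delta / Num.sqrt (2 * pi * g) in a1 b1 osc.
have A0 : 0 < A by rewrite divr_gt0 ?sqrtr_gt0.
have -> : Delta ^+ 2 / (2 * pi * g) = A ^+ 2.
  by rewrite /A expr_div_n sqr_sqrtr // ltW.
rewrite integral_arcsine_density //.
apply: cvg_EFin; first by apply: nearW.
have eps1 : `|(if s then 1 else -1) : R| = 1 by case: (s); rewrite ?normrN normr1.
have t0 : 0 < 2 * g by rewrite mulr_gt0.
have aA : -1 <= alpha / A by rewrite ler_pdivlMr // mulN1r.
have bA : beta / A <= 1 by rewrite ler_pdivrMr // mul1r.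
have abA : alpha / A <= beta / A by rewrite ler_pM2r ?invr_gt0.
have L := limiting_frequency t0 eps1 osc aA abA bA.
apply: cvg_trans L; apply: near_eq_cvg; apply: nearW => N /=.
congr (_ * _); rewrite big_mkord; apply: eq_bigr => n _.
by rewrite !ler_pM2r ?invr_gt0 //; case: (_ && _).
Qed.
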